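(* The hybrid network dynamics $$\dot{x}=-\nabla_x f(x)-(L\otimes I_l)x-(L\otimes I_l)\alpha-y_{H_3},\qquad \dot a_{iq}=d_{iq}(e_{iq}^Te_{iq}+\dot e_{iq}^T\dot e_{iq})\ (i\in\mathcal N,\,q\in\mathcal N_i),$$ $$\dot\alpha=(L\otimes I_l)x,\qquad \dot\theta^{ik}_j=[g_j(x_{ik})]^+_{\theta^{ik}_j}\ (i\in\mathcal N,\ k=1,\dots,l,\ j=1,\dots,m_g^{ik}),$$ where $y_{H_3}=\big(\sum_{j=1}^{m_g^{ik}}\theta^{ik}_j\nabla g_j(x_{ik})\big)_{i,k}\in\mathbb R^{ln}$, converges to the saddle point solution $(x^*,\alpha^*,\theta^* )$ satisfying the KKT conditions: for all $i\in\mathcal N$, $k=1,\dots,l$, $j=1,\dots,m_g^{ik}$, $$\nabla_{x_{ik}}f_i(x^*_{ik})+\sum_{q\in\mathcal N_i}a_{iq}(\alpha^*_{ik}-\alpha^*_{qk})+\sum_{j=1}^{m_g^{ik}}(\theta^{ik}_j)^*\nabla g_j(x^*_{ik})=0,$$ $$g_j(x^*_{ik})\le0,\quad(\theta^{ik}_j)^*\ge0,\quad(\theta^{ik}_j)^*g_j(x^*_{ik})=0,\quad x^*_{ik}=x^*_{qk}\ \ (i,q\in\mathcal N).$$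
   Context: Graph: $\mathcal G=(\mathcal N,\mathcal E)$ is an undirected connected graph, $\mathcal N=\{1,\dots,n\}$, $\mathcal N_i$ the neighbor set of $i$, with coupling weights $a_{iq}=a_{qi}>0$ for $(i,q)\in\mathcal E$ and $a_{iq}=0$ otherwise; $L$ is the weighted Laplacian, time-varying because the weights evolve. $d_{iq}=d_{qi}>0$ are adaptive gains, $e_{iq}=x_i-x_q$; the right-hand side of the weight law, as a function of $(e_{iq},\dot e_{iq})$, is assumed Lipschitz continuous. For scalars, $[a]^+_b:=a$ if $b>0$ or $a>0$, and $0$ otherwise. The multipliers satisfy $\theta^{ik}_j\ge0$. $\nabla_{x_{ik}}f_i(x^*_{ik})$ denotes the partial derivative of $f_i$ with respect to $x_{ik}$ at $x_i^*$. The dynamics is associated with the problem: minimize $f(x)=\sum_{i=1}^n f_i(x_i)$, $x_i=[x_{i1},\dots,x_{il}]^T\in\mathbb R^l$, $x=[x_1^T,\dots,x_n^T]^T\in\mathbb R^{ln}$, subject to $x_{ik}=x_{qk}$ for all $i,q\in\mathcal N$, $k=1,\dots,l$ and $g_j(x_{ik})\le0$ for $j=1,\dots,m_g^{ik}$, all $k$, $i$. The $f_i$ are twice differentiable and strongly convex, the $g_j:\mathbb R\to\mathbb R$ convex (and differentiable), and Slater's condition and strong duality hold. It is assumed that $f$ is $\mu$-strongly convex and $\kappa$-smooth: $\mu\|x_1-x_2\|^2\le\langle\nabla f(x_1)-\nabla f(x_2),x_1-x_2\rangle\le\kappa\|x_1-x_2\|^2$ for all $x_1,x_2\in\mathbb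 R^{ln}$. *)

(* Defs.v *)
From HB Require Import structures.
From mathcomp Require Import all_boot all_order all_algebra.
From mathcomp Require Import all_classical all_reals all_analysis.

Set Implicit Arguments.
Unset Strict Implicit.
Unset Printing Implicit Defensive.

Import Order.TTheory GRing.Theory Num.Theory.
Import numFieldNormedType.Exports.

Local Open Scope classical_set_scope.
Local Open Scope ring_scope.

(* A vector x = [x_1^T, ..., x_n^T]^T of R^(ln) is represented by the n x l
   matrix X whose i-th row is x_i.  In this representation (L (x) I_l) x is the
   matrix product L *m X, and the Euclidean inner product of R^(ln) is the
   entrywise one below (the library norm on matrices is the sup norm). *)
Definition inner (R : realType) (p q : nat) (A B : 'M[R]_(p, q)) : R :=
  \sum_i \sum_j A i j * B i j.

Definition sqnorm (R : realType) (p q : nat) (A : 'M[R]_(p, q)) : R := inner A A.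

Definition gradient (R : realType) (p q : nat) (F : 'M[R]_(p, q) -> R)
    (X : 'M[R]_(p, q)) : 'M[R]_(p, q) :=
  \matrix_(i, k) 'D_(delta_mx i k) F X.

Definition twice_differentiable (R : realType) (p q : nat)
    (F : 'M[R]_(p, q) -> R) : Prop :=
  (forall X, differentiable F X) /\
  (forall V X, differentiable (fun Y => 'D_V F Y) X).

Definition strongly_convex (R : realType) (p q : nat)
    (F : 'M[R]_(p, q) -> R) : Prop :=
  exists2 c : R, 0 < c & forall (X Y : 'M[R]_(p, q)) (t : R), 0 <= t <= 1 ->
    F (t *: X + (1 - t) *: Y) <=
      t * F X + (1 - t) * F Y - c / 2 * (t * (1 - t)) * sqnorm (X - Y).

Definition strongly_convex_smooth (R : realType) (p q : nat) (mu kappa : R)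
    (F : 'M[R]_(p, q) -> R) : Prop :=
  forall X Y : 'M[R]_(p, q),
    mu * sqnorm (X - Y) <= inner (gradient F X - gradient F Y) (X - Y)
      <= kappa * sqnorm (X - Y).

Definition connected_graph (n : nat) (e : rel 'I_n) : Prop :=
  [/\ symmetric e, irreflexive e & forall i q, connect e i q].

Definition coupling_weights (R : realType) (n : nat) (e : rel 'I_n)
    (a : 'M[R]_n) : Prop :=
  forall i q, a i q = a q i /\ (if e i q then 0 < a i q else a i q == 0).

Definition laplacian (R : realType) (n : nat) (a : 'M[R]_n) : 'M[R]_n :=
  \matrix_(i, q) (if i == q then \sum_r a i r else - a i q).

(* One multiplier theta^{ik}_j, respectively one constraint function, for every
   i, k and j < m i k. *)
Definition multipliers (R : realType) (n l : nat) (m : 'I_n -> 'I_l -> nat) :=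
  forall (i : 'I_n) (k : 'I_l), 'I_(m i k) -> R.
Definition constraints (R : realType) (n l : nat) (m : 'I_n -> 'I_l -> nat) :=
  forall (i : 'I_n) (k : 'I_l), 'I_(m i k) -> R -> R.

Section Problem.
Variables (R : realType) (n l : nat) (m : 'I_n -> 'I_l -> nat).
Variables (f : 'I_n -> 'rV[R]_l -> R) (g : constraints R m).
Arguments g : clear implicits.

Definition objective (X : 'M[R]_(n, l)) : R := \sum_i f i (row i X).

Definition nonneg (th : multipliers R m) : Prop := forall i k j, 0 <= th i k j.

Definition consensus (X : 'M[R]_(n, l)) : Prop :=
  forall i q k, X i k = X q k.

Definition feasible (X : 'M[R]_(n, l)) : Prop :=
  consensus X /\ forall i k j, g i k j (X i k) <= 0.

Definition slater : Prop :=
  exists X : 'M[R]_(n, l), consensus X /\ forall i k j, g i k j (X i k) < 0.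

Definition ineq_term (X : 'M[R]_(n, l)) (th : multipliers R m) : R :=
  \sum_i \sum_k \sum_j th i k j * g i k j (X i k).

(* The Lagrangian of the optimization problem: nu i q k is the multiplier of
   the constraint x_ik - x_qk = 0. *)
Definition problem_lagrangian (X : 'M[R]_(n, l))
    (nu : 'I_n -> 'I_n -> 'I_l -> R) (th : multipliers R m) : R :=
  objective X + \sum_i \sum_q \sum_k nu i q k * (X i k - X q k)
    + ineq_term X th.

Definition primal_value : \bar R :=
  ereal_inf [set (objective X)%:E | X in feasible].

Definition dual_function (nu : 'I_n -> 'I_n -> 'I_l -> R)
    (th : multipliers R m) : \bar R :=
  ereal_inf (range (fun X => (problem_lagrangian X nu th)%:E)).

Definition dual_value : \bar R :=
  ereal_sup [set v | exists nu th, nonneg th /\ v = dual_function nu th].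

Definition strong_duality : Prop := dual_value = primal_value.

(* The Lagrangian in the variables of the network: the consensus constraint is
   written (L (x) I_l) x = 0, with multiplier alpha. *)
Definition network_lagrangian (a : 'M[R]_n) (X alpha : 'M[R]_(n, l))
    (th : multipliers R m) : R :=
  objective X + inner alpha (laplacian a *m X) + ineq_term X th.

Definition saddle_point (a : 'M[R]_n) (xs alphas : 'M[R]_(n, l))
    (ths : multipliers R m) : Prop :=
  nonneg ths /\
  forall (X alpha : 'M[R]_(n, l)) (th : multipliers R m), nonneg th ->
    network_lagrangian a xs alpha th <= network_lagrangian a xs alphas ths
      <= network_lagrangian a X alphas ths.

Definition kkt (e : rel 'I_n) (a : 'M[R]_n) (xs alphas : 'M[R]_(n, l))
    (ths : multipliers R m) : Prop :=
  [/\ forall i k,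
        'D_(delta_mx 0 k) (f i) (row i xs)
          + \sum_(q | e i q) a i q * (alphas i k - alphas q k)
          + \sum_j ths i k j * derive1 (g i k j) (xs i k) = 0,
      forall i k j, g i k j (xs i k) <= 0,
      forall i k j, 0 <= ths i k j,
      forall i k j, ths i k j * g i k j (xs i k) = 0
    & forall i q k, xs i k = xs q k].

(* y_{H_3} *)
Definition constraint_force (X : 'M[R]_(n, l)) (th : multipliers R m) :
    'M[R]_(n, l) :=
  \matrix_(i, k) \sum_j th i k j * derive1 (g i k j) (X i k).

(* [b]^+_c *)
Definition pos_proj (b c : R) : R := if (0 < c) || (0 < b) then b else 0.

(* The right-hand side of the law of a weight, as a function of
   (e_iq, d/dt e_iq). *)
Definition weight_rate (d : R) (p : 'rV[R]_l * 'rV[R]_l) : R :=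
  d * (sqnorm p.1 + sqnorm p.2).

(* Being quadratic, weight_rate is not globally Lipschitz as soon as d != 0 and
   0 < l; Lipschitz continuity is meant on bounded sets. *)
Definition lipschitz_on_bounded (F : 'rV[R]_l * 'rV[R]_l -> R) : Prop :=
  forall r : R, [lipschitz F p | p in [set p | `|p| <= r]].

Definition disagreement (x : R -> 'M[R]_(n, l)) (i q : 'I_n) (t : R) :
    'rV[R]_l :=
  row i (x t) - row q (x t).

(* A solution on [0, +oo[; the values at negative times are irrelevant.
   The right-hand sides for x, a and alpha are continuous along a solution,
   hence classical derivatives.  The one for theta is discontinuous, hence a
   Caratheodory solution, i.e. a solution of the integral equation. *)
Record hybrid_solution (e : rel 'I_n) (d : 'M[R]_n)
    (x : R -> 'M[R]_(n, l)) (a : R -> 'M[R]_n) (alpha : R -> 'M[R]_(n, l))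
    (th : R -> multipliers R m) : Prop := HybridSolution {
  sol_weights : forall t, 0 <= t -> coupling_weights e (a t) ;
  sol_init : nonneg (th 0) ;
  sol_cont_x : {within `[0, +oo[, continuous x} ;
  sol_cont_a : {within `[0, +oo[, continuous a} ;
  sol_cont_alpha : {within `[0, +oo[, continuous alpha} ;
  sol_cont_th : forall i k j,
    {within `[0, +oo[, continuous (fun t => th t i k j)} ;
  sol_x : forall t : R, 0 < t ->
    is_derive t 1 x
      (- gradient objective (x t) - laplacian (a t) *m x t
       - laplacian (a t) *m alpha t - constraint_force (x t) (th t)) ;
  sol_a : forall (t : R) i q, 0 < t -> e i q ->
    is_derive t 1 (fun s => a s i q)
      (weight_rate (d i q)
        (disagreement x i q t, derive1 (disagreement x i q) t)) ;
  sol_alpha : forall t : R, 0 < t ->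
    is_derive t 1 alpha (laplacian (a t) *m x t) ;
  sol_th : forall (t : R) i k j, 0 <= t ->
    let rate s := pos_proj (g i k j (x s i k)) (th s i k j) in
    (@lebesgue_measure R).-integrable `[0, t] (EFin \o rate) /\
    th t i k j = th 0 i k j + \int[lebesgue_measure]_(s in `[0, t]) rate s
}.

End Problem.

(* Main.v *)
(* Let xs be the minimizer, h the sum of the gradient of f and of the constraint
   force at (xs, ths), so that the columns of h sum to zero, and alpha*(t) the
   solution of L(t) alpha* = - h. The weights are nondecreasing, so a
   pseudo-inverse of L(t) decreases in the positive semidefinite order; its trace
   then bounds the total variation of alpha*, and
     W = 1/2 (|x - xs|^2 + |alpha - alpha*|^2 + |theta - ths|^2)
   satisfies W' <= - mu |x - xs|^2 - <x, L x> + (1 + W) b with b integrable. So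
   everything but the weights is bounded and W converges.

   The weights cannot blow up. Multiplying the equation of x by its velocity v
   expresses the integral of |v|^2 by boundary terms and integrals of order
   eps * A(T), where A is the total weight and eps is arbitrarily small at late
   times; since the increase of A is at most a constant times the integral of
   |x - xs|^2 + |v|^2, A is bounded. The smallness comes from the edges: the
   integral of a_iq |e_iq|^2 is finite and e_iq varies at speed at most of order
   A, which itself satisfies A' <= K A^2, so a_iq |e_iq| / A tends to 0.

   Now the weights converge, x tends to xs, and alpha and theta vary slowly. A
   limit of (alpha, theta) along an ultrafilter satisfies the KKT conditions for
   the limit weights; W built on that limit converges, and its limit along the
   ultrafilter is 0, hence the whole trajectory converges.

   Integrals over time never appear: they are replaced by the decrease of
   functions with a right derivative of known sign. *)
Require Import Defs.
From HB Require Import structures.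
From mathcomp Require Import all_boot all_order all_algebra.
From mathcomp Require Import all_classical all_reals all_analysis.
From mathcomp Require Import ring lra.

Set Implicit Arguments.
Unset Strict Implicit.
Unset Printing Implicit Defensive.

Import Order.TTheory GRing.Theory Num.Theory.
Import numFieldNormedType.Exports.

Local Open Scope classical_set_scope.
Local Open Scope ring_scope.

(** * Right derivatives *)

(** The weights feed on the velocity and the velocity on the weights, so no a priori bound on L is
    at hand; this circularity shapes the middle of the proof. The drift of alpha* is harmless
    because it is governed by N = P L' P, where P is the inverse of L plus the all-ones matrix and
    L' is the Laplacian of the derivatives of the weights: N is positive semidefinite, so its
    entries are bounded by its trace, which is minus the derivative of the trace of P. The energy
    that controls the velocity is an augmented Lagrangian, whose gradient in x is - v. Its
    derivative has growth terms due to alpha, to the weights and to the multipliers; they are paid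
    respectively by the decrease of the Lyapunov function taken with a coefficient of order A, by
    the sum of the sqrt(a_iq + delta), and by theta itself. That coefficient is frozen at the end of
    the interval, which costs little because the Lyapunov function has almost nothing left to lose
    at late times. The Lyapunov function is built twice since multipliers need not be unique: with
    those obtained from Slater's condition it only yields boundedness and x -> xs. *)

(* The multipliers are only right differentiable, hence right derivatives; the
   two-sided continuity is what the mean value inequality needs in addition. *)
Definition rd (R : realType) (f : R -> R) (t c : R) : Prop :=
  f s @[s --> t] --> f t /\ (f (h + t) - f t) / h @[h --> 0^'+] --> c.

Section RightDerivative.
Variable R : realType.
Implicit Types (f g : R -> R) (s t c : R).

Lemma cvg_shift_right f t : f s @[s --> t] --> f t -> f (h + t) @[h --> 0^'+] --> f t.
Proof.
move=> ft; apply: cvg_at_right_filter.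
have : h + t @[h --> (0 : R)] --> t.
  rewrite -{2}[t]add0r; apply: cvgD; [exact: cvg_id|exact: cvg_cst].
by move=> /cvg_comp; apply.
Qed.

Lemma rd_eq f t c c' : rd f t c -> c = c' -> rd f t c'.
Proof. by move=> ? <-. Qed.

Lemma rd_ext f g t c : f =1 g -> rd f t c -> rd g t c.
Proof. by move=> /funext ->. Qed.

Lemma rd_cst c t : rd (fun=> c) t 0.
Proof.
split; first exact: cvg_cst.
by under eq_fun do rewrite subrr mul0r; exact: cvg_cst.
Qed.

Lemma rdD f g t c c' : rd f t c -> rd g t c' -> rd (fun s => f s + g s) t (c + c').
Proof.
move=> [cf qf] [cg qg]; split; first exact: cvgD.
under eq_fun do rewrite opprD addrACA mulrDl.
exact: cvgD.
Qed.

Lemma rdM f g t c c' : rd f t c -> rd g t c' ->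
  rd (fun s => f s * g s) t (c * g t + f t * c').
Proof.
move=> [cf qf] [cg qg]; split; first exact: cvgM.
have -> : (fun h => (f (h + t) * g (h + t) - f t * g t) / h) =
  (fun h => (f (h + t) - f t) / h * g (h + t) + f t * ((g (h + t) - g t) / h)).
  by apply/funext => h; ring.
apply: cvgD; first by apply: cvgM => //; exact: cvg_shift_right.
by apply: cvgM => //; exact: cvg_cst.
Qed.

Lemma rdZ f t c k : rd f t c -> rd (fun s => k * f s) t (k * c).
Proof.
by move=> /(rdM (rd_cst k t)) /rd_eq; apply; rewrite mul0r add0r.
Qed.

Lemma rdN f t c : rd f t c -> rd (fun s => - f s) t (- c).
Proof.
by move=> /(rdZ (-1)); rewrite mulN1r; apply: rd_ext => s; rewrite mulN1r.
Qed.

Lemma rdB f g t c c' : rd f t c -> rd g t c' -> rd (fun s => f s - g s) t (c - c').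
Proof. by move=> ? /rdN; exact: rdD. Qed.

Lemma rd_sum (I : Type) (r : seq I) (P : pred I) (F : I -> R -> R) (c : I -> R) t :
  (forall i, P i -> rd (F i) t (c i)) ->
  rd (fun s => \sum_(i <- r | P i) F i s) t (\sum_(i <- r | P i) c i).
Proof.
move=> Fc; elim: r => [|i r IHr].
  by rewrite big_nil; apply: rd_ext (rd_cst _ t) => s; rewrite big_nil.
rewrite big_cons; case: ifPn => Pi.
  by apply: rd_ext (rdD (Fc i Pi) IHr) => s; rewrite big_cons Pi.
by apply: rd_ext IHr => s; rewrite big_cons (negbTE Pi).
Qed.

Lemma is_derive_cvg_quot f t c : is_derive t 1 f c ->
  (f (h + t) - f t) / h @[h --> 0^'] --> c.
Proof.
move=> [ft fc]; move: (ft); rewrite /derivable -[lim _]/('D_1 f t) fc.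
by under eq_fun do rewrite /= scaler1 [_ *: _]mulrC.
Qed.

Lemma is_derive_rd f t c : is_derive t 1 f c -> rd f t c.
Proof.
move=> fc; split; last exact/cvg_dnbhs_at_right/is_derive_cvg_quot.
by case: fc => ft _; exact/differentiable_continuous/derivable1_diffP.
Qed.

(* Caratheodory's form of the derivative of phi avoids dividing by f s - f t. *)
Lemma rd_comp (phi : R -> R) f t c c' :
  is_derive (f t) 1 phi c' -> rd f t c -> rd (fun s => phi (f s)) t (c' * c).
Proof.
move=> dphi [cf qf].
have cphi : phi y @[y --> f t] --> phi (f t).
  by case: dphi => ? _; exact/differentiable_continuous/derivable1_diffP.
split; first by apply: cvg_comp cphi.
pose q y := if y == 0 then c' else (phi (y + f t) - phi (f t)) / y.
have qc : q y @[y --> 0] --> c'.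
  have H := is_derive_cvg_quot dphi.
  have q0 : q 0 = c' by rewrite /q eqxx.
  rewrite -q0; apply/continuous_withinNx; rewrite q0.
  apply: cvg_trans H; apply: near_eq_cvg; near=> y.
  by rewrite /q ifF //; apply/negbTE; near: y; exact: nbhs_dnbhs_neq.
have -> : (fun h => (phi (f (h + t)) - phi (f t)) / h) =
  (fun h => q (f (h + t) - f t) * ((f (h + t) - f t) / h)).
  apply/funext => h; rewrite /q; case: eqP => [/eqP|/eqP fh].
    by rewrite subr_eq0 => /eqP ->; rewrite !subrr mul0r mulr0.
  by rewrite subrK mulrA divfK.
apply: cvgM => //; apply: cvg_comp qc.
have : (f (h + t) - f t) @[h --> 0^'+] --> f t - f t.
  by apply: cvgB; [exact: cvg_shift_right|exact: cvg_cst].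
by rewrite subrr.
Unshelve. all: by end_near. Qed.

Lemma nbhs_right_ex (P : set R) : (\forall h \near 0^'+, P h) ->
  exists2 d : R, 0 < d & forall h, 0 < h < d -> P h.
Proof.
rewrite near_withinE => /nbhs_ballP[d /= d0 dP]; exists d => // h /andP[h0 hd].
by apply: dP => //; rewrite /ball /= sub0r normrN gtr0_norm.
Qed.

(** Let [z] be the last time up to which [f] stays below the line of slope [eta] through (a, f a).
    Left continuity gives the bound at [z] itself, and a right derivative at most 0 < [eta] would
    carry it beyond [z] if z < b. *)
Lemma rd_le0_nonincreasing f (a b : R) : a <= b ->
  (forall t, a <= t <= b -> exists2 c, c <= 0 & rd f t c) -> f b <= f a.
Proof.
move=> ab df; apply/ler_addgt0Pr => e e0.
(* The slack accumulated over [a, b] is at most [e]; the [+ 1] covers a = b. *)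
pose eta := e / (b - a + 1).
have eta0 : 0 < eta by rewrite divr_gt0// ltr_wpDl ?subr_ge0.
pose S := [set u | a <= u <= b /\ forall w, a <= w <= u -> f w <= f a + eta * (w - a)].
have Sa : S a.
  split=> [|w /andP[aw wa]]; first by rewrite lexx.
  have -> : w = a by apply/le_anti/andP.
  by rewrite subrr mulr0 addr0.
have ubS : ubound S b by move=> u [/andP[]].
have supS : has_sup S by split; [exists a|exists b].
pose z := sup S.
have az : a <= z by apply: ub_le_sup => //; exists b.
have zb : z <= b by apply: ge_sup => //; exists a.
have below w : a <= w < z -> f w <= f a + eta * (w - a).
  move=> /andP[aw wz]; have := @sup_adherent _ S (z - w).
  rewrite subr_gt0 => /(_ wz supS)[u [_ Su]]; rewrite opprB addrC subrK => wu.
  by apply: Su; rewrite aw ltW.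
have atz : f z <= f a + eta * (z - a).
  move: az; rewrite le_eqVlt => /predU1P[<-|az]; first by rewrite subrr mulr0 addr0.
  have [|c _ [fz _]] := df z; first by rewrite ltW.
  apply: (ler_cvg_to (f := f) (g := fun w => f a + eta * (w - a)) (a := z^'-)).
  - exact: cvg_at_left_filter.
  - apply: cvg_at_left_filter; apply: cvgD; first exact: cvg_cst.
    by apply: cvgM; [exact: cvg_cst|apply: cvgB; [exact: cvg_id|exact: cvg_cst]].
  - near=> w; apply: below; apply/andP; split => //.
    by near: w; exact: nbhs_left_ge.
suff -> : b = z.
  apply: (le_trans atz); rewrite lerD2l /eta.
  rewrite mulrAC ler_pdivrMr ?ltr_wpDl ?subr_ge0// ler_pM2l//.
  by rewrite lerBlDr addrAC subrK (le_trans zb)// lerDl.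
apply/eqP; rewrite eq_sym eq_le zb leNgt; apply/negP => ltzb.
have [|c c0 [_ rz]] := df z; first by rewrite az.
have /nbhs_right_ex[dl dl0 Hdl] : \forall h \near 0^'+, (f (h + z) - f z) / h <= eta.
  by apply: (cvgr_le _ rz); exact: le_lt_trans eta0.
pose h := Num.min (dl / 2) (b - z).
have h0 : 0 < h by rewrite lt_min divr_gt0//= subr_gt0.
have : S (z + h).
  split=> [|w /andP[aw wzh]].
    rewrite (le_trans az) ?lerDl ?(ltW h0)//= -lerBrDl.
    by rewrite /h ge_min lexx orbT.
  have [wz|zw|->] := ltgtP w z; [| |exact: atz].
    by apply: below; rewrite aw.
  have wz0 : 0 < w - z by rewrite subr_gt0.
  have /Hdl : 0 < w - z < dl.
    rewrite wz0 (@le_lt_trans _ _ (dl / 2))//; last by lra.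
    by rewrite lerBlDl (le_trans wzh)// lerD2l /h ge_min lexx.
  rewrite subrK ler_pdivrMr// => fw. lra.
move=> /(ub_le_sup (ex_intro _ b ubS)); rewrite -/z.
by rewrite gerDl leNgt h0.
Unshelve. all: by end_near. Qed.
Lemma rd_increment_le f (a b c : R) : a <= b ->
  (forall t, a <= t <= b -> exists2 k, `|k| <= c & rd f t k) -> `|f b - f a| <= c * (b - a).
Proof.
move=> ab df.
have sg (r : R) : `|r| = 1 -> r * f b - c * b <= r * f a - c * a.
  move=> r1; apply: (@rd_le0_nonincreasing (fun t => r * f t - c * t)) => // t /df[k kc dk].
  have did : rd (fun s : R => s) t 1 by apply: is_derive_rd; exact: is_derive_id.
  exists (r * k - c * 1); last exact: rdB (rdZ r dk) (rdZ c did).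
  by rewrite mulr1 subr_le0 (le_trans (ler_norm _))// normrM r1 mul1r.
have := sg 1 (normr1 _); have := sg (-1) (normrN1 _).
by rewrite ler_norml !mulN1r !mul1r => ? ?; apply/andP; split; lra.
Qed.

End RightDerivative.

(** * Limits of functions and matrices *)

Section Limits.
Variable R : realType.
Implicit Types f g : R -> R.

Lemma nonincreasing_cvgy f (a c : R) :
  (forall s t, a <= s -> s <= t -> f t <= f s) -> (forall t, a <= t -> c <= f t) ->
  exists2 l : R, f t @[t --> +oo] --> l & forall t, a <= t -> l <= f t.
Proof.
(* Freezing the time before [a] makes the function monotone on the whole line. *)
move=> fdec fc; pose g t := - f (Num.max a t).
have gmon : {homo g : s t / s <= t}.
  move=> s t st; rewrite lerN2; apply: fdec; first by rewrite le_max lexx.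
  by rewrite ge_max !le_max lexx st orbT.
have gub : has_ubound (range g).
  by exists (- c) => _ [t _ <-]; rewrite lerN2 fc// le_max lexx.
have gsup := nondecreasing_cvgr gmon gub.
exists (- sup (range g)).
  have : (- g t) @[t --> +oo] --> - sup (range g) by exact: cvgN.
  apply: cvg_trans; apply: near_eq_cvg; near=> t.
  rewrite /g opprK; congr (f _); apply/max_idPr.
  by near: t; apply: nbhs_pinfty_ge; exact: num_real.
move=> t at_; rewrite lerNl; apply: ub_le_sup => //; exists t => //.
by rewrite /g (max_idPr at_).
Unshelve. all: by end_near. Qed.

Lemma nondecreasing_cvgy f (a c : R) :
  (forall s t, a <= s -> s <= t -> f s <= f t) -> (forall t, a <= t -> f t <= c) ->
  exists2 l : R, f t @[t --> +oo] --> l & forall t, a <= t -> f t <= l.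
Proof.
move=> finc fc; have [s t a_s st|t at_|l fl lf] := @nonincreasing_cvgy (fun t => - f t) a (- c).
- by rewrite lerN2 finc.
- by rewrite lerN2 fc.
exists (- l); last by move=> t at_; rewrite lerNr lf.
have : (- - f t) @[t --> +oo] --> - l by exact: cvgN.
by under eq_fun do rewrite opprK.
Qed.

End Limits.

Section RealBounds.
Variable R : realType.
Implicit Types s t : R.

Lemma sqr_le_norm (u c : R) : u ^+ 2 <= c -> `|u| <= 1 + c.
Proof.
move=> uc; have := sqr_ge0 (`|u| - 1); rewrite sqrrB expr1n mulr1 real_normK ?num_real//.
by have := sqr_ge0 u; have := normr_ge0 u; lra.
Qed.

Lemma sqr_sum_le (N : nat) (z : 'I_N -> R) :
  (\sum_q z q) ^+ 2 <= N%:R * \sum_q (z q) ^+ 2.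
Proof.
have -> : (\sum_q z q) ^+ 2 = \sum_p \sum_q z p * z q.
  by rewrite expr2 mulr_suml; apply: eq_bigr => p _; rewrite mulr_sumr.
apply: (@le_trans _ _ (\sum_p \sum_q (z p ^+ 2 + z q ^+ 2) / 2)).
  apply: ler_sum => p _; apply: ler_sum => q _.
  by have := sqr_ge0 (z p - z q); rewrite sqrrB => ?; lra.
under eq_bigr do rewrite -mulr_suml big_split /= sumr_const card_ord.
rewrite -mulr_suml big_split /= sumr_const card_ord sumrMnl -(mulr_natl _ N).
by rewrite le_eqVlt; apply/orP; left; apply/eqP; field.
Qed.

Lemma cvg0_of_sqr (phi W : R -> R) : W t @[t --> +oo] --> (0 : R) ->
  (forall t, phi t ^+ 2 <= 2 * W t) -> phi t @[t --> +oo] --> (0 : R).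
Proof.
move=> W0 le; apply/cvgrPdist_le => eps eps0.
have e2 : 0 < eps ^+ 2 / 2 by rewrite divr_gt0// exprn_gt0.
move/cvgrPdist_le : W0 => /(_ _ e2); apply: filterS => t; rewrite !sub0r !normrN => Wt.
rewrite -(@ler_pXn2r _ 2) ?nnegrE ?(ltW eps0)// real_normK ?num_real//.
by have := le t; have := ler_norm (W t); lra.
Qed.

Lemma fin_bound (I : finType) (T : Type) (A : set T) (phi : I -> T -> R) :
  (forall i, exists B, forall y, A y -> `|phi i y| <= B) ->
  exists B, forall i y, A y -> `|phi i y| <= B.
Proof.
move=> H; exists (\sum_i `|sval (cid (H i))|) => i y Ay.
rewrite (bigD1 i)//= ler_wpDr ?sumr_ge0//.
exact: le_trans (svalP (cid (H i)) y Ay) (ler_norm _).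
Qed.

End RealBounds.

Section MatrixLimits.
Variables (R : realType) (T : Type) (F : set_system T).
Context {FF : Filter F}.

Lemma cvg_sumr (I : Type) (r : seq I) (P : pred I) (f : I -> T -> R) (l : I -> R) :
  (forall i, P i -> f i s @[s --> F] --> l i) ->
  (\sum_(i <- r | P i) f i s) @[s --> F] --> \sum_(i <- r | P i) l i.
Proof. by move=> fl; apply: cvg_big => //; exact: add_continuous. Qed.

Lemma cvg_prodr (I : Type) (r : seq I) (P : pred I) (f : I -> T -> R) (l : I -> R) :
  (forall i, P i -> f i s @[s --> F] --> l i) ->
  (\prod_(i <- r | P i) f i s) @[s --> F] --> \prod_(i <- r | P i) l i.
Proof. by move=> fl; apply: cvg_big => //; exact: mul_continuous. Qed.

(** Convergence is stated entrywise so that every matrix limit reduces to real ones; [mxcvg_cvg]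
    goes back to the norm at the very end. *)
Definition mxcvg p q (A : T -> 'M[R]_(p, q)) (B : 'M[R]_(p, q)) :=
  forall i j, A s i j @[s --> F] --> B i j.

Lemma cvg_det n (A : T -> 'M[R]_n) B : mxcvg A B -> \det (A s) @[s --> F] --> \det B.
Proof.
move=> AB; apply: cvg_sumr => sg _.
by apply: cvgM; [exact: cvg_cst|exact: cvg_prodr].
Qed.

(** The inverse is the adjugate divided by the determinant, both polynomial in the entries. *)
Lemma mxcvg_invmx n (A : T -> 'M[R]_n) B : (\forall s \near F, A s \in unitmx) ->
  B \in unitmx -> mxcvg A B -> mxcvg (fun s => invmx (A s)) (invmx B).
Proof.
move=> Au Bu AB i j; rewrite /invmx Bu !mxE.
apply: (@cvg_trans _ ((\det (A s))^-1 * cofactor (A s) j i @[s --> F])); last first.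
  apply: cvgM; first by apply: cvgV; [rewrite -unitfE; exact: Bu|exact: cvg_det].
  apply: cvgM; first exact: cvg_cst.
  by apply: cvg_det => i' j'; under eq_fun do rewrite !mxE; rewrite !mxE; exact: AB.
apply: near_eq_cvg; move: Au; apply: filterS => s As.
by rewrite /invmx As !mxE.
Qed.

Lemma mxcvg_mul p q r (A : T -> 'M[R]_(p, q)) (B : T -> 'M[R]_(q, r)) A' B' :
  mxcvg A A' -> mxcvg B B' -> mxcvg (fun s => A s *m B s) (A' *m B').
Proof.
move=> cA cB i j; rewrite mxE; under eq_fun do rewrite mxE.
by apply: cvg_sumr => k _; exact: cvgM.
Qed.

Lemma mxcvgD p q (A B : T -> 'M[R]_(p, q)) A' B' :
  mxcvg A A' -> mxcvg B B' -> mxcvg (fun s => A s + B s) (A' + B').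
Proof.
by move=> cA cB i j; rewrite mxE; under eq_fun do rewrite mxE; exact: cvgD.
Qed.

Lemma mxcvgN p q (A : T -> 'M[R]_(p, q)) A' :
  mxcvg A A' -> mxcvg (fun s => - A s) (- A').
Proof.
by move=> cA i j; rewrite mxE; under eq_fun do rewrite mxE; exact: cvgN.
Qed.

Lemma mxcvg_cst p q (A : 'M[R]_(p, q)) : mxcvg (fun=> A) A.
Proof. by move=> i j; exact: cvg_cst. Qed.

Lemma mxcvg_laplacian n (a : T -> 'M[R]_n) a' :
  mxcvg a a' -> mxcvg (fun s => laplacian (a s)) (laplacian a').
Proof.
move=> aa i j; rewrite mxE; under eq_fun do rewrite mxE; case: eqP => _.
  by apply: cvg_sumr.
exact: cvgN.
Qed.

Lemma mxcvg_cvg p q (A : T -> 'M[R]_(p, q)) B : mxcvg A B -> A s @[s --> F] --> B.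
Proof.
move=> AB; apply/cvgrPdist_le => eps eps0.
have near_all : \forall s \near F, forall ij : 'I_p * 'I_q, `|B ij.1 ij.2 - A s ij.1 ij.2| <= eps.
  by apply: filter_forall => -[i j]; move/cvgrPdist_le : (AB i j); exact.
apply: filterS near_all => s H.
rewrite /Num.Def.normr /= mx_normrE bigmax_le ?(ltW eps0)// => ij _.
by rewrite !mxE; exact: H.
Qed.

End MatrixLimits.

(** The image filter has a cluster point in a compact segment, and an ultrafilter that clusters at a
    point converges to it. *)
Lemma ultra_bounded_cvg (R : realType) (T : Type) (G : set_system T) (phi : T -> R) (C : R) :
  UltraFilter G -> (\forall s \near G, `|phi s| <= C) ->
  exists p : R, phi s @[s --> G] --> p.
Proof.
move=> UG bnd; have PG : ProperFilter G by exact: ultra_proper.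
have Pphi : ProperFilter (phi s @[s --> G]) by exact: fmap_proper_filter.
have phiC : (phi s @[s --> G]) `[- C, C]%classic.
  by apply: filterS bnd => s; rewrite /= in_itv /= ler_norml.
have [p [_ clp]] := @segment_compact R (- C) C _ Pphi phiC.
exists p => B Bp; have [//|nB] := in_ultra_setVsetC (phi @^-1` B) UG.
by have [y []] := clp (~` B) B nB Bp.
Qed.

(** * Right derivatives of matrix-valued functions *)

Definition mrd (R : realType) p q (F : R -> 'M[R]_(p, q)) (t : R) (G : 'M[R]_(p, q)) :=
  forall i j, rd (fun s => F s i j) t (G i j).

Section MatrixDerivative.
Variable R : realType.
Implicit Types t : R.

Lemma mrd_eq p q (F : R -> 'M[R]_(p, q)) t G G' : mrd F t G -> G = G' -> mrd F t G'.
Proof. by move=> ? <-. Qed.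

Lemma is_derive_entry p q (F : R -> 'M[R]_(p, q)) t G i j :
  is_derive t 1 F G -> is_derive t 1 (fun s => F s i j) (G i j).
Proof.
move=> [dF FG]; split; first by move/derivable_mxP : dF.
by rewrite -FG derive_mx// mxE.
Qed.

Lemma is_derive_mrd p q (F : R -> 'M[R]_(p, q)) t G : is_derive t 1 F G -> mrd F t G.
Proof. by move=> dF i j; exact/is_derive_rd/is_derive_entry. Qed.

Lemma mrd_cst p q (A : 'M[R]_(p, q)) t : mrd (fun=> A) t 0.
Proof. by move=> i j; rewrite mxE; exact: rd_cst. Qed.

Lemma mrdD p q (F G : R -> 'M[R]_(p, q)) t F' G' :
  mrd F t F' -> mrd G t G' -> mrd (fun s => F s + G s) t (F' + G').
Proof.
by move=> dF dG i j; rewrite mxE; apply: rd_ext (rdD (dF i j) (dG i j)) => s; rewrite mxE.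
Qed.

Lemma mrdN p q (F : R -> 'M[R]_(p, q)) t F' : mrd F t F' -> mrd (fun s => - F s) t (- F').
Proof.
by move=> dF i j; rewrite mxE; apply: rd_ext (rdN (dF i j)) => s; rewrite mxE.
Qed.

Lemma mrdB p q (F G : R -> 'M[R]_(p, q)) t F' G' :
  mrd F t F' -> mrd G t G' -> mrd (fun s => F s - G s) t (F' - G').
Proof. by move=> dF /mrdN; exact: mrdD. Qed.

Lemma mrdM p q r (F : R -> 'M[R]_(p, q)) (G : R -> 'M[R]_(q, r)) t F' G' :
  mrd F t F' -> mrd G t G' -> mrd (fun s => F s *m G s) t (F' *m G t + F t *m G').
Proof.
move=> dF dG i j; rewrite !mxE -big_split /=.
apply: (@rd_ext _ (fun s => \sum_k F s i k * G s k j)) => [s|]; first by rewrite mxE.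
by apply: rd_sum => k _; exact: rdM.
Qed.

Lemma rd_inner p q (F G : R -> 'M[R]_(p, q)) t F' G' :
  mrd F t F' -> mrd G t G' ->
  rd (fun s => inner (F s) (G s)) t (inner F' (G t) + inner (F t) G').
Proof.
move=> dF dG; rewrite /inner -big_split /=; apply: rd_sum => i _.
by rewrite -big_split /=; apply: rd_sum => j _; exact: rdM.
Qed.

Lemma mrd_laplacian n (a : R -> 'M[R]_n) t a' :
  mrd a t a' -> mrd (fun s => laplacian (a s)) t (laplacian a').
Proof.
move=> da i j; rewrite mxE.
apply: (@rd_ext _ (fun s => if i == j then \sum_r a s i r else - a s i j)) => [s|].
  by rewrite mxE.
by case: eqP => _; [exact: rd_sum|exact: rdN].
Qed.

Lemma rd_mxtrace n (F : R -> 'M[R]_n) t F' :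
  mrd F t F' -> rd (fun s => \tr (F s)) t (\tr F').
Proof. by move=> dF; apply: rd_sum => i _. Qed.

(** The identity P(t+h) - P(t) = - P(t+h) (F(t+h) - F(t)) P(t), where P is the inverse of F, is
    divided by h; the limit exists because P is continuous. *)
Lemma mrd_invmx n (F : R -> 'M[R]_n) t F' : (\forall s \near t, F s \in unitmx) ->
  F t \in unitmx -> mrd F t F' ->
  mrd (fun s => invmx (F s)) t (- (invmx (F t) *m F' *m invmx (F t))).
Proof.
move=> Fu Ftu dF.
have cF : mxcvg (nbhs t) F (F t) by move=> i j; have [] := dF i j.
have cP : mxcvg (nbhs t) (fun s => invmx (F s)) (invmx (F t)) by exact: mxcvg_invmx.
move=> i j; split; first exact: cP.
have sh : h + t @[h --> 0^'+] --> t.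
  apply: cvg_at_right_filter; rewrite -{2}[t]add0r.
  by apply: cvgD; [exact: cvg_id|exact: cvg_cst].
pose Q h := \matrix_(i, j) ((F (h + t) i j - F t i j) / h).
have cQ : mxcvg 0^'+ Q F'.
  move=> p q; have [_] := dF p q; apply: cvg_trans; apply: near_eq_cvg.
  by near=> h; rewrite mxE.
have cPh : mxcvg 0^'+ (fun h => invmx (F (h + t))) (invmx (F t)).
  by move=> p q; exact: cvg_comp sh (cP p q).
have : mxcvg 0^'+ (fun h => - (invmx (F (h + t)) *m Q h *m invmx (F t)))
    (- (invmx (F t) *m F' *m invmx (F t))).
  by apply: mxcvgN; apply: mxcvg_mul; [exact: mxcvg_mul|exact: mxcvg_cst].
move=> /(_ i j); apply: cvg_trans; apply: near_eq_cvg.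
have := sh _ Fu; rewrite nbhs_filterE /= => Fhu.
near=> h.
have h0 : h != 0 by near: h; exact: nbhs_right_neq.
have Fh : F (h + t) \in unitmx by near: h.
apply/(mulIf h0); rewrite divfK//.
have -> : Q h = h^-1 *: (F (h + t) - F t).
  by apply/matrixP => p q; rewrite !mxE mulrC.
rewrite -scalemxAr -scalemxAl mulmxBr mulVmx// mulmxBl mul1mx -mulmxA mulmxV// mulmx1.
by rewrite !mxE mulNr mulrAC mulVf// mul1r opprB.
Unshelve. all: by end_near. Qed.

End MatrixDerivative.

(** * Slowly varying functions *)

Section SlowVariation.
Variable R : realType.
Implicit Types s t : R.

Lemma near_ge1 : \forall t \near +oo, 1 <= (t : R).
Proof. by apply: nbhs_pinfty_ge; exact: num_real. Qed.

Lemma near_forall_ge (P : set R) : (\forall t \near +oo, P t) ->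
  \forall t \near +oo, forall s, t <= s -> P s.
Proof.
move=> [M [Mr HM]]; exists M; split => // t Mt s ts; apply: HM.
exact: lt_le_trans ts.
Qed.

(** A weak substitute for convergence: the oscillation over unit windows vanishes, which suffices to
    move a limit from [t] to a nearby time. The length 1 is that of the window on which the mean
    value theorem is later applied to [x]. *)
Definition slow (phi : R -> R) := forall eps, 0 < eps ->
  \forall t \near +oo, forall s, t <= s <= t + 1 -> `|phi s - phi t| <= eps.

Lemma slow_rd (phi c : R -> R) : (forall t, 1 <= t -> rd phi t (c t)) ->
  c t @[t --> +oo] --> (0 : R) -> slow phi.
Proof.
move=> dphi c0 eps eps0.
have nc : \forall t \near +oo, forall s, t <= s -> `|c s| <= eps.
  apply: near_forall_ge; move/cvgrPdist_le : c0 => /(_ _ eps0).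
  by apply: filterS => t; rewrite sub0r normrN.
near=> t => s /andP[ts st1].
have t1 : 1 <= t by near: t; exact: near_ge1.
have ct : forall s, t <= s -> `|c s| <= eps by near: t.
apply: (@le_trans _ _ (eps * (s - t))); last by rewrite ler_piMr ?(ltW eps0)// lerBlDl.
apply: rd_increment_le => // u /andP[tu _]; exists (c u); first exact: ct.
by apply: dphi; exact: le_trans tu.
Unshelve. all: by end_near. Qed.

Lemma slow_cvg (phi : R -> R) (p : R) : phi t @[t --> +oo] --> p -> slow phi.
Proof.
move=> cphi eps eps0; have e2 : 0 < eps / 2 by rewrite divr_gt0.
move/cvgrPdist_le : cphi => /(_ _ e2)/near_forall_ge np.
near=> t => s /andP[ts _].
have H : forall s, t <= s -> `|p - phi s| <= eps / 2 by near: t.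
have H1 := H s ts; have H2 := H t (lexx _).
by have := ler_distD p (phi s) (phi t); rewrite [`|phi s - p|]distrC; lra.
Unshelve. all: by end_near. Qed.

Lemma slow_shift (phi tau : R -> R) (p : R) (G : set_system R) : ProperFilter G ->
  +oo%R `<=` G -> slow phi -> (forall t, 1 <= t -> t <= tau t <= t + 1) ->
  phi t @[t --> G] --> p -> phi (tau t) @[t --> G] --> p.
Proof.
move=> PG ooG sphi Htau phip.
have d0 : (phi (tau t) - phi t) @[t --> G] --> (0 : R).
  apply/cvgrPdist_le => eps eps0.
  have : \forall t \near +oo, `|0 - (phi (tau t) - phi t)| <= eps.
    near=> t; rewrite sub0r normrN.
    have t1 : 1 <= t by near: t; exact: near_ge1.
    have H : forall s, t <= s <= t + 1 -> `|phi s - phi t| <= eps by near: t; exact: sphi.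
    exact: H (Htau t t1).
  by move=> /ooG.
have : (phi (tau t) - phi t + phi t) @[t --> G] --> 0 + p by exact: cvgD.
by rewrite add0r; under eq_fun do rewrite subrK.
Unshelve. all: by end_near. Qed.

End SlowVariation.

(** * Weighted Laplacians *)

Section Inner.
Variable R : realType.
Variables p q : nat.
Implicit Types A B C : 'M[R]_(p, q).

Lemma inner_trace A B : inner A B = \tr (A^T *m B).
Proof.
rewrite /inner exchange_big /=; apply: eq_bigr => j _.
by rewrite mxE; apply: eq_bigr => i _; rewrite mxE.
Qed.

Lemma innerC A B : inner A B = inner B A.
Proof. by apply: eq_bigr => i _; apply: eq_bigr => j _; rewrite mulrC. Qed.

Lemma innerDr A B C : inner A (B + C) = inner A B + inner A C.
Proof. by rewrite !inner_trace mulmxDr mxtraceD. Qed.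

Lemma innerNr A B : inner A (- B) = - inner A B.
Proof. by rewrite !inner_trace mulmxN raddfN. Qed.

Lemma innerBr A B C : inner A (B - C) = inner A B - inner A C.
Proof. by rewrite innerDr innerNr. Qed.

Lemma innerDl A B C : inner (B + C) A = inner B A + inner C A.
Proof. by rewrite innerC innerDr !(innerC A). Qed.

Lemma innerNl A B : inner (- B) A = - inner B A.
Proof. by rewrite innerC innerNr innerC. Qed.

Lemma innerBl A B C : inner (B - C) A = inner B A - inner C A.
Proof. by rewrite innerDl innerNl. Qed.

Lemma inner0r A : inner A 0 = 0.
Proof. by rewrite inner_trace mulmx0 mxtrace0. Qed.

Lemma inner_mulmx (M : 'M[R]_p) A B : inner A (M *m B) = inner (M^T *m A) B.
Proof. by rewrite !inner_trace trmx_mul trmxK mulmxA. Qed.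

Lemma sqnorm_ge0 A : 0 <= sqnorm A.
Proof. by apply: sumr_ge0 => i _; apply: sumr_ge0 => j _; rewrite -expr2 sqr_ge0. Qed.

Lemma entry_le_sqnorm A i j : (A i j) ^+ 2 <= sqnorm A.
Proof.
rewrite /sqnorm /inner (bigD1 i)//= (bigD1 j)//= expr2 -addrA lerDl addr_ge0//.
  by apply: sumr_ge0 => ? _; rewrite -expr2 sqr_ge0.
by apply: sumr_ge0 => ? _; apply: sumr_ge0 => ? _; rewrite -expr2 sqr_ge0.
Qed.

End Inner.

Section Sqnorm.
Variable R : realType.

Lemma sqnormN p q (A : 'M[R]_(p, q)) : sqnorm (- A) = sqnorm A.
Proof. by rewrite /sqnorm innerNl innerNr opprK. Qed.

Lemma row_diff_sqnorm_le p q (X Y : 'M[R]_(p, q)) i r :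
  (forall i r k, X i k - X r k = Y i k - Y r k) ->
  sqnorm (row i X - row r X) <= 4 * sqnorm Y.
Proof.
move=> XY; rewrite {1}/sqnorm {1}/inner big_ord1.
have rowY i' : \sum_k (Y i' k) ^+ 2 <= sqnorm Y.
  rewrite /sqnorm /inner (bigD1 i')//=; under eq_bigr do rewrite expr2; rewrite lerDl.
  by do 2 (apply: sumr_ge0 => ? _); rewrite -expr2 sqr_ge0.
apply: (@le_trans _ _ (\sum_k (2 * (Y i k) ^+ 2 + 2 * (Y r k) ^+ 2))).
  apply: ler_sum => k _; rewrite !mxE XY.
  by have := sqr_ge0 (Y i k + Y r k); rewrite sqrrD => ?; lra.
by rewrite big_split /= -!mulr_sumr; have := rowY i; have := rowY r; lra.
Qed.

Lemma sqnorm_bounded p q (Y : 'M[R]_(p, q)) (B : R) : 0 <= B ->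
  (forall i k, `|Y i k| <= B) -> sqnorm Y <= (p * q)%:R * B ^+ 2.
Proof.
move=> B0 YB; apply: (@le_trans _ _ (\sum_(i < p) \sum_(k < q) B ^+ 2)).
  apply: ler_sum => i _; apply: ler_sum => k _; rewrite -expr2 -real_normK ?num_real//.
  by rewrite ler_pXn2r ?nnegrE// (le_trans _ B0).
by rewrite !sumr_const !card_ord -mulrnA mulr_natl mulnC.
Qed.

Lemma cvg_sqnorm (T : Type) (G : set_system T) (FG : Filter G) p q
    (A : T -> 'M[R]_(p, q)) B : mxcvg G A B -> sqnorm (A y) @[y --> G] --> sqnorm B.
Proof.
move=> AB; rewrite /sqnorm /inner.
apply: (@cvg_sumr _ _ _ FG) => i _; apply: (@cvg_sumr _ _ _ FG) => j _.
exact: (@cvgM _ _ _ FG _ _ _ _ (AB i j) (AB i j)).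
Qed.

End Sqnorm.

(** * Positive semidefinite matrices *)

Section PositiveSemidefinite.
Variables (R : realType) (n : nat).

Definition psd (N : 'M[R]_n) := forall u : 'cV[R]_n, 0 <= inner u (N *m u).

Lemma inner_delta (N : 'M[R]_n) i j :
  inner (delta_mx i 0 : 'cV[R]_n) (N *m delta_mx j 0) = N i j.
Proof.
rewrite /inner (bigD1 i)//= big_ord1 mxE !eqxx mul1r mxE (bigD1 j)//= mxE !eqxx mulr1.
rewrite !big1 ?addr0// => [k ki|k kj]; first by rewrite big_ord1 mxE (negbTE ki) mul0r.
by rewrite mxE (negbTE kj) mulr0.
Qed.

Lemma psd_diag_ge0 (N : 'M[R]_n) i : psd N -> 0 <= N i i.
Proof. by move=> /(_ (delta_mx i 0)); rewrite inner_delta. Qed.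

Lemma psd_trace_ge0 (N : 'M[R]_n) : psd N -> 0 <= \tr N.
Proof. by move=> psdN; apply: sumr_ge0 => i _; exact: psd_diag_ge0. Qed.

Lemma psd_diag_le_trace (N : 'M[R]_n) i : psd N -> N i i <= \tr N.
Proof.
move=> psdN; rewrite /mxtrace (bigD1 i)//= lerDl.
by apply: sumr_ge0 => j _; exact: psd_diag_ge0.
Qed.

(** Testing the form on the sum and the difference of two basis vectors bounds |N i j| by half of N
    i i + N j j. *)
Lemma psd_entry_le_trace (N : 'M[R]_n) i j : N^T = N -> psd N -> `|N i j| <= \tr N.
Proof.
move=> symN psdN.
have := psdN (delta_mx i 0 + delta_mx j 0); have := psdN (delta_mx i 0 - delta_mx j 0).
rewrite mulmxBr mulmxDr !(innerBl, innerBr, innerDl, innerDr) !inner_delta.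
have -> : N j i = N i j by rewrite -{1}symN mxE.
have := psd_diag_le_trace i psdN; have := psd_diag_le_trace j psdN.
by move=> *; rewrite ler_norml; apply/andP; split; lra.
Qed.

(** The bound is by the trace because [N] will be minus the derivative of a matrix: its trace is
    then itself a derivative in time and can be compensated exactly. *)
Lemma psd_inner_le (l : nat) (N : 'M[R]_n) (A B : 'M[R]_(n, l)) :
  N^T = N -> psd N -> inner A (N *m B) <= \tr N * (n%:R * (sqnorm A + sqnorm B) / 2).
Proof.
move=> symN psdN.
have -> : inner A (N *m B) = \sum_i \sum_k \sum_j A i k * (N i j * B j k).
  apply: eq_bigr => i _; apply: eq_bigr => k _.
  by rewrite mxE mulr_sumr.
apply: (@le_trans _ _ (\sum_i \sum_k \sum_j \tr N * ((A i k * A i k + B j k * B j k) / 2))).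
  apply: ler_sum => i _; apply: ler_sum => k _; apply: ler_sum => j _.
  rewrite mulrCA; apply: (le_trans (ler_norm _)); rewrite normrM.
  apply: ler_pM => //; first exact: psd_entry_le_trace.
  rewrite ler_norml; apply/andP; split.
    by have := sqr_ge0 (A i k + B j k); lra.
  by have := sqr_ge0 (A i k - B j k); lra.
under eq_bigr do under eq_bigr do rewrite -mulr_sumr.
under eq_bigr do rewrite -mulr_sumr.
rewrite -mulr_sumr ler_wpM2l ?psd_trace_ge0//.
under eq_bigr do under eq_bigr do rewrite -mulr_suml big_split /= sumr_const card_ord.
under eq_bigr do rewrite -mulr_suml big_split /=.
rewrite -mulr_suml big_split /= ler_wpM2r// mulrDr lerD//.
  rewrite /sqnorm /inner mulr_sumr ler_sum// => i _.
  by rewrite mulr_sumr ler_sum// => k _; rewrite mulr_natl.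
rewrite sumr_const card_ord mulr_natl /sqnorm /inner.
by rewrite exchange_big.
Qed.

End PositiveSemidefinite.

Section Laplacian.
Variables (R : realType) (n : nat).
Implicit Types a : 'M[R]_n.

(** What the weights share with their time derivatives, which need not be positive on the edges. *)
Definition sym_loopless a := (forall i q, a i q = a q i) /\ forall i, a i i = 0.

Lemma laplacian_tr a : sym_loopless a -> (laplacian a)^T = laplacian a.
Proof.
move=> [sa _]; apply/matrixP => i j; rewrite !mxE eq_sym.
by case: eqP => [->//|_]; rewrite sa.
Qed.

Lemma laplacian_mulE l a (U : 'M[R]_(n, l)) i k : sym_loopless a ->
  (laplacian a *m U) i k = \sum_q a i q * (U i k - U q k).
Proof.
move=> [_ a0]; rewrite mxE (bigD1 i)//= mxE eqxx.
under [in RHS]eq_bigr do rewrite mulrBr.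
rewrite sumrB -mulr_suml; congr (_ + _).
rewrite [in RHS](bigD1 i)//= a0 mul0r add0r -sumrN; apply: eq_bigr => q qi.
by rewrite mxE eq_sym (negbTE qi) mulNr.
Qed.

(** Expand along the entries of [U], exchange the two ends of every edge, and average both
    expressions. *)
Lemma inner_laplacian l a (U V : 'M[R]_(n, l)) : sym_loopless a ->
  inner U (laplacian a *m V) =
  2^-1 * \sum_i \sum_q \sum_k a i q * ((U i k - U q k) * (V i k - V q k)).
Proof.
move=> sa.
have E1 : inner U (laplacian a *m V) =
    \sum_i \sum_q \sum_k a i q * (U i k * (V i k - V q k)).
  apply: eq_bigr => i _; rewrite exchange_big /=; apply: eq_bigr => k _.
  rewrite laplacian_mulE// mulr_sumr; apply: eq_bigr => q _.
  by rewrite mulrCA.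
have E2 : inner U (laplacian a *m V) =
    \sum_i \sum_q \sum_k a i q * (- U q k * (V i k - V q k)).
  rewrite E1 exchange_big /=; apply: eq_bigr => i _; apply: eq_bigr => q _.
  by apply: eq_bigr => k _; rewrite sa.1 mulNr -mulrN opprB.
apply: (canRL (mulKf (_ : 2 != 0))) => //.
rewrite mulr_natl mulr2n; transitivity (\sum_i \sum_q \sum_k a i q * (U i k * (V i k - V q k)) +
    \sum_i \sum_q \sum_k a i q * (- U q k * (V i k - V q k))); first by congr (_ + _).
rewrite -big_split /=; apply: eq_bigr => i _.
rewrite -big_split /=; apply: eq_bigr => q _.
by rewrite -big_split /=; apply: eq_bigr => k _; ring.
Qed.

Lemma inner_laplacianC l a (U V : 'M[R]_(n, l)) : sym_loopless a ->
  inner U (laplacian a *m V) = inner (laplacian a *m U) V.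
Proof. by move=> sa; rewrite inner_mulmx laplacian_tr. Qed.

Lemma laplacian_quad_ge0 l a (U : 'M[R]_(n, l)) : sym_loopless a ->
  (forall i q, 0 <= a i q) -> 0 <= inner U (laplacian a *m U).
Proof.
move=> sa a0; rewrite inner_laplacian// mulr_ge0 ?invr_ge0//.
apply: sumr_ge0 => i _; apply: sumr_ge0 => q _; apply: sumr_ge0 => k _.
by rewrite mulr_ge0// -expr2 sqr_ge0.
Qed.

Lemma laplacian_edge_le l a (U : 'M[R]_(n, l)) i q k : sym_loopless a ->
  (forall i q, 0 <= a i q) ->
  2^-1 * (a i q * (U i k - U q k) ^+ 2) <= inner U (laplacian a *m U).
Proof.
move=> sa a0; rewrite inner_laplacian// ler_wpM2l ?invr_ge0//.
have H i' q' k' : 0 <= a i' q' * ((U i' k' - U q' k') * (U i' k' - U q' k')).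
  by rewrite mulr_ge0// -expr2 sqr_ge0.
rewrite (bigD1 i)//= (bigD1 q)//= (bigD1 k)//= -expr2 -!addrA lerDl !addr_ge0//.
- by apply: sumr_ge0.
- by apply: sumr_ge0 => ? _; apply: sumr_ge0.
- by apply: sumr_ge0 => ? _; apply: sumr_ge0 => ? _; apply: sumr_ge0.
Qed.

Lemma laplacian_consensus l a (U : 'M[R]_(n, l)) : sym_loopless a ->
  (forall i q k, U i k = U q k) -> laplacian a *m U = 0.
Proof.
move=> sa cU; apply/matrixP => i k; rewrite laplacian_mulE// mxE big1// => q _.
by rewrite (cU i q) subrr mulr0.
Qed.

Lemma laplacian_column_sum l a (U : 'M[R]_(n, l)) k : sym_loopless a ->
  \sum_i (laplacian a *m U) i k = 0.
Proof.
move=> sa; under eq_bigr do rewrite laplacian_mulE//.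
set S := \sum_i _; have : S = - S.
  rewrite {1}/S exchange_big /S -sumrN; apply: eq_bigr => i _ /=.
  by rewrite -sumrN; apply: eq_bigr => q _; rewrite sa.1 -mulrN opprB.
lra.
Qed.

(* Adding ones to the Laplacian of a connected graph gives a positive definite
   matrix, whose inverse is a pseudo-inverse of the Laplacian on the vectors
   orthogonal to the constants. *)
Definition ones : 'M[R]_n := const_mx 1.
Definition grounded a := laplacian a + ones.

Lemma ones_mulE l (U : 'M[R]_(n, l)) i k : (ones *m U) i k = \sum_j U j k.
Proof. by rewrite mxE; apply: eq_bigr => j _; rewrite mxE mul1r. Qed.

Lemma inner_ones l (U : 'M[R]_(n, l)) : inner U (ones *m U) = \sum_k (\sum_j U j k) ^+ 2.
Proof.
rewrite /inner exchange_big /=; apply: eq_bigr => k _.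
by rewrite expr2 mulr_suml; apply: eq_bigr => i _; rewrite ones_mulE.
Qed.

Lemma inner_grounded_ge0 l a (U : 'M[R]_(n, l)) : sym_loopless a ->
  (forall i q, 0 <= a i q) -> 0 <= inner U (grounded a *m U).
Proof.
move=> sa a0; rewrite mulmxDl innerDr addr_ge0 ?laplacian_quad_ge0//.
by rewrite inner_ones sumr_ge0// => k _; rewrite sqr_ge0.
Qed.

Lemma grounded_tr a : sym_loopless a -> (grounded a)^T = grounded a.
Proof. by move=> sa; rewrite linearD /= laplacian_tr// trmx_const. Qed.

Variable e : rel 'I_n.
Hypothesis graph_e : connected_graph e.

Lemma coupling_sym_loopless a : coupling_weights e a -> sym_loopless a.
Proof.
move=> ca; split=> [i q|i]; first by have [] := ca i q.
have [_] := ca i i; have [_ irr _] := graph_e.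
by rewrite irr => /eqP.
Qed.

Lemma coupling_ge0 a i q : coupling_weights e a -> 0 <= a i q.
Proof.
by move=> /(_ i q)[_]; case: ifP => _ => [/ltW//|/eqP ->].
Qed.

(** On a vector of the kernel both nonnegative parts of the quadratic form vanish: the Laplacian
    part makes the vector constant along edges, hence constant by connectedness, and the other part
    makes its sum zero. *)
Lemma grounded_unit a : coupling_weights e a -> grounded a \in unitmx.
Proof.
move=> ca; have sa := coupling_sym_loopless ca.
have a0 i q : 0 <= a i q by exact: coupling_ge0.
rewrite -row_free_unit; apply: inj_row_free => v vM.
pose U := v^T.
have MU : grounded a *m U = 0 by rewrite -(grounded_tr sa) -trmx_mul vM trmx0.
have : inner U (grounded a *m U) = 0 by rewrite MU inner0r.
rewrite mulmxDl innerDr => /eqP; rewrite paddr_eq0 ?laplacian_quad_ge0//; last first.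
  by rewrite inner_ones sumr_ge0// => k _; rewrite sqr_ge0.
case/andP => /eqP LU /eqP; rewrite inner_ones big_ord1 => /eqP; rewrite sqrf_eq0 => /eqP sU.
have edgeU i q : e i q -> U i 0 = U q 0.
  move=> eiq; have := laplacian_edge_le U i q 0 sa a0; rewrite LU.
  have [_] := ca i q; rewrite eiq => aiq.
  rewrite pmulr_rle0 ?invr_gt0// pmulr_rle0// => H.
  by apply/eqP; rewrite -subr_eq0 -sqrf_eq0 eq_le H sqr_ge0.
have constU i q : U i 0 = U q 0.
  have [_ _ /(_ i q)/connectP[s]] := graph_e.
  elim: s i => [|r s IHs] i /=; first by move=> _ ->.
  by case/andP => /edgeU -> /IHs H /H.
apply/rowP => i; rewrite mxE; have := sU.
under eq_bigr do rewrite (constU _ i).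
rewrite sumr_const card_ord => /eqP; rewrite mulrn_eq0 => /orP[/eqP n0|/eqP <-];
  last by rewrite mxE.
by have := ltn_ord i; rewrite {2}n0.
Qed.

(** Multiplication by [ones] kills both the Laplacian and [H], so the solution has the column sums
    of [B], and the two terms in [ones] cancel. *)
Lemma laplacian_invmx_grounded l a (B H : 'M[R]_(n, l)) : coupling_weights e a ->
  (forall k, \sum_i H i k = 0) ->
  laplacian a *m (invmx (grounded a) *m (ones *m B - H)) = - H.
Proof.
move=> ca H0; have sa := coupling_sym_loopless ca; set U := _ *m (_ - _).
have MU : grounded a *m U = ones *m B - H by rewrite mulmxA mulmxV ?mul1mx// grounded_unit.
clearbody U.
have OL : ones *m laplacian a = 0.
  apply/matrixP => i j; rewrite ones_mulE mxE -[laplacian a]mulmx1.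
  exact: laplacian_column_sum.
have OO : ones *m ones = n%:R *: ones.
  apply/matrixP => i j; rewrite ones_mulE !mxE; under eq_bigr do rewrite mxE.
  by rewrite sumr_const card_ord mulr1.
have OH : ones *m H = 0 by apply/matrixP => i k; rewrite ones_mulE mxE.
have : ones *m (grounded a *m U) = ones *m (ones *m B - H) by rewrite MU.
rewrite mulmxBr OH subr0 !mulmxA [ones *m grounded a]mulmxDr OL add0r OO -!scalemxAl => OU.
have {}OU : ones *m U = ones *m B.
  have [n0|n0] := eqVneq n 0%N; last first.
    by apply: (@scalerI _ _ (n%:R : R)); rewrite ?pnatr_eq0.
  by apply/matrixP => i; have := ltn_ord i; rewrite {2}n0.
by move: MU; rewrite mulmxDl OU addrC => /addrI.
Qed.

Lemma invmx_grounded_tr a : coupling_weights e a -> (invmx (grounded a))^T = invmx (grounded a).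
Proof. by move=> ca; rewrite trmx_inv grounded_tr//; exact: coupling_sym_loopless. Qed.

Lemma invmx_grounded_psd a : coupling_weights e a -> psd (invmx (grounded a)).
Proof.
move=> ca u; set P := invmx _.
have {1}-> : u = grounded a *m (P *m u) by rewrite mulmxA mulmxV ?mul1mx// grounded_unit.
rewrite innerC; apply: inner_grounded_ge0 => [|i q]; first exact: coupling_sym_loopless.
exact: coupling_ge0.
Qed.

End Laplacian.

(** * Convexity *)

Section ConvexOneVariable.
Variables (R : realType) (g : R -> R).
Hypothesis g_convex : convex_function [set: R^o] g.
Hypothesis g_diff : forall z : R, derivable g z 1.

Lemma is_derive_derive1 (z : R) : is_derive (z : R) (1 : R) g (derive1 g z).
Proof. by split; [exact: g_diff|rewrite derive1E]. Qed.

Lemma derivable_cvg z : g y @[y --> z] --> g z.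
Proof. exact/differentiable_continuous/derivable1_diffP. Qed.

(** By convexity the difference quotient from [z] towards [y] is at most g y - g z for every step in
    ]0, 1]; the step tends to 0. *)
Lemma convex_tangent z y : g z + derive1 g z * (y - z) <= g y.
Proof.
have dline : rd (fun h : R => h * (y - z) + z) 0 (y - z).
  rewrite -[X in rd _ _ X]addr0 -[X in rd _ _ (X + _)]mul1r.
  apply: rdD (rd_cst _ _); apply: rd_eq (rdM (is_derive_rd (is_derive_id _ _)) (rd_cst _ _)) _.
  by rewrite mulr0 addr0.
have dg : is_derive (0 * (y - z) + z) 1 g (derive1 g z).
  by rewrite mul0r add0r; exact: is_derive_derive1.
have [_ H] := rd_comp (f := fun h => h * (y - z) + z) dg dline.
rewrite -lerBrDl; apply: (cvgr_to_le H).
near=> h; rewrite addr0 mul0r add0r.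
have h0 : 0 < h by near: h; exact: nbhs_right_gt.
have h1 : h <= 1 by near: h; exact: nbhs_right_le.
rewrite ler_pdivrMr//.
have := @g_convex (Itv01 (ltW h0) h1) y z.
rewrite !in_setT => /(_ isT isT); rewrite convRE /= /unstable.onem.
have -> : h * (y - z) + z = conv (Itv01 (ltW h0) h1) (y : R^o) z.
  by rewrite convRE /= /unstable.onem; ring.
by move=> ?; lra.
Unshelve. all: by end_near. Qed.

(** The slope at [y] lies between the backward and forward chord slopes of a fixed length [d], which
    are continuous in [y] and close to the slope at [z]. The constraints are only assumed
    differentiable, yet the constraint force has to be bounded along the trajectory and to pass to
    the limit. *)
Lemma convex_derive1_cvg z : derive1 g y @[y --> z] --> derive1 g z.
Proof.
apply/cvgrPdist_lt => e e0.
have [d d0 Hd] : exists2 d, 0 < d &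
    (g (d + z) - g z) / d < derive1 g z + e /\ derive1 g z - e < (g z - g (- d + z)) / d.
  have /cvgrPdist_lt/(_ _ e0) := is_derive_cvg_quot (is_derive_derive1 z).
  rewrite near_withinE => /nbhs_ballP[d /= d0 dP].
  have dh : `|d / 2| < d by rewrite gtr0_norm; lra.
  exists (d / 2); first by rewrite divr_gt0.
  have := dP (d / 2); have := dP (- (d / 2)); rewrite /ball /= !sub0r !normrN.
  move=> /(_ dh); rewrite oppr_eq0 gt_eqF ?divr_gt0// => /(_ isT); rewrite ltr_norml => /andP[_ H1].
  move=> /(_ dh isT); rewrite ltr_norml => /andP[H2 _].
  split; first by lra.
  rewrite (_ : (g z - _) / _ = (g (- (d / 2) + z) - g z) / - (d / 2)); first by lra.
  by rewrite invrN mulrN -mulNr opprB.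
case: Hd => Hr Hl.
have sh c : c + y @[y --> z] --> c + z.
  by apply: cvgD; [exact: cvg_cst|exact: cvg_id].
have qr : ((g (d + y) - g y) / d) @[y --> z] --> (g (d + z) - g z) / d.
  apply: cvgM; last exact: cvg_cst.
  apply: cvgB; last exact: derivable_cvg.
  by apply: cvg_comp (sh (d)) _; exact: derivable_cvg.
have ql : ((g y - g (- d + y)) / d) @[y --> z] --> (g z - g (- d + z)) / d.
  apply: cvgM; last exact: cvg_cst.
  apply: cvgB; first exact: derivable_cvg.
  by apply: cvg_comp (sh (- d)) _; exact: derivable_cvg.
have nr := cvgr_lt _ qr _ Hr; have nl := cvgr_gt _ ql _ Hl.
near=> y.
have Hyr : (g (d + y) - g y) / d < derive1 g z + e by near: y; exact: nr.
have Hyl : derive1 g z - e < (g y - g (- d + y)) / d by near: y; exact: nl.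
have := convex_tangent y (d + y); have := convex_tangent y (- d + y).
rewrite !addrK => T1 T2.
have U1 : (g y - g (- d + y)) / d <= derive1 g y by rewrite ler_pdivrMr//; lra.
have U2 : derive1 g y <= (g (d + y) - g y) / d by rewrite ler_pdivlMr//; lra.
by rewrite ltr_norml; apply/andP; split; lra.
Unshelve. all: by end_near. Qed.

End ConvexOneVariable.

(** * Bounds on compact sets *)

Section Bounded.
Variable R : realType.

Lemma continuous_compact_bounded (T : topologicalType) (F : T -> R) (A : set T) :
  compact A -> continuous F -> exists B, forall z, A z -> `|F z| <= B.
Proof.
move=> cA cF; have := compact_bounded (continuous_compact (continuous_subspaceT cF) cA).
move=> [M [_ HM]]; exists (M + 1) => z Az.
by apply: (HM (M + 1)); [rewrite ltrDl|exists z].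
Qed.

Lemma continuous_rV_bounded l (F : 'rV[R]_l -> R) (C : R) : continuous F ->
  exists B, forall z : 'rV[R]_l, (forall k, `|z 0 k| <= C) -> `|F z| <= B.
Proof.
move=> cF; have [B HB] := continuous_compact_bounded
  (rV_compact (fun _ : 'I_l => @segment_compact R (- C) C)) cF.
by exists B => z zC; apply: HB => k /=; rewrite in_itv /= -ler_norml.
Qed.

Lemma continuous_bounded (F : R -> R) (C : R) : continuous F ->
  exists B, forall z, `|z| <= C -> `|F z| <= B.
Proof.
move=> cF; have [B HB] := continuous_compact_bounded (@segment_compact R (- C) C) cF.
by exists B => z zC; apply: HB; rewrite /= in_itv /= -ler_norml.
Qed.

End Bounded.

(** * Derivatives along curves and the separable objective *)

Section Curves.
Variable R : realType.

Lemma is_derive_curve l (F : 'rV[R]_l -> R) (y : R -> 'rV[R]_l) (t : R) v :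
  differentiable F (y t) -> is_derive t 1 y v ->
  is_derive t 1 (fun s => F (y s)) (\sum_k 'D_(delta_mx 0 k) F (y t) * v 0 k).
Proof.
move=> dF [/derivable1_diffP dy yv].
have dFy : differentiable (F \o y) t by exact: differentiable_comp.
split; first exact/derivable1_diffP.
have dyv : 'd y t 1 = v by rewrite -deriveE.
rewrite deriveE// diff_comp//= dyv [in LHS](row_sum_delta v).
rewrite linear_sum; apply: eq_bigr => k _.
by rewrite linearZ /= -deriveE// mulrC.
Qed.

Lemma is_derive_row p q (y : R -> 'M[R]_(p, q)) (t : R) v i :
  is_derive t 1 y v -> is_derive t 1 (fun s => row i (y s)) (row i v).
Proof.
move=> [dy yv].
have dr : derivable (fun s => row i (y s)) t 1.
  apply/derivable_mxP => i' k; under eq_fun do rewrite mxE.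
  by move/derivable_mxP : dy; exact.
split => //; rewrite derive_mx// -yv derive_mx//; apply/matrixP => i' k.
by rewrite !mxE; under eq_fun do rewrite mxE.
Qed.

Lemma is_derive_line (V : normedModType R) (X Y : V) (t : R) :
  is_derive t 1 (fun s : R => X + s *: Y) Y.
Proof.
suff H : (h^-1 *: ((X + (h *: 1 + t) *: Y) - (X + t *: Y))) @[h --> 0^'] --> Y.
  by split; [apply/cvg_ex; exists Y|exact/cvg_lim].
have : Y @[_ --> (0 : R)^'] --> Y by exact: cvg_cst.
apply: cvg_trans; apply: near_eq_cvg; near=> h.
have h0 : h != 0 by near: h; exact: nbhs_dnbhs_neq.
by rewrite opprD addrACA subrr add0r -scalerBl addrK [h *: 1]mulr1 scalerA mulVf// scale1r.
Unshelve. all: by end_near. Qed.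

End Curves.

Section Objective.
Variables (R : realType) (n l : nat) (f : 'I_n -> 'rV[R]_l -> R).
Hypothesis f_diff : forall i, twice_differentiable (f i).
Local Notation F := (objective f).

Lemma partial_cvg i k z : 'D_(delta_mx 0 k) (f i) y @[y --> z] --> 'D_(delta_mx 0 k) (f i) z.
Proof. by have [_ /(_ (delta_mx 0 k) z)/differentiable_continuous] := f_diff i. Qed.

Lemma gradient_objective X i k :
  gradient F X i k = 'D_(delta_mx 0 k) (f i) (row i X).
Proof.
rewrite mxE; apply/cvg_lim => //=.
have H : (\sum_i' h^-1 *: (f i' (h *: row i' (delta_mx i k) + row i' X) - f i' (row i' X)))
    @[h --> 0^'] --> \sum_i' 'D_(row i' (delta_mx i k)) (f i') (row i' X).
  by apply: cvg_sumr => i' _; have [/(_ (row i' X)) df _] := f_diff i'; exact: diff_derivable.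
rewrite (bigD1 i)//= big1 ?addr0 in H; last first.
  move=> i' ii'; have -> : row i' (delta_mx i k) = 0 :> 'rV[R]_l; last by rewrite derive0.
  by apply/rowP => k'; rewrite !mxE (negbTE ii').
have rd : row i (delta_mx i k) = delta_mx 0 k :> 'rV[R]_l.
  by apply/rowP => k'; rewrite !mxE eqxx.
rewrite rd in H; apply: cvg_trans H; apply: near_eq_cvg; near=> h.
rewrite /objective -sumrB scaler_sumr; apply: eq_bigr => i' _.
by rewrite linearP.
Unshelve. all: by end_near. Qed.

Lemma rd_objective (x : R -> 'M[R]_(n, l)) (t : R) v : is_derive t 1 x v ->
  rd (fun s => F (x s)) t (inner (gradient F (x t)) v).
Proof.
move=> xv; apply: rd_sum => i _.
have [/(_ (row i (x t))) df _] := f_diff i.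
apply: rd_eq (is_derive_rd (is_derive_curve df (is_derive_row i xv))) _.
by apply: eq_bigr => k _; rewrite gradient_objective mxE.
Qed.

Variables mu kappa : R.
Hypothesis f_smooth : strongly_convex_smooth mu kappa F.

(** Strong monotonicity of the gradient is integrated along the segment: [psi], the difference of
    the two sides at X + s V, starts at 0 and has a nonpositive derivative. *)
Lemma objective_tangent X Y :
  F X + inner (gradient F X) (Y - X) + mu / 2 * sqnorm (Y - X) <= F Y.
Proof.
set V := Y - X; pose G s := X + s *: V.
pose psi s := F X + s * inner (gradient F X) V + mu / 2 * sqnorm V * (s * s) - F (G s).
have dpsi s : rd psi s (0 + (1 * inner (gradient F X) V + s * 0) +
    mu / 2 * sqnorm V * (1 * s + s * 1) - inner (gradient F (G s)) V).
  have did : rd (fun s : R => s) s 1 by apply: is_derive_rd; exact: is_derive_id.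
  apply: rdB; last exact: rd_objective (is_derive_line X V s).
  apply: rdD; last exact: rdZ (rdM did did).
  by apply: rdD; [exact: rd_cst|exact: rdM did (rd_cst _ _)].
have : psi 1 <= psi 0.
  apply: rd_le0_nonincreasing => // s /andP[s0 s1]; eexists; last exact: dpsi.
  (* The gradient inequality between [G s] and [X] has to be divided by [s], hence the separate case
     s = 0. *)
  move: s0; rewrite le_eqVlt => /predU1P[<-|s0].
    by rewrite /G scale0r addr0; lra.
  have /andP[+ _] := f_smooth (G s) X.
  rewrite {1 3}/G [_ + _ - _]addrAC subrr add0r.
  have -> : sqnorm (s *: V) = s * (s * sqnorm V).
    rewrite /sqnorm /inner !mulr_sumr; apply: eq_bigr => i _.
    by rewrite !mulr_sumr; apply: eq_bigr => k _; rewrite !mxE; ring.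
  have -> A : inner A (s *: V) = s * inner A V.
    rewrite /inner !mulr_sumr; apply: eq_bigr => i _.
    by rewrite !mulr_sumr; apply: eq_bigr => k _; rewrite !mxE; ring.
  by rewrite innerBl mulrCA ler_pM2l// => ?; lra.
rewrite /psi /G scale0r addr0 scale1r mul0r !mulr0 !mulr1 !addr0 mul1r subrr.
have -> : X + V = Y by rewrite addrC subrK.
by move=> ?; lra.
Qed.

End Objective.

(** * Existence of multipliers *)

Section KKT.
Variables (R : realType) (n l : nat) (m : 'I_n -> 'I_l -> nat).
Variables (f : 'I_n -> 'rV[R]_l -> R) (g : constraints R m) (mu kappa : R).
Arguments g : clear implicits.
Hypothesis f_diff : forall i, twice_differentiable (f i).
Hypothesis f_smooth : strongly_convex_smooth mu kappa (objective f).
Hypothesis mu_gt0 : 0 < mu.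
Hypothesis g_convex : forall i k (j : 'I_(m i k)), convex_function [set: R^o] (g i k j).
Hypothesis g_diff : forall i k (j : 'I_(m i k)) (z : R), derivable (g i k j) z 1.
Local Notation F := (objective f).

(* The KKT conditions with alpha eliminated: a suitable alpha exists iff the
   columns of the remaining terms of the stationarity condition sum to zero. *)
Definition kkt_pair (xs : 'M[R]_(n, l)) (ths : multipliers R m) : Prop :=
  [/\ consensus xs, forall i k j, g i k j (xs i k) <= 0, nonneg ths,
      forall i k j, ths i k j * g i k j (xs i k) = 0
    & forall k, \sum_i (gradient F xs + constraint_force g xs ths) i k = 0].

Definition consensus_state (z : 'rV[R]_l) : 'M[R]_(n, l) := \matrix_(i, k) z 0 k.

Lemma minimizer_exists (z0 : 'rV[R]_l) :
  (0 < n)%N -> (forall i k j, g i k j (z0 0 k) <= 0) ->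
  exists2 z : 'rV[R]_l, forall i k j, g i k j (z 0 k) <= 0 &
    forall y : 'rV[R]_l, (forall i k j, g i k j (y 0 k) <= 0) ->
      F (consensus_state z) <= F (consensus_state y).
Proof.
move=> n0 fz0; pose X0 := consensus_state z0; pose G := gradient F X0.
(* On the sublevel set of [X0], the tangent inequality and Young's inequality give |V|^2 <= 4 |G|^2
   / mu^2 = C - 1 for the displacement V; then C - 1 <= C^2 bounds the entries by [C]. *)
pose C := 4 * sqnorm G / mu ^+ 2 + 1.
have C0 : 0 <= C.
  by rewrite addr_ge0// divr_ge0 ?exprn_ge0 ?(ltW mu_gt0)// mulr_ge0// sqnorm_ge0.
have coercive y k : F (consensus_state y) <= F X0 -> `|y 0 k - z0 0 k| <= C.
  move=> Fy; pose V := consensus_state y - X0.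
  have Vk : (y 0 k - z0 0 k) ^+ 2 <= sqnorm V.
    by have := entry_le_sqnorm V (Ordinal n0) k; rewrite !mxE.
  have young : - inner G V <= sqnorm G / mu + mu / 4 * sqnorm V.
    rewrite /sqnorm /inner mulr_suml mulr_sumr -big_split -sumrN; apply: ler_sum => i _.
    rewrite mulr_suml mulr_sumr -big_split -sumrN; apply: ler_sum => k' _ /=.
    have : 0 <= (G i k' + mu / 2 * V i k') ^+ 2 / mu by rewrite divr_ge0 ?sqr_ge0 ?ltW.
    rewrite (_ : _ / mu = G i k' * G i k' / mu + mu / 4 * (V i k' * V i k') + G i k' * V i k').
      by move=> ?; lra.
    by field; rewrite gt_eqF.
  have H := objective_tangent f_diff f_smooth X0 (consensus_state y).
  have VC : sqnorm V <= C - 1.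
    rewrite addrK ler_pdivlMr ?exprn_gt0// expr2 mulrA -ler_pdivlMr//.
    rewrite -/G -/V in H; lra.
  rewrite -(@ler_pXn2r _ 2) ?nnegrE//.
  rewrite -normrX ger0_norm ?sqr_ge0//.
  have : 0 <= C - 1 by exact: le_trans (sqnorm_ge0 _) VC.
  move=> C1; rewrite (le_trans Vk)// (le_trans VC)//.
  have := mulr_ge0 C1 C1; nra.
pose A k := `[z0 0 k - C, z0 0 k + C] `&` \bigcap_(s : {i : 'I_n & 'I_(m i k)})
  [set y : R | g (tag s) k (tagged s) y <= 0].
have cA k : compact (A k).
  apply: compact_closedI; first exact: segment_compact.
  apply: closed_bigI => s _; apply: (@closed_comp _ _ (g (tag s) k (tagged s)) [set y | y <= 0]).
    by move=> y _; exact: derivable_cvg.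
  exact: closed_le.
have inA (z : 'rV[R]_l) : (forall k, A k (z 0 k)) <->
    (forall k, `|z 0 k - z0 0 k| <= C) /\ (forall i k j, g i k j (z 0 k) <= 0).
  split=> [Az|[z1 z2] k].
    split=> [k|i k j]; have [+ +] := Az k.
      by rewrite /= in_itv /= => /andP[? ?] _; rewrite ler_norml; apply/andP; split; lra.
    by move=> _ /(_ (Tagged (fun i => 'I_(m i k)) j)); apply.
  split=> [|s _]; last exact: z2.
  by rewrite /= in_itv /=; have := z1 k; rewrite ler_norml => /andP[? ?]; apply/andP; split; lra.
have Az0 k : A k (z0 0 k).
  by move: k; apply/inA; split => // k; rewrite subrr normr0.
have Fc : continuous (fun z => F (consensus_state z)).
  move=> z; apply: (@cvg_sumr _ _ _ (nbhs_filter z)) => i _.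
  have rowE y : row i (consensus_state y) = y by apply/rowP => k; rewrite !mxE.
  under eq_fun do rewrite rowE; rewrite rowE.
  by have [/(_ z)/differentiable_continuous] := f_diff i.
have [|z] := EVT_min_rV _ (rV_compact cA) (continuous_subspaceT Fc).
  by exists z0.
rewrite inE => Az zmin; have [_ fz] := (inA z).1 Az; exists z => // y fy.
have [yX0|/ltW X0y] := leP (F (consensus_state y)) (F X0).
  by apply: zmin; rewrite inE; apply/(inA y).2; split => // k; exact: coercive.
by apply: le_trans X0y; apply: zmin; rewrite inE.
Qed.

(** Moving the common coordinate [k] against [p] lowers the objective at first order, so at a
    minimizer some constraint must forbid this move. Each constraint involves a single coordinate,
    hence only those on coordinate [k] can. *)
Lemma active_constraint (z s : 'rV[R]_l) k :
  (forall i k j, g i k j (s 0 k) < 0) ->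
  (forall i k j, g i k j (z 0 k) <= 0) ->
  (forall y : 'rV[R]_l, (forall i k j, g i k j (y 0 k) <= 0) ->
     F (consensus_state z) <= F (consensus_state y)) ->
  let p := \sum_i gradient F (consensus_state z) i k in
  p != 0 -> exists i (j : 'I_(m i k)),
    g i k j (z 0 k) = 0 /\ p * derive1 (g i k j) (z 0 k) < 0.
Proof.
move=> slat fz zmin p p0; apply: contrapT => noactive.
pose V := consensus_state (- p *: delta_mx 0 k).
have qF : (F (consensus_state z + (h + 0) *: V) - F (consensus_state z + 0 *: V)) / h
    @[h --> 0^'+] --> - p * p.
  have [_] := rd_objective f_diff (is_derive_line (consensus_state z) V 0).
  rewrite scale0r addr0 (_ : inner _ _ = - p * p)//.
  rewrite /p mulr_sumr; apply: eq_bigr => i _; rewrite (bigD1 k)//= big1 ?addr0.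
    by rewrite !mxE !eqxx mulr1 mulrC.
  by move=> k' kk'; rewrite !mxE (negbTE kk') !mulr0.
have nF : \forall h \near 0^'+, (F (consensus_state z + (h + 0) *: V) -
    F (consensus_state z + 0 *: V)) / h < 0.
  apply: (cvgr_lt _ qF); rewrite mulNr oppr_lt0 -expr2 lt_neqAle sqr_ge0 andbT.
  by rewrite eq_sym sqrf_eq0.
have ng : \forall h \near 0^'+, forall q : {i : 'I_n & 'I_(m i k)},
    g (tag q) k (tagged q) (z 0 k + (h + 0) *: - p) <= 0.
  apply: filter_forall => -[i j] /=.
  have := rd_comp (f := fun h => z 0 k + h *: - p)
    (is_derive_derive1 (@g_diff i k j) _) (is_derive_rd (is_derive_line (z 0 k) (- p) 0)).
  move=> [_]; rewrite scale0r addr0 => qg.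
  have := fz i k j; rewrite le_eqVlt => /predU1P[g0|gneg]; last first.
    have sh : z 0 k + (h + 0) *: - p @[h --> 0^'+] --> z 0 k.
      have [cl _] := is_derive_rd (is_derive_line (z 0 k) (- p) 0).
      by have := cvg_shift_right cl; rewrite scale0r addr0.
    have cg : g i k j (z 0 k + (h + 0) *: - p) @[h --> 0^'+] --> g i k j (z 0 k).
      by apply: cvg_comp sh _; apply: derivable_cvg; exact: g_diff.
    exact: (cvgr_le _ cg).
  (* An active constraint has nonzero slope at [z]: otherwise its tangent would force it to be
     nonnegative at the Slater point [s]. *)
  have slope : derive1 (g i k j) (z 0 k) * - p < 0.
    have := convex_tangent (@g_convex i k j) (@g_diff i k j) (z 0 k) (s 0 k).
    rewrite g0 add0r => T.
    have T0 := le_lt_trans T (slat i k j).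
    rewrite lt_neqAle; apply/andP; split.
      rewrite mulf_neq0 ?oppr_eq0//; apply/eqP => d0.
      by move: T0; rewrite d0 mul0r ltxx.
    rewrite mulrN oppr_le0 mulrC leNgt; apply/negP => pg.
    by apply: noactive; exists i, j.
  have nq : \forall h \near 0^'+,
      (g i k j (z 0 k + (h + 0) *: - p) - g i k j (z 0 k)) / h < 0.
    exact: (cvgr_lt _ qg).
  near=> h.
  have H : (g i k j (z 0 k + (h + 0) *: - p) - g i k j (z 0 k)) / h < 0 by near: h.
  rewrite g0 subr0 in H.
  have h0 : 0 < h by near: h; exact: nbhs_right_gt.
  by apply: ltW; move: H; rewrite ltr_pdivrMr// mul0r.
have /filter_ex[h [[h0 hF] hg]] : \forall h \near 0^'+, (0 < h /\
   (F (consensus_state z + (h + 0) *: V) - F (consensus_state z + 0 *: V)) / h < 0) /\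
   forall q : {i : 'I_n & 'I_(m i k)}, g (tag q) k (tagged q) (z 0 k + (h + 0) *: - p) <= 0.
  by apply: filterI ng; apply: filterI nF; exact: nbhs_right_gt.
pose y : 'rV[R]_l := z + (h + 0) *: (- p *: delta_mx 0 k).
have yE : consensus_state z + (h + 0) *: V = consensus_state y.
  by apply/matrixP => i k'; rewrite !mxE.
move: hF; rewrite ltr_pdivrMr// mul0r yE scale0r addr0 subr_lt0 ltNge => /negP; apply.
apply: zmin => i k' j; rewrite !mxE; have [kk'|_] := eqVneq k' k.
  by rewrite kk' in j *; rewrite mulr1; exact: (hg (Tagged (fun i => 'I_(m i k)) j)).
by rewrite andbF !mulr0 addr0.
Unshelve. all: by end_near. Qed.

(** Consensus reduces stationarity to one scalar equation per coordinate [k], which a single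
    multiplier, placed on one blocking active constraint, can balance. *)
Lemma kkt_pair_exists : slater g -> exists xs ths, kkt_pair xs ths.
Proof.
move=> [X0 [cX0 X0neg]].
have [n0|n0] := posnP n.
  exists X0, (fun _ _ _ => 0); split => // [i|i|k]; try by have := ltn_ord i; rewrite {2}n0.
  by rewrite big1// => i; have := ltn_ord i; rewrite {2}n0.
pose i0 := Ordinal n0; pose s := row i0 X0.
have sneg i k j : g i k j (s 0 k) < 0 by rewrite mxE (cX0 i0 i).
have [z fz zmin] := minimizer_exists n0 (fun i k j => ltW (sneg i k j)).
pose xs := consensus_state z; pose p k := \sum_i gradient F xs i k.
have theta k : exists t : forall i, 'I_(m i k) -> R,
    [/\ forall i j, 0 <= t i j, forall i j, t i j * g i k j (z 0 k) = 0 &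
        p k + \sum_i \sum_j t i j * derive1 (g i k j) (z 0 k) = 0].
  have [pk0|pk0] := eqVneq (p k) 0.
    exists (fun _ _ => 0); split => // [i j|]; first by rewrite mul0r.
    by rewrite pk0 big1 ?addr0// => i _; rewrite big1// => j _; rewrite mul0r.
  have [i [j [g0 pg]]] := active_constraint sneg fz zmin pk0.
  pose th := - p k / derive1 (g i k j) (z 0 k).
  have dg0 : derive1 (g i k j) (z 0 k) != 0.
    by apply/eqP => d0; move: pg; rewrite d0 mulr0 ltxx.
  have th0 : 0 <= th.
    have -> : th = - (p k * derive1 (g i k j) (z 0 k)) / derive1 (g i k j) (z 0 k) ^+ 2.
      by rewrite /th; field.
    by rewrite divr_ge0 ?sqr_ge0// oppr_ge0 ltW.
  (* The type of [j] depends on [i], so index pairs are compared as dependent pairs. *)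
  pose T i j := Tagged (fun i => 'I_(m i k)) (j : 'I_(m i k)).
  exists (fun i' j' => if T i' j' == T i j then th else 0); split.
  - by move=> i' j'; case: ifP.
  - move=> i' j'; case: ifP => [/eqP E|]; last by rewrite mul0r.
    suff -> : g i' k j' (z 0 k) = 0 by rewrite mulr0.
    by rewrite -g0; exact: (congr1 (fun q => g (tag q) k (tagged q) (z 0 k)) E).
  - rewrite (bigD1 i)//= (bigD1 j)//= eqxx divfK// big1 ?big1 ?addr0 ?subrr//.
      move=> i' ii'; rewrite big1// => j' _; case: eqP => [/(congr1 tag)/= E|].
        by rewrite E eqxx in ii'.
      by rewrite mul0r.
    by move=> j' jj'; rewrite eq_Tagged /= (negbTE jj') mul0r.
exists xs, (fun i k j => sval (cid (theta k)) i j); split.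
- by move=> i q k; rewrite !mxE.
- by move=> i k j; rewrite mxE.
- by move=> i k j; have [] := svalP (cid (theta k)).
- by move=> i k j; rewrite mxE; have [] := svalP (cid (theta k)).
- move=> k; have [_ _ sum0] := svalP (cid (theta k)); apply: etrans sum0.
  under eq_bigr do rewrite mxE; rewrite big_split; congr (_ + _).
  by apply: eq_bigr => i _; rewrite mxE; apply: eq_bigr => j _; rewrite mxE.
Qed.

End KKT.

(** * The projected flow of one multiplier *)

Section ProjectedFlow.
Variables (R : realType) (G theta : R -> R).
Local Notation rate := (fun s => pos_proj (G s) (theta s)).
Hypothesis theta0 : 0 <= theta 0.
Hypothesis theta_cont : forall t : R, 0 < t -> theta s @[s --> t] --> theta t.
Hypothesis G_cont : forall t : R, 0 < t -> G s @[s --> t] --> G t.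
Hypothesis theta_sol : forall t : R, 0 <= t ->
  (@lebesgue_measure R).-integrable `[0, t] (EFin \o rate) /\
  theta t = theta 0 + \int[lebesgue_measure]_(s in `[0, t]) rate s.

(** The interval is open on the left because the rate is later controlled only after its left
    end. *)
Lemma projected_incrementE (s t : R) : 0 <= s -> s < t ->
  (@lebesgue_measure R).-integrable `]s, t] (EFin \o rate) /\
  theta t - theta s = \int[lebesgue_measure]_(u in `]s, t]) rate u.
Proof.
move=> s0 st; have t0 : 0 <= t by exact: le_trans (ltW st).
have [it Et] := theta_sol t0; have [ints Es] := theta_sol s0.
split.
  apply: (integrableS _ _ _ it) => //.
  by apply: subset_itv; rewrite bnd_simp.
rewrite Et Es opprD addrACA subrr add0r.
by apply: Rintegral_itvB => //; rewrite bnd_simp// ltW.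
Qed.

Lemma Rintegral_oc_cst (s t c : R) : s < t ->
  (@lebesgue_measure R).-integrable `]s, t] (EFin \o cst c) /\
  \int[lebesgue_measure]_(u in `]s, t]) c = c * (t - s).
Proof.
move=> st; split; last by rewrite Rintegral_cst//= lebesgue_measure_itv /= lte_fin st.
have ic : (@lebesgue_measure R).-integrable `[s, t] (EFin \o cst c).
  apply: continuous_compact_integrable; first exact: segment_compact.
  by apply: continuous_subspaceT => ?; exact: cvg_cst.
by apply: (integrableS _ _ _ ic) => //; apply: subset_itv; rewrite bnd_simp.
Qed.

Lemma projected_increment_ge (s t c : R) : 0 <= s -> s < t ->
  (forall u, s < u <= t -> c <= rate u) -> c * (t - s) <= theta t - theta s.
Proof.
move=> s0 st bnd; have [ir ->] := projected_incrementE s0 st.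
have [ic <-] := Rintegral_oc_cst c st.
by apply: le_Rintegral => // u; rewrite /= in_itv; exact: bnd.
Qed.

Lemma projected_increment_le (s t c : R) : 0 <= s -> s < t ->
  (forall u, s < u <= t -> rate u <= c) -> theta t - theta s <= c * (t - s).
Proof.
move=> s0 st bnd; have [ir ->] := projected_incrementE s0 st.
have [ic <-] := Rintegral_oc_cst c st.
by apply: le_Rintegral => // u; rewrite /= in_itv; exact: bnd.
Qed.

(** After the last time [z] at which theta is nonnegative, the rate is either a positive value of
    [G] or 0, so theta cannot fall below its value at [z]. *)
Lemma projected_ge0 (t : R) : 0 <= t -> 0 <= theta t.
Proof.
rewrite le_eqVlt => /predU1P[<-//|t0]; rewrite leNgt; apply/negP => tneg.
pose S := [set u | 0 <= u <= t /\ 0 <= theta u].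
have S0 : S 0 by split; [rewrite lexx ltW|].
have ubS : ubound S t by move=> u [/andP[]].
have supS : has_sup S by split; [exists 0|exists t].
pose z := sup S.
have z0 : 0 <= z by apply: ub_le_sup => //; exists t.
have zt : z <= t by apply: ge_sup => //; exists 0.
have above u : z < u <= t -> theta u < 0.
  move=> /andP[zu ut]; rewrite ltNge; apply/negP => thu.
  have Su : S u by split => //; rewrite ut (le_trans z0)// ltW.
  by have := ub_le_sup (ex_intro _ t ubS) Su; rewrite leNgt zu.
have thz : 0 <= theta z.
  move: z0; rewrite le_eqVlt => /predU1P[<-//|z0]; rewrite leNgt; apply/negP => thz.
  have : \forall u \near z, theta u < 0 by apply: (cvgr_lt _ (theta_cont z0)).
  move=> /nbhs_ballP[d /= d0 dP].
  have [u [utI thu] zu] := sup_adherent d0 supS.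
  have uz : u <= z by apply: ub_le_sup; [exists t|].
  have /dP : ball z d u by rewrite /ball /= ger0_norm ?subr_ge0//; rewrite -/z in zu; lra.
  by rewrite /= ltNge thu.
have ltzt : z < t.
  by rewrite lt_neqAle zt andbT; apply: contraTneq thz => ->; rewrite -ltNge.
have : 0 * (t - z) <= theta t - theta z.
  apply: projected_increment_ge => // u uI; rewrite /pos_proj.
  have thu := above u uI; case: ifPn => // /orP[|/ltW//].
  by rewrite ltNge (ltW thu).
by rewrite mul0r subr_ge0 leNgt (lt_le_trans tneg thz).
Qed.

(** If theta or [G] is positive at [t], the rate coincides with [G] nearby. Otherwise theta vanishes
    at [t] and the rate is at most [eps] just after it, while theta stays nonnegative: the quotient
    is squeezed between 0 and [eps]. *)
Lemma rd_projected (t : R) : 0 < t -> rd theta t (rate t).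
Proof.
move=> t0; split; first exact: theta_cont.
have Gt := G_cont t0; have tht := theta_cont t0.
have shl (P : set R) : (\forall s \near t, P s) ->
    exists2 d : R, 0 < d & forall u, t < u <= t + d -> P u.
  move=> /nbhs_ballP[d /= d0 dP]; exists (d / 2); first by rewrite divr_gt0.
  by move=> u /andP[tu utd]; apply: dP; rewrite /ball /= ltr0_norm; lra.
apply/cvgrPdist_le => eps eps0.
have [pos|neg] := boolP ((0 < theta t) || (0 < G t)).
  have npos : \forall s \near t, (0 < theta s) || (0 < G s).
    case/orP: pos => p.
      have : \forall s \near t, 0 < theta s by apply: (cvgr_gt _ tht).
      by apply: filterS => s ->.
    have : \forall s \near t, 0 < G s by apply: (cvgr_gt _ Gt).
    by apply: filterS => s ->; rewrite orbT.
  have nG : \forall s \near t, `|G t - G s| <= eps by move/cvgrPdist_le : Gt; exact.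
  have [d d0 dP] := shl _ (filterI npos nG).
  rewrite /pos_proj pos; near=> h.
  have h0 : 0 < h by near: h; exact: nbhs_right_gt.
  have hd : h <= d by near: h; exact: nbhs_right_le.
  have thh : t < h + t by rewrite ltrDr.
  have bnd u : t < u <= h + t -> G t - eps <= rate u <= G t + eps.
    move=> /andP[tu uth]; have [] := dP u; first by rewrite tu (le_trans uth)// addrC lerD2l.
    by rewrite /pos_proj => -> ; rewrite ler_norml => /andP[? ?]; apply/andP; split; lra.
  have ge := projected_increment_ge (ltW t0) thh (fun u uI => proj1 (elimT andP (bnd u uI))).
  have le := projected_increment_le (ltW t0) thh (fun u uI => proj2 (elimT andP (bnd u uI))).
  rewrite addrK -ler_pdivlMr// in ge; rewrite addrK -ler_pdivrMr// in le.
  by rewrite ler_norml; apply/andP; split; lra.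
rewrite /pos_proj (negbTE neg).
move: neg; rewrite negb_or -!leNgt => /andP[tht0 Gt0].
have th0 : theta t = 0 by apply/le_anti; rewrite tht0 projected_ge0// ltW.
have nG : \forall s \near t, G s <= eps by apply: (cvgr_le _ Gt); exact: le_lt_trans eps0.
have [d d0 dP] := shl _ nG.
near=> h.
have h0 : 0 < h by near: h; exact: nbhs_right_gt.
have hd : h <= d by near: h; exact: nbhs_right_le.
have thh : t < h + t by rewrite ltrDr.
have le : theta (h + t) - theta t <= eps * (h + t - t).
  apply: projected_increment_le => //; first exact: ltW.
  move=> u /andP[tu uth]; rewrite /pos_proj; case: ifP => _; last exact: ltW.
  by apply: dP; rewrite tu (le_trans uth)// addrC lerD2l.
rewrite addrK -ler_pdivrMr// th0 in le; rewrite th0 sub0r normrN ger0_norm//.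
by rewrite subr0 divr_ge0 ?(ltW h0)// projected_ge0// addr_ge0 ?ltW.
Unshelve. all: by end_near. Qed.

End ProjectedFlow.

(** * The network dynamics *)

Section Dynamics.
Variables (R : realType) (n l : nat) (m : 'I_n -> 'I_l -> nat).
Variables (e : rel 'I_n) (f : 'I_n -> 'rV[R]_l -> R) (g : constraints R m).
Variables (d : 'M[R]_n) (mu kappa : R).
Variables (x : R -> 'M[R]_(n, l)) (a : R -> 'M[R]_n) (alpha : R -> 'M[R]_(n, l)).
Variable th : R -> multipliers R m.
Arguments g : clear implicits.
Arguments th : clear implicits.
Hypothesis graph_e : connected_graph e.
Hypothesis f_diff : forall i, twice_differentiable (f i).
Hypothesis g_convex : forall i k (j : 'I_(m i k)), convex_function [set: R^o] (g i k j).
Hypothesis g_diff : forall i k (j : 'I_(m i k)) (z : R), derivable (g i k j) z 1.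
Hypothesis mu_gt0 : 0 < mu.
Hypothesis f_smooth : strongly_convex_smooth mu kappa (objective f).
Hypothesis d_gain : forall i q, e i q -> 0 < d i q /\ d i q = d q i.
Hypothesis sol : hybrid_solution f g e d x a alpha th.

Implicit Types s t : R.

Local Notation F := (objective f).
Local Notation L t := (laplacian (a t)).

Definition velocity (t : R) : 'M[R]_(n, l) :=
  - gradient F (x t) - L t *m x t - L t *m alpha t - constraint_force g (x t) (th t).

Definition weight_velocity (t : R) : 'M[R]_n :=
  \matrix_(i, q) if e i q then
    d i q * (sqnorm (row i (x t) - row q (x t)) +
             sqnorm (row i (velocity t) - row q (velocity t))) else 0.

Definition multiplier_rate (t : R) : multipliers R m :=
  fun i k j => pos_proj (g i k j (x t i k)) (th t i k j).
Arguments multiplier_rate : clear implicits.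

Lemma weights_sym t : 0 <= t -> sym_loopless (a t).
Proof. by move=> /(sol_weights sol)/(coupling_sym_loopless graph_e). Qed.

Lemma weights_ge0 t i q : 0 <= t -> 0 <= a t i q.
Proof. by move=> /(sol_weights sol)/coupling_ge0. Qed.

Lemma mrd_x t : 0 < t -> mrd x t (velocity t).
Proof. by move=> t0; exact: is_derive_mrd (sol_x sol t0). Qed.

Lemma mrd_alpha t : 0 < t -> mrd alpha t (L t *m x t).
Proof. by move=> t0; exact: is_derive_mrd (sol_alpha sol t0). Qed.

Lemma mrd_a t : 0 < t -> mrd a t (weight_velocity t).
Proof.
move=> t0 i q; rewrite mxE; case: ifPn => eiq.
  have dv := is_derive_row i (sol_x sol t0); have dw := is_derive_row q (sol_x sol t0).
  have -> : row i (velocity t) - row q (velocity t) = derive1 (disagreement x i q) t.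
    by rewrite derive1E; apply/esym; exact: derive_val.
  exact: is_derive_rd (sol_a sol t0 eiq).
have a0 s : 0 <= s -> a s i q = 0.
  by move=> /(sol_weights sol)/(_ i q)[_]; rewrite (negbTE eiq) => /eqP.
apply: is_derive_rd; apply: (@near_eq_is_derive _ _ _ (cst 0)); rewrite ?oner_neq0//.
near=> s; rewrite a0//; apply: ltW; near: s; exact: lt_nbhsr.
Unshelve. all: by end_near. Qed.

Lemma weight_velocity_ge0 t i q : 0 <= weight_velocity t i q.
Proof.
rewrite mxE; case: ifP => // /d_gain[d0 _].
by rewrite mulr_ge0 ?(ltW d0)// addr_ge0// sqnorm_ge0.
Qed.

Lemma weight_velocity_sym t : sym_loopless (weight_velocity t).
Proof.
have [se ie _] := graph_e; split=> [i q|i]; rewrite !mxE; last by rewrite ie.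
rewrite se; case: ifP => // /d_gain[_ ->].
by rewrite -opprB sqnormN -[X in _ + sqnorm X]opprB sqnormN.
Qed.

Lemma x_cvg t i k : 0 < t -> x s i k @[s --> t] --> x t i k.
Proof. by move=> /mrd_x/(_ i k)[]. Qed.

Lemma rd_g t i k j : 0 < t ->
  rd (fun s => g i k j (x s i k)) t (derive1 (g i k j) (x t i k) * velocity t i k).
Proof.
move=> t0; apply: rd_comp (mrd_x t0 i k).
by apply: is_derive_derive1; exact: g_diff.
Qed.

Lemma constraint_cvg t i k j : 0 < t -> g i k j (x s i k) @[s --> t] --> g i k j (x t i k).
Proof. by move=> /(rd_g j)[]. Qed.

Lemma th_cvg t i k j : 0 < t -> th s i k j @[s --> t] --> th t i k j.
Proof.
move=> t0; have : {within `[0, +oo[, continuous (fun s => th s i k j)}.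
  exact: (sol_cont_th sol).
have sub : `[0, t + 1] `<=` `[0, +oo[ by apply: subset_itvl; rewrite bnd_simp.
move=> /(continuous_subspaceW sub) /within_continuous_continuous; apply.
  by rewrite ltr_wpDl// ltW.
by rewrite in_itv /= t0 ltrDl ltr01.
Qed.

Lemma th_ge0 t i k j : 0 <= t -> 0 <= th t i k j.
Proof.
apply: (@projected_ge0 _ (fun s => g i k j (x s i k)) (fun s => th s i k j)).
- exact: sol_init sol _ _ _.
- by move=> s s0; exact: th_cvg.
- by move=> s; exact: (sol_th sol).
Qed.

Lemma rd_th t i k j : 0 < t -> rd (fun s => th s i k j) t (multiplier_rate t i k j).
Proof.
apply: (@rd_projected _ (fun s => g i k j (x s i k)) (fun s => th s i k j)).
- exact: sol_init sol _ _ _.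
- by move=> s s0; exact: th_cvg.
- by move=> s s0; exact: constraint_cvg.
- by move=> s; exact: (sol_th sol).
Qed.

Lemma rd_F t : 0 < t -> rd (fun s => F (x s)) t (inner (gradient F (x t)) (velocity t)).
Proof. by move=> t0; exact: (rd_objective f_diff (sol_x sol t0)). Qed.

(** * The Lyapunov function *)

Section Lyapunov.
Variables (xs beta : 'M[R]_(n, l)) (ths : multipliers R m).
Arguments ths : clear implicits.
Hypothesis kkt_s : kkt_pair f g xs ths.

(* The weights vary, hence so does the multiplier alpha solving the KKT system;
   beta only fixes its mean. *)
Definition rhs_star : 'M[R]_(n, l) :=
  ones R n *m beta - (gradient F xs + constraint_force g xs ths).
Local Notation P t := (invmx (grounded (a t))).
Definition alpha_star t : 'M[R]_(n, l) := P t *m rhs_star.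

Definition gap_energy t : R :=
  2^-1 * (sqnorm (x t - xs) + sqnorm (alpha t - alpha_star t) +
    \sum_i \sum_k \sum_j (th t i k j - ths i k j) * (th t i k j - ths i k j)).

(* Since P t is nonincreasing, its trace bounds the total variation of
   alpha_star: this is what the exponential weight pays for. *)
Definition variation_potential t : R := n%:R * (1 + sqnorm rhs_star) * \tr (P t).

Definition lyapunov t : R := (1 + gap_energy t) * expR (variation_potential t).

Definition dissipation t : R :=
  mu * sqnorm (x t - xs) + inner (x t - xs) (L t *m (x t - xs)).

Lemma grounded_near t : 0 < t -> \forall s \near t, grounded (a s) \in unitmx.
Proof.
move=> t0; near=> s; apply: (grounded_unit graph_e); apply: (sol_weights sol).
by apply: ltW; near: s; exact: lt_nbhsr.
Unshelve. all: by end_near. Qed.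

Lemma mrd_P t : 0 < t ->
  mrd (fun s => P s) t (- (P t *m laplacian (weight_velocity t) *m P t)).
Proof.
move=> t0; apply: mrd_invmx; first exact: grounded_near.
  by apply: (grounded_unit graph_e); apply: (sol_weights sol); exact: ltW.
apply: mrd_eq (mrdD (mrd_laplacian (mrd_a t0)) (mrd_cst _ _)) _.
by rewrite addr0.
Qed.

Lemma P_tr t : 0 <= t -> (P t)^T = P t.
Proof. by move=> /(sol_weights sol)/(invmx_grounded_tr graph_e). Qed.

Lemma P_psd t : 0 <= t -> psd (P t).
Proof. by move=> /(sol_weights sol)/(invmx_grounded_psd graph_e). Qed.

Let N t := P t *m laplacian (weight_velocity t) *m P t.

Lemma P_decay_tr t : 0 <= t -> (N t)^T = N t.
Proof.
move=> t0; rewrite /N !trmx_mul P_tr// laplacian_tr ?mulmxA//.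
exact: weight_velocity_sym.
Qed.

Lemma P_decay_psd t : 0 <= t -> psd (N t).
Proof.
move=> t0 u; rewrite /N -!mulmxA inner_mulmx P_tr//.
apply: laplacian_quad_ge0; first exact: weight_velocity_sym.
by move=> i q; exact: weight_velocity_ge0.
Qed.

Lemma gap_energy_ge0 t : 0 <= gap_energy t.
Proof.
rewrite mulr_ge0 ?invr_ge0// !addr_ge0 ?sqnorm_ge0//.
by do 3 (apply: sumr_ge0 => ? _); rewrite -expr2 sqr_ge0.
Qed.

Lemma variation_potential_ge0 t : 0 <= t -> 0 <= variation_potential t.
Proof.
move=> t0; rewrite mulr_ge0 ?psd_trace_ge0//; last exact: P_psd.
by rewrite mulr_ge0// addr_ge0// sqnorm_ge0.
Qed.

Lemma dissipation_ge0 t : 0 <= t -> 0 <= dissipation t.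
Proof.
move=> t0; rewrite addr_ge0 ?mulr_ge0 ?(ltW mu_gt0) ?sqnorm_ge0//.
apply: laplacian_quad_ge0; first exact: weights_sym.
by move=> i q; exact: weights_ge0.
Qed.

Lemma laplacian_xs t : 0 <= t -> L t *m xs = 0.
Proof.
have [cxs _ _ _ _] := kkt_s => t0.
by apply: laplacian_consensus; [exact: weights_sym|exact: cxs].
Qed.

Lemma laplacian_alpha_star t : 0 <= t ->
  L t *m alpha_star t = - (gradient F xs + constraint_force g xs ths).
Proof.
have [_ _ _ _ h0] := kkt_s => t0.
by apply: (laplacian_invmx_grounded graph_e); [exact: (sol_weights sol)|exact: h0].
Qed.

(** The tangents of each constraint at [x t] and at [xs] pair the forces with the multipliers, and
    complementarity removes the terms in ths g(xs). The projection helps: where it acts, theta = 0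
    and g <= 0, so the discarded term - ths g is nonnegative. *)
Lemma multiplier_dissipation t : 0 <= t ->
  - inner (x t - xs) (constraint_force g (x t) (th t))
    + inner (x t - xs) (constraint_force g xs ths)
    + \sum_i \sum_k \sum_j (th t i k j - ths i k j) * multiplier_rate t i k j <= 0.
Proof.
have [cxs fxs ths0 comp _] := kkt_s => t0.
rewrite /inner -sumrN -!big_split /=; apply: sumr_le0 => i _.
rewrite -sumrN -!big_split /=; apply: sumr_le0 => k _.
rewrite !mxE !mulr_sumr -sumrN -!big_split /=; apply: sumr_le0 => j _.
have thp := th_ge0 j t0; have thsp := ths0 i k j; have gs := fxs i k j.
have T1 := convex_tangent (@g_convex i k j) (@g_diff i k j) (x t i k) (xs i k).
have T2 := convex_tangent (@g_convex i k j) (@g_diff i k j) (xs i k) (x t i k).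
have cs := comp i k j.
have H1 : th t i k j * (g i k j (x t i k) + derive1 (g i k j) (x t i k) * (xs i k - x t i k))
    <= th t i k j * g i k j (xs i k) by exact: ler_wpM2l.
have H2 : ths i k j * (g i k j (xs i k) + derive1 (g i k j) (xs i k) * (x t i k - xs i k))
    <= ths i k j * g i k j (x t i k) by exact: ler_wpM2l.
have H3 : th t i k j * g i k j (xs i k) <= 0 by exact: mulr_ge0_le0.
have H4 : (th t i k j - ths i k j) * multiplier_rate t i k j <=
    (th t i k j - ths i k j) * g i k j (x t i k).
  rewrite /multiplier_rate /pos_proj; case: ifPn => //.
  rewrite negb_or -!leNgt => /andP[th_le g_le].
  have -> : th t i k j = 0 by apply/le_anti/andP.
  by rewrite mulr0 sub0r mulNr oppr_ge0 mulr_ge0_le0.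
lra.
Qed.

(** The coupling between [x] and [alpha] cancels, and what remains is the drift of [alpha_star], at
    most tr N times a constant times [1 + gap_energy t]. Since tr N is minus the derivative of tr P,
    differentiating the exponential factor produces exactly the opposite term. *)
Lemma lyapunov_decay t : 0 < t ->
  exists2 c, c <= - dissipation t & rd lyapunov t c.
Proof.
move=> t0; have t0' := ltW t0; pose A := alpha t - alpha_star t.
have dx := mrdB (mrd_x t0) (mrd_cst xs t); rewrite subr0 in dx.
have dal : mrd (fun s => alpha s - alpha_star s) t (L t *m x t + N t *m rhs_star).
  apply: mrd_eq (mrdB (mrd_alpha t0) (mrdM (mrd_P t0) (mrd_cst rhs_star t))) _.
  by rewrite mulmx0 addr0 mulNmx opprK.
have dth i k j := rdB (rd_th j t0 : rd (fun s => th s i k j) _ _) (rd_cst (ths i k j) t).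
pose w := inner (x t - xs) (velocity t) + inner A (L t *m x t + N t *m rhs_star) +
  \sum_i \sum_k \sum_j (th t i k j - ths i k j) * multiplier_rate t i k j.
have dW : rd gap_energy t w.
  have dsq : rd (fun s =>
      \sum_i \sum_k \sum_j (th s i k j - ths i k j) * (th s i k j - ths i k j)) t
      (\sum_i \sum_k \sum_j ((multiplier_rate t i k j - 0) * (th t i k j - ths i k j) +
        (th t i k j - ths i k j) * (multiplier_rate t i k j - 0))).
    by do 3 (apply: rd_sum => ? _); exact: rdM.
  apply: rd_eq (rdZ 2^-1 (rdD (rdD (rd_inner dx dx) (rd_inner dal dal)) dsq)) _.
  rewrite (innerC (velocity t)) [inner (_ + _) (alpha t - _)]innerC /w -/A.
  under eq_bigr do under eq_bigr do under eq_bigr do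
    rewrite subr0 [multiplier_rate _ _ _ _ * _]mulrC -mulr2n -mulr_natl.
  under eq_bigr do under eq_bigr do rewrite -mulr_sumr.
  under eq_bigr do rewrite -mulr_sumr.
  by rewrite -mulr_sumr; lra.
have wle : w <= - dissipation t + \tr (N t) * (n%:R * (1 + sqnorm rhs_star)) * (1 + gap_energy t).
  have Lx : L t *m x t = L t *m (x t - xs) by rewrite mulmxBr laplacian_xs// subr0.
  have E1 : inner A (L t *m x t) = inner (x t - xs) (L t *m alpha t) +
      inner (x t - xs) (gradient F xs) + inner (x t - xs) (constraint_force g xs ths).
    rewrite Lx inner_laplacianC; last exact: weights_sym.
    by rewrite innerC mulmxBr laplacian_alpha_star// opprK !innerDr addrA.
  have E2 : inner (x t - xs) (velocity t) = - inner (x t - xs) (gradient F (x t))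
      - inner (x t - xs) (L t *m (x t - xs)) - inner (x t - xs) (L t *m alpha t)
      - inner (x t - xs) (constraint_force g (x t) (th t)).
    by rewrite /velocity !innerBr innerNr Lx.
  have /andP[E3 _] := f_smooth (x t) xs.
  rewrite innerC innerBr in E3.
  have E4 := multiplier_dissipation t0'.
  have E5 := psd_inner_le A rhs_star (P_decay_tr t0') (P_decay_psd t0').
  have trN0 := psd_trace_ge0 (P_decay_psd t0').
  have E6 : \tr (N t) * (n%:R * (sqnorm A + sqnorm rhs_star) / 2) <=
      \tr (N t) * (n%:R * (1 + sqnorm rhs_star)) * (1 + gap_energy t).
    rewrite -[leRHS]mulrA ler_wpM2l// -!mulrA ler_wpM2l//.
    have sA : sqnorm A <= 2 * gap_energy t.
      rewrite /gap_energy mulrA divff// mul1r -/A addrAC lerDr addr_ge0 ?sqnorm_ge0//.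
      by do 3 (apply: sumr_ge0 => ? _); rewrite -expr2 sqr_ge0.
    have := mulr_ge0 (sqnorm_ge0 rhs_star) (gap_energy_ge0 t).
    have := sqnorm_ge0 rhs_star; have := gap_energy_ge0 t.
    by move=> ? ? ?; lra.
  rewrite /w [inner A _]innerDr E1 E2 /dissipation; lra.
have dr : rd variation_potential t (n%:R * (1 + sqnorm rhs_star) * \tr (- N t)).
  exact: rdZ (rd_mxtrace (mrd_P t0)).
have dU := rdM (rdD (rd_cst 1 t) dW) (rd_comp (is_derive_expR (variation_potential t)) dr).
exists ((0 + w) * expR (variation_potential t) + (1 + gap_energy t) *
  (expR (variation_potential t) * (n%:R * (1 + sqnorm rhs_star) * \tr (- N t)))) => //.
have e1 : 1 <= expR (variation_potential t).
  by rewrite -[leLHS]expR0 ler_expR variation_potential_ge0.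
rewrite raddfN /=.
have -> : (0 + w) * expR (variation_potential t) + (1 + gap_energy t) *
    (expR (variation_potential t) * (n%:R * (1 + sqnorm rhs_star) * - \tr (N t))) =
  expR (variation_potential t) *
    (w - \tr (N t) * (n%:R * (1 + sqnorm rhs_star)) * (1 + gap_energy t)) by ring.
apply: (@le_trans _ _ (expR (variation_potential t) * - dissipation t)).
  by rewrite ler_pM2l ?expR_gt0//; lra.
by rewrite mulrN lerN2 ler_peMl// dissipation_ge0.
Qed.

Lemma lyapunov_nonincreasing s t : 0 < s -> s <= t -> lyapunov t <= lyapunov s.
Proof.
move=> s0 st; apply: rd_le0_nonincreasing => // u /andP[su _].
have u0 : 0 < u by exact: lt_le_trans su.
have [c cd rc] := lyapunov_decay u0; exists c => //.
by rewrite (le_trans cd)// oppr_le0 dissipation_ge0// ltW.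
Qed.

Lemma gap_energy_le_lyapunov t : 0 <= t -> gap_energy t <= lyapunov t.
Proof.
move=> t0; have W0 := gap_energy_ge0 t; rewrite /lyapunov.
have e1 : 1 <= expR (variation_potential t).
  by rewrite -[leLHS]expR0 ler_expR variation_potential_ge0.
apply: (@le_trans _ _ (1 + gap_energy t)); first by rewrite lerDr.
by rewrite ler_peMr// addr_ge0.
Qed.

Lemma trace_P_nonincreasing s t : 0 < s -> s <= t -> \tr (P t) <= \tr (P s).
Proof.
move=> s0 st; apply: (@rd_le0_nonincreasing _ (fun u => \tr (P u))) => // u /andP[su _].
have u0 : 0 < u by exact: lt_le_trans su.
exists (\tr (- N u)); last exact: rd_mxtrace (mrd_P u0).
by rewrite raddfN oppr_le0 psd_trace_ge0//; apply: P_decay_psd; exact: ltW.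
Qed.

Lemma lyapunov_cvg : exists2 U : R, lyapunov t @[t --> +oo] --> U &
  forall t, 1 <= t -> U <= lyapunov t.
Proof.
apply: (@nonincreasing_cvgy _ _ 1 0) => [s t s1 st|t t1].
  by apply: lyapunov_nonincreasing => //; exact: lt_le_trans s1.
by rewrite mulr_ge0 ?expR_ge0// addr_ge0 ?gap_energy_ge0.
Qed.

(** Both [lyapunov] and its exponential factor converge, the latter because the trace of [P t] is
    nonincreasing and nonnegative. *)
Lemma gap_energy_cvg : exists w : R, gap_energy t @[t --> +oo] --> w.
Proof.
have [U cU _] := lyapunov_cvg.
have [r cr _] : exists2 r : R, \tr (P t) @[t --> +oo] --> r & forall t, 1 <= t -> r <= \tr (P t).
  apply: (@nonincreasing_cvgy _ _ 1 0) => [s t s1 st|t t1].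
    by apply: trace_P_nonincreasing => //; exact: lt_le_trans s1.
  by apply: psd_trace_ge0; apply: P_psd; exact: le_trans t1.
pose c := n%:R * (1 + sqnorm rhs_star).
exists (U * expR (- (c * r)) - 1).
have : (lyapunov t * expR (- (c * \tr (P t))) - 1) @[t --> +oo] --> U * expR (- (c * r)) - 1.
  apply: cvgB; last exact: cvg_cst.
  apply: cvgM => //; apply: continuous_cvg; first exact: continuous_expR.
  by apply: cvgN; apply: cvgM => //; exact: cvg_cst.
apply: cvg_trans; apply: near_eq_cvg; near=> t.
by rewrite /lyapunov expRN mulfK ?gt_eqF ?expR_gt0// addrAC subrr add0r.
Unshelve. all: by end_near. Qed.

Lemma alpha_star_bounded : exists C, forall t i k, 1 <= t -> `|alpha_star t i k| <= C.
Proof.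
exists (\sum_i \sum_k \tr (P 1) * `|rhs_star i k|) => t i k t1.
have t0 : 0 <= t by exact: le_trans t1.
have tr0 : 0 <= \tr (P 1) by apply: psd_trace_ge0; exact: P_psd.
rewrite mxE; apply: (le_trans (ler_norm_sum _ _ _)); apply: ler_sum => j _.
rewrite normrM (bigD1 k)//=; apply: ler_wpDr.
  by apply: sumr_ge0 => ? _; rewrite mulr_ge0.
apply: ler_wpM2r => //; apply: (@le_trans _ _ (\tr (P t))).
  by apply: psd_entry_le_trace; [exact: P_tr|exact: P_psd].
exact: trace_P_nonincreasing.
Qed.

Lemma trajectory_bounded : exists C, forall t, 1 <= t ->
  [/\ forall i k, `|x t i k| <= C, forall i k, `|alpha t i k| <= C &
      forall i k j, `|th t i k j| <= C].
Proof.
have [C1 HC1] := alpha_star_bounded.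
pose C0 := 1 + 2 * lyapunov 1.
pose C2 := \sum_i \sum_k `|xs i k|; pose C3 := \sum_i \sum_k \sum_j `|ths i k j|.
exists (C0 + `|C1| + C2 + C3) => t t1.
have t0 : 0 <= t by exact: le_trans t1.
have C20 : 0 <= C2 by do 2 (apply: sumr_ge0 => ? _).
have C30 : 0 <= C3 by do 3 (apply: sumr_ge0 => ? _).
have C10 := normr_ge0 C1; have C1le := ler_norm C1.
have W : 2 * gap_energy t <= 2 * lyapunov 1.
  by rewrite ler_pM2l// (le_trans (gap_energy_le_lyapunov t0))// lyapunov_nonincreasing.
rewrite /gap_energy mulrA divff// mul1r in W.
have s1 := sqnorm_ge0 (x t - xs); have s2 := sqnorm_ge0 (alpha t - alpha_star t).
have s3 : 0 <= \sum_i \sum_k \sum_j (th t i k j - ths i k j) * (th t i k j - ths i k j).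
  by do 3 (apply: sumr_ge0 => ? _); rewrite -expr2 sqr_ge0.
have tri (u v c : R) : `|u - v| <= c -> `|u| <= c + `|v|.
  by move=> uv; rewrite -(subrK v u) (le_trans (ler_normD _ _))// lerD2r.
split=> [i k|i k|i k j].
- have /sqr_le_norm : (x t i k - xs i k) ^+ 2 <= 2 * lyapunov 1.
    by have := entry_le_sqnorm (x t - xs) i k; rewrite !mxE => ?; lra.
  move=> /tri H; have : `|xs i k| <= C2.
    rewrite /C2 (bigD1 i)//= (bigD1 k)//= -addrA lerDl addr_ge0//.
      by apply: sumr_ge0.
    by do 2 (apply: sumr_ge0 => ? _).
  by rewrite /C0; lra.
- have /sqr_le_norm : (alpha t i k - alpha_star t i k) ^+ 2 <= 2 * lyapunov 1.
    by have := entry_le_sqnorm (alpha t - alpha_star t) i k; rewrite !mxE => ?; lra.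
  by move=> /tri H; have := HC1 t i k t1; rewrite /C0; lra.
- have /sqr_le_norm : (th t i k j - ths i k j) ^+ 2 <= 2 * lyapunov 1.
    have : (th t i k j - ths i k j) ^+ 2 <=
        \sum_i \sum_k \sum_j (th t i k j - ths i k j) * (th t i k j - ths i k j).
      rewrite (bigD1 i)//= (bigD1 k)//= (bigD1 j)//= expr2 -!addrA lerDl !addr_ge0//.
      + by apply: sumr_ge0 => ? _; rewrite -expr2 sqr_ge0.
      + by do 2 (apply: sumr_ge0 => ? _); rewrite -expr2 sqr_ge0.
      + by do 3 (apply: sumr_ge0 => ? _); rewrite -expr2 sqr_ge0.
    by lra.
  move=> /tri H; have : `|ths i k j| <= C3.
    rewrite /C3 (bigD1 i)//= (bigD1 k)//= (bigD1 j)//= -!addrA lerDl !addr_ge0//.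
    + by apply: sumr_ge0.
    + by do 2 (apply: sumr_ge0 => ? _).
    + by do 3 (apply: sumr_ge0 => ? _).
  by rewrite /C0; lra.
Qed.

End Lyapunov.

Lemma gt0_ge1 t : 1 <= t -> 0 < t.
Proof. exact: lt_le_trans. Qed.

Lemma ge0_ge1 t : 1 <= t -> 0 <= t.
Proof. by move=> /gt0_ge1/ltW. Qed.

(** * The total weight and its growth *)

Definition total_weight t : R := 1 + \sum_i \sum_q a t i q.

Lemma total_weight_ge1 t : 0 <= t -> 1 <= total_weight t.
Proof.
by move=> t0; rewrite lerDl; do 2 (apply: sumr_ge0 => ? _); exact: weights_ge0.
Qed.

Lemma total_weight_gt0 t : 0 <= t -> 0 < total_weight t.
Proof. by move=> /total_weight_ge1; exact: lt_le_trans. Qed.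

Lemma weight_le_total t i q : 0 <= t -> a t i q <= total_weight t.
Proof.
move=> t0; rewrite /total_weight (bigD1 i)//= (bigD1 q)//= -!addrA (addrCA 1) lerDl.
rewrite !addr_ge0//; first by apply: sumr_ge0 => ? _; exact: weights_ge0.
by do 2 (apply: sumr_ge0 => ? _); exact: weights_ge0.
Qed.

Lemma laplacian_bounded t (Y : 'M[R]_(n, l)) i k (B : R) : 0 <= t -> 0 <= B ->
  (forall i k, `|Y i k| <= B) -> `|(L t *m Y) i k| <= 2 * B * total_weight t.
Proof.
move=> t0 B0 YB; rewrite laplacian_mulE; last exact: weights_sym.
apply: (le_trans (ler_norm_sum _ _ _)).
apply: (@le_trans _ _ (\sum_q a t i q * (2 * B))).
  apply: ler_sum => q _; rewrite normrM ger0_norm ?weights_ge0// ler_wpM2l ?weights_ge0//.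
  by apply: (le_trans (ler_normB _ _)); have := YB i k; have := YB q k; lra.
rewrite -mulr_suml mulrC ler_wpM2l ?mulr_ge0//.
rewrite /total_weight [X in _ <= 1 + X](bigD1 i)//= addrCA lerDl addr_ge0//.
by do 2 (apply: sumr_ge0 => ? _); exact: weights_ge0.
Qed.

Lemma velocityE t i k : velocity t i k = - gradient F (x t) i k - (L t *m x t) i k
  - (L t *m alpha t) i k - constraint_force g (x t) (th t) i k.
Proof.
have entry (A1 A2 A3 A4 : 'M[R]_(n, l)) :
    (- A1 - A2 - A3 - A4) i k = - A1 i k - A2 i k - A3 i k - A4 i k by rewrite !mxE.
exact: entry.
Qed.

Definition total_weight_velocity t : R := \sum_i \sum_q weight_velocity t i q.

Lemma rd_total_weight t : 0 < t -> rd total_weight t (total_weight_velocity t).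
Proof.
move=> t0; apply: rd_eq (rdD (rd_cst 1 t) _) (add0r _).
by apply: rd_sum => i _; apply: rd_sum => q _; exact: mrd_a.
Qed.

(** [Y] is left free because the law of the weights sees only row differences: [x t] serves for a
    crude quadratic bound, [x t - xs] for one that the dissipation controls. *)
Lemma total_weight_velocity_le : exists2 K, 0 < K & forall t (Y : 'M[R]_(n, l)),
  (forall i r k, x t i k - x t r k = Y i k - Y r k) ->
  total_weight_velocity t <= K * (sqnorm Y + sqnorm (velocity t)).
Proof.
exists (1 + \sum_i \sum_q `|d i q| * 4) => [|t Y xY].
  by rewrite ltr_wpDr// ; do 2 (apply: sumr_ge0 => ? _); rewrite mulr_ge0.
rewrite mulrDl mul1r ler_wpDl ?addr_ge0 ?sqnorm_ge0//.
rewrite mulr_suml; apply: ler_sum => i _; rewrite mulr_suml; apply: ler_sum => q _.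
rewrite mxE; case: ifP => [eiq|_]; last by rewrite !mulr_ge0 ?addr_ge0 ?sqnorm_ge0.
have [d0 _] := d_gain eiq; rewrite gtr0_norm// -mulrA ler_pM2l// mulrDr lerD//.
  exact: row_diff_sqnorm_le.
exact: row_diff_sqnorm_le.
Qed.

Lemma weights_nondecreasing s t i q : 0 < s -> s <= t -> a s i q <= a t i q.
Proof.
move=> s0 st; rewrite -lerN2.
apply: (@rd_le0_nonincreasing _ (fun u => - a u i q)) => // u /andP[su _].
have u0 : 0 < u by exact: lt_le_trans su.
exists (- weight_velocity u i q); last exact: rdN (mrd_a u0 i q).
by rewrite oppr_le0 weight_velocity_ge0.
Qed.

Lemma total_weight_nondecreasing s t : 0 < s -> s <= t -> total_weight s <= total_weight t.
Proof.
move=> s0 st; rewrite lerD2l; apply: ler_sum => i _; apply: ler_sum => q _.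
exact: weights_nondecreasing.
Qed.

(** * Boundedness of the weights *)

Section Potential.
(** [U] abstracts [lyapunov]: only its limit and its decay matter here. *)
Variables (xs : 'M[R]_(n, l)) (U : R -> R) (Uinf C : R).
Hypothesis xs_consensus : consensus xs.
Hypothesis xs_feasible : forall i k j, g i k j (xs i k) <= 0.
Hypothesis U_cvg : U t @[t --> +oo] --> Uinf.
Hypothesis U_ge : forall t, 1 <= t -> Uinf <= U t.
Hypothesis U_decay : forall t, 0 < t -> exists2 c, c <= - dissipation xs t & rd U t c.
Hypothesis C_ge1 : 1 <= C.
Hypothesis x_bounded : forall t i k, 1 <= t -> `|x t i k| <= C.
Hypothesis alpha_bounded : forall t i k, 1 <= t -> `|alpha t i k| <= C.
Hypothesis th_bounded : forall t i k j, 1 <= t -> `|th t i k j| <= C.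

Local Notation ge1 := [set t : R | 1 <= t].

Lemma gradient_bounded : exists B, forall i k t, 1 <= t -> `|gradient F (x t) i k| <= B.
Proof.
have [B HB] : exists B, forall (ik : 'I_n * 'I_l) t, ge1 t -> `|gradient F (x t) ik.1 ik.2| <= B.
  apply: fin_bound => -[i k].
  have [B HB] := continuous_rV_bounded C (fun z => partial_cvg f_diff (i := i) (k := k) (z := z)).
  exists B => t t1 /=; rewrite gradient_objective//; apply: HB => k'.
  by rewrite mxE x_bounded.
by exists B => i k t t1; exact: (HB (i, k)).
Qed.

Lemma objective_bounded : exists B, forall t, 1 <= t -> `|F (x t)| <= B.
Proof.
have [B HB] : exists B, forall i t, ge1 t -> `|f i (row i (x t))| <= B.
  apply: fin_bound => i.
  have fc : continuous (f i) by move=> z; have [/(_ z)/differentiable_continuous] := f_diff i.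
  have [B HB] := continuous_rV_bounded C fc.
  by exists B => t t1; apply: HB => k; rewrite mxE x_bounded.
exists (\sum_(i < n) B) => t t1; apply: (le_trans (ler_norm_sum _ _ _)).
by apply: ler_sum => i _; exact: HB.
Qed.

Lemma constraint_bounded : exists B, forall i k j t, 1 <= t -> `|g i k j (x t i k)| <= B.
Proof.
have [B HB] : exists B, forall (s : {s : 'I_n * 'I_l & 'I_(m s.1 s.2)}) t, ge1 t ->
    `|g (tag s).1 (tag s).2 (tagged s) (x t (tag s).1 (tag s).2)| <= B.
  apply: fin_bound => -[[i k] /= j].
  have [B HB] := continuous_bounded C (derivable_cvg (@g_diff i k j)).
  by exists B => t t1; apply: HB; exact: x_bounded.
exists B => i k j t t1.
exact: (HB (existT (fun s : 'I_n * 'I_l => 'I_(m s.1 s.2)) (i, k) j)).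
Qed.

Lemma constraint_slope_bounded :
  exists B, forall i k j t, 1 <= t -> `|derive1 (g i k j) (x t i k)| <= B.
Proof.
have [B HB] : exists B, forall (s : {s : 'I_n * 'I_l & 'I_(m s.1 s.2)}) t, ge1 t ->
    `|derive1 (g (tag s).1 (tag s).2 (tagged s)) (x t (tag s).1 (tag s).2)| <= B.
  apply: fin_bound => -[[i k] /= j].
  have [B HB] := continuous_bounded C
    (fun z => convex_derive1_cvg (@g_convex i k j) (@g_diff i k j) (z := z)).
  by exists B => t t1; apply: HB; exact: x_bounded.
exists B => i k j t t1.
exact: (HB (existT (fun s : 'I_n * 'I_l => 'I_(m s.1 s.2)) (i, k) j)).
Qed.

Lemma force_bounded : exists B, forall i k t, 1 <= t ->
  `|constraint_force g (x t) (th t) i k| <= B.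
Proof.
have [B HB] := constraint_slope_bounded.
exists (\sum_i \sum_k \sum_(j < m i k) C * B) => i k t t1.
have B0 (j : 'I_(m i k)) : 0 <= B by exact: le_trans (normr_ge0 _) (HB i k j t t1).
rewrite mxE; apply: (le_trans (ler_norm_sum _ _ _)).
apply: (@le_trans _ _ (\sum_(j < m i k) C * B)).
  by apply: ler_sum => j _; rewrite normrM ler_pM// ?th_bounded// HB.
have C0 : 0 <= C by exact: le_trans C_ge1.
have sB i' k' : 0 <= \sum_(j < m i' k') C * B.
  apply: sumr_ge0 => j _; rewrite mulr_ge0//.
  exact: le_trans (normr_ge0 _) (HB i' k' j 1 (lexx _)).
rewrite [leRHS](bigD1 i)//= (bigD1 k)//= -addrA lerDl addr_ge0//.
  by apply: sumr_ge0 => ? _; exact: sB.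
by do 2 (apply: sumr_ge0 => ? _); exact: sB.
Qed.

Lemma velocity_bounded : exists2 K, 0 < K & forall i k t, 1 <= t ->
  `|velocity t i k| <= K * total_weight t.
Proof.
have [B1 HB1] := gradient_bounded; have [B2 HB2] := force_bounded.
have C0 : 0 <= C by exact: le_trans C_ge1.
exists (`|B1| + `|B2| + 4 * C) => [|i k t t1].
  by rewrite ltr_wpDl ?addr_ge0// mulr_gt0// (lt_le_trans _ C_ge1).
have t0 := ge0_ge1 t1; have T1 := total_weight_ge1 t0.
have h1 := laplacian_bounded i k t0 C0 (fun i k => x_bounded i k t1).
have h2 := laplacian_bounded i k t0 C0 (fun i k => alpha_bounded i k t1).
have h3 : `|B1| <= `|B1| * total_weight t by rewrite ler_peMr.
have h4 : `|B2| <= `|B2| * total_weight t by rewrite ler_peMr.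
have h5 := le_trans (HB1 i k t t1) (ler_norm _).
have h6 := le_trans (HB2 i k t t1) (ler_norm _).
have h : `|velocity t i k| <= `|gradient F (x t) i k| + `|(L t *m x t) i k| +
    `|(L t *m alpha t) i k| + `|constraint_force g (x t) (th t) i k|.
  rewrite velocityE.
  apply: (le_trans (ler_normB _ _)); rewrite lerD2r.
  apply: (le_trans (ler_normB _ _)); rewrite lerD2r.
  by apply: (le_trans (ler_normB _ _)); rewrite normrN.
by apply: (le_trans h); lra.
Qed.

Lemma total_weight_velocity_quadratic : exists2 K, 0 < K & forall t, 1 <= t ->
  total_weight_velocity t <= K * total_weight t ^+ 2.
Proof.
have [K1 K10 HK1] := total_weight_velocity_le; have [K2 K20 HK2] := velocity_bounded.
have C0 : 0 <= C by exact: le_trans C_ge1.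
exists (K1 * (1 + (n * l)%:R * (C ^+ 2 + K2 ^+ 2))) => [|t t1].
  by rewrite mulr_gt0// ltr_wpDr// mulr_ge0// addr_ge0// sqr_ge0.
have t0 := ge0_ge1 t1; have T1 := total_weight_ge1 t0.
apply: (le_trans (HK1 t (x t) (fun _ _ _ => erefl))); rewrite -mulrA ler_pM2l//.
have s1 := sqnorm_bounded C0 (fun i k => x_bounded i k t1).
have s2 := sqnorm_bounded (mulr_ge0 (ltW K20) (ltW (total_weight_gt0 t0)))
  (fun i k => HK2 i k t t1).
rewrite exprMn in s2.
have TT : 1 <= total_weight t ^+ 2 by rewrite exprn_ege1.
have s3 : (n * l)%:R * C ^+ 2 <= (n * l)%:R * C ^+ 2 * total_weight t ^+ 2.
  by rewrite ler_peMr// mulr_ge0// sqr_ge0.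
lra.
Qed.

Lemma edge_dissipation t i q k : 0 <= t ->
  2^-1 * (a t i q * (x t i k - x t q k) ^+ 2) <= dissipation xs t.
Proof.
move=> t0; have sw := weights_sym t0.
have := laplacian_edge_le (x t - xs) i q k sw (fun i q => weights_ge0 i q t0).
rewrite !mxE (xs_consensus i q) => H.
have -> : x t i k - x t q k = x t i k - xs q k - (x t q k - xs q k) by ring.
by rewrite (le_trans H)// lerDr mulr_ge0 ?(ltW mu_gt0)// sqnorm_ge0.
Qed.

(** Since A' <= K A^2, the inverse 1 / A decreases at rate at most [K], and the time allowed lets it
    lose at most half of its value. *)
Lemma total_weight_doubling (K : R) t u : 0 < K ->
  (forall t, 1 <= t -> total_weight_velocity t <= K * total_weight t ^+ 2) ->
  1 <= t -> t <= u -> K * (u - t) <= (2 * total_weight t)^-1 ->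
  total_weight u <= 2 * total_weight t.
Proof.
move=> K0 HK t1 tu ush.
have T0 s : 1 <= s -> 0 < total_weight s by move=> /ge0_ge1/total_weight_gt0.
have inv' : - (total_weight u)^-1 - K * u <= - (total_weight t)^-1 - K * t.
  apply: (@rd_le0_nonincreasing _ (fun s => - (total_weight s)^-1 - K * s)) => // s /andP[ts su].
  have s1 : 1 <= s by exact: le_trans ts.
  have dinv : is_derive (total_weight s) 1 (fun y : R => y^-1) (- (total_weight s) ^- 2 *: 1).
    have Ts : total_weight s != 0 by rewrite gt_eqF ?T0.
    exact: (@is_deriveV R id (total_weight s) 1 1 Ts (is_derive_id _ _)).
  have dT := rd_total_weight (gt0_ge1 s1).
  have did : rd (fun s : R => s) s 1 by apply: is_derive_rd; exact: is_derive_id.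
  exists (- (- (total_weight s) ^- 2 *: 1 * total_weight_velocity s) - K * 1); last first.
    exact: rdB (rdN (rd_comp dinv dT)) (rdZ K did).
  rewrite [_ *: 1]mulr1 mulNr opprK mulr1 subr_le0 ler_pdivrMl ?exprn_gt0 ?T0// mulrC.
  exact: HK.
have Tt := T0 _ t1; have u1 : 1 <= u by exact: le_trans tu.
rewrite -lef_pV2 ?posrE ?T0 ?mulr_gt0//.
have : (total_weight t)^-1 = 2 * (2 * total_weight t)^-1 by rewrite invfM mulrA divff// mul1r.
by lra.
Qed.

(* Heavy edges carry vanishing disagreement: if a_iq |e_iq| > eta A at time t,
   it stays comparable during a time of order 1 / A, which dissipates a fixed
   amount of U. *)
Lemma heavy_edge_disagreement (eta : R) : 0 < eta -> exists2 T0, 1 <= T0 &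
  forall t i q k, T0 <= t -> a t i q * `|x t i k - x t q k| <= eta * total_weight t.
Proof.
move=> eta0; have [K K0 HK] := velocity_bounded.
have [K2 K20 HK2] := total_weight_velocity_quadratic.
have C0 : 0 < C by exact: lt_le_trans C_ge1.
(* Over a time [sg] / A, the first bound keeps the total weight within a factor 2; the second keeps
   the disagreement above eta / 2, since it then moves at speed at most 4 K A. *)
pose sg := Num.min (2 * K2)^-1 (eta / (8 * K)).
have sg0 : 0 < sg by rewrite lt_min invr_gt0 mulr_gt0//= divr_gt0// mulr_gt0.
(* With a_iq >= eta A / (2 C) and |e_iq| >= eta / 2, half of a_iq e_iq^2 is at least [ka] A. *)
pose ka := eta ^+ 3 / (16 * C).
have ka0 : 0 < ka by rewrite divr_gt0 ?exprn_gt0 ?mulr_gt0.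
have [M [_ HM]] : \forall t \near +oo, U t < Uinf + ka * sg.
  by apply: (cvgr_lt _ U_cvg); rewrite ltrDl mulr_gt0.
exists (Num.max 1 (M + 1)) => [|t i q k]; first by rewrite le_max lexx.
rewrite ge_max => /andP[t1 tM].
have Ut : U t < Uinf + ka * sg by apply: HM; rewrite (lt_le_trans _ tM)// ltrDl.
have t0 := ge0_ge1 t1; have A0 := total_weight_gt0 t0.
rewrite leNgt; apply/negP => heavy.
pose ed s := x s i k - x s q k.
have ed2C s : 1 <= s -> `|ed s| <= 2 * C.
  move=> s1; apply: (le_trans (ler_normB _ _)).
  by have := x_bounded i k s1; have := x_bounded q k s1; lra.
have aheavy : eta * total_weight t < a t i q * (2 * C).
  by apply: (lt_le_trans heavy); rewrite ler_wpM2l ?weights_ge0// ed2C.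
have ebig : eta < `|ed t|.
  rewrite -(ltr_pM2l A0) mulrC (lt_le_trans heavy)// ler_wpM2r//.
  exact: weight_le_total.
pose v := t + sg / total_weight t.
have tv : t <= v by rewrite lerDl divr_ge0 ?(ltW sg0) ?ltW.
have on_window s : t <= s -> s <= v ->
    total_weight s <= 2 * total_weight t /\ eta / 2 <= `|ed s|.
  move=> ts sv.
  have sgA : (s - t) * total_weight t <= sg.
    by rewrite -ler_pdivlMr// lerBlDl.
  have dbl s' : t <= s' -> s' <= s -> total_weight s' <= 2 * total_weight t.
    move=> ts' s's; apply: total_weight_doubling HK2 _ _ _ => //.
    have : (s' - t) * total_weight t <= 1 / (2 * K2).
      apply: (@le_trans _ _ sg); last by rewrite div1r /sg ge_min lexx.
      by apply: le_trans sgA; rewrite ler_pM2r// lerD2r.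
    rewrite ler_pdivlMr ?mulr_gt0// => ?.
    by rewrite -[leRHS]mul1r ler_pdivlMr ?mulr_gt0//; lra.
  split; first exact: dbl.
  have drift (c : R) : `|c| = 1 -> c * ed s - c * ed t <= 4 * K * total_weight t * (s - t).
    move=> c1; rewrite lerBlDl -lerBlDr.
    have -> : c * ed t = c * ed t - 4 * K * total_weight t * (t - t) by rewrite subrr mulr0 subr0.
    apply: (@rd_le0_nonincreasing _ (fun s => c * ed s - 4 * K * total_weight t * (s - t))) => //.
    move=> s' /andP[ts' s's]; have s1 : 1 <= s' by exact: le_trans ts'.
    have did : rd (fun s : R => s) s' 1 by apply: is_derive_rd; exact: is_derive_id.
    exists (c * (velocity s' i k - velocity s' q k) - 4 * K * total_weight t * (1 - 0)); last first.
      apply: rdB; last exact: rdZ (rdB did (rd_cst _ _)).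
      by apply: rdZ; apply: rdB; exact: mrd_x (gt0_ge1 s1) _ _.
    rewrite subr0 mulr1 subr_le0 (le_trans (ler_norm _))// normrM c1 mul1r.
    have := HK i k s' s1; have := HK q k s' s1.
    have : K * total_weight s' <= K * (2 * total_weight t) by rewrite ler_pM2l// dbl.
    by move=> ? ? ?; rewrite (le_trans (ler_normB _ _))//; lra.
  have small : 4 * K * total_weight t * (s - t) <= eta / 2.
    have : (s - t) * total_weight t <= eta / (8 * K).
      by apply: (le_trans sgA); rewrite /sg ge_min lexx orbT.
    by rewrite ler_pdivlMr ?mulr_gt0// => ?; lra.
  have d1 := drift 1 (normr1 _); have dN := drift (-1) (normrN1 _).
  have := ler_norm (ed s); have := ler_norm (- ed s); rewrite normrN.
  by move: ebig; rewrite !mulN1r !mul1r in d1 dN *; case: (ger0P (ed t)) => _ ? ? ?; lra.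
have decay : U v + ka * total_weight t * v <= U t + ka * total_weight t * t.
  apply: (@rd_le0_nonincreasing _ (fun s => U s + ka * total_weight t * s)) => // s /andP[ts sv].
  have s1 : 1 <= s by exact: le_trans ts.
  have [c cD dU] := U_decay (gt0_ge1 s1).
  have did : rd (fun s : R => s) s 1 by apply: is_derive_rd; exact: is_derive_id.
  exists (c + ka * total_weight t * 1); last exact: rdD dU (rdZ _ did).
  have [_ es] := on_window s ts sv.
  have ats := weights_nondecreasing i q (gt0_ge1 t1) ts.
  suff : ka * total_weight t <= dissipation xs s by lra.
  apply: le_trans (edge_dissipation i q k (ge0_ge1 s1)).
  have e2 : eta ^+ 2 / 4 <= (x s i k - x s q k) ^+ 2.
    rewrite -[leRHS]real_normK ?num_real// (_ : eta ^+ 2 / 4 = (eta / 2) ^+ 2); last by field.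
    by rewrite ler_pXn2r ?nnegrE// divr_ge0// ltW.
  have as' : eta * total_weight t / (2 * C) <= a s i q.
    by rewrite ler_pdivrMr ?mulr_gt0// (le_trans (ltW aheavy))// ler_wpM2r// mulr_ge0// ltW.
  rewrite (_ : ka * _ = 2^-1 * (eta * total_weight t / (2 * C) * (eta ^+ 2 / 4))); last first.
    by rewrite /ka; field; rewrite gt_eqF.
  rewrite ler_wpM2l ?invr_ge0// ler_pM// ?divr_ge0 ?sqr_ge0// ?mulr_ge0// ltW//.
have := U_ge (le_trans t1 tv).
have vt : ka * total_weight t * v - ka * total_weight t * t = ka * sg.
  by rewrite /v; field; rewrite gt_eqF.
lra.
Qed.

(** By convexity the increment lies between the slopes at the two ends times the displacement; those
    at [x t] are bounded along the trajectory, those at [xs] are finite in number. *)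
Lemma constraint_lipschitz : exists2 B, 0 <= B & forall i k j t, 1 <= t ->
  `|g i k j (x t i k) - g i k j (xs i k)| <= B * `|x t i k - xs i k|.
Proof.
have [B HB] := constraint_slope_bounded.
pose B' := \sum_i \sum_k \sum_j `|derive1 (g i k j) (xs i k)|.
exists (`|B| + B') => [|i k j t t1].
  by rewrite addr_ge0//; do 3 (apply: sumr_ge0 => ? _).
have T1 := convex_tangent (@g_convex i k j) (@g_diff i k j) (x t i k) (xs i k).
have T2 := convex_tangent (@g_convex i k j) (@g_diff i k j) (xs i k) (x t i k).
have b1 : `|derive1 (g i k j) (x t i k)| <= `|B| + B'.
  rewrite (le_trans (HB i k j t t1))// (le_trans (ler_norm B))// lerDl.
  by do 3 (apply: sumr_ge0 => ? _).
have b2 : `|derive1 (g i k j) (xs i k)| <= `|B| + B'.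
  apply: ler_wpDl => //; rewrite /B' (bigD1 i)//= (bigD1 k)//= (bigD1 j)//=.
  rewrite -!addrA lerDl !addr_ge0//.
  - by apply: sumr_ge0.
  - by do 2 (apply: sumr_ge0 => ? _).
  - by do 3 (apply: sumr_ge0 => ? _).
have b1' := ler_wpM2r (normr_ge0 (x t i k - xs i k)) b1.
have b2' := ler_wpM2r (normr_ge0 (x t i k - xs i k)) b2.
have := ler_norm (derive1 (g i k j) (x t i k) * (x t i k - xs i k)).
have := lerNnormlW (lexx `|derive1 (g i k j) (xs i k) * (x t i k - xs i k)|).
rewrite !normrM => ? ?.
by rewrite ler_norml; apply/andP; split; lra.
Qed.

(* An inactive constraint has a negative rate whenever its multiplier is
   positive and x is close to xs, so theta itself is a potential for the power. *)
Lemma rate_power1 i k j : exists w K, [/\ 0 <= w, 0 <= K &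
  forall t, 1 <= t -> multiplier_rate t i k j * g i k j (x t i k) <=
    - w * multiplier_rate t i k j + K * (x t i k - xs i k) ^+ 2].
Proof.
have [Lg Lg0 HL] := constraint_lipschitz; have [B HB] := constraint_bounded.
have := xs_feasible j; rewrite le_eqVlt => /predU1P[gs0|gneg].
  (* A constraint active at [xs] is of order |x - xs|, so its power is already quadratic. *)
  exists 0, (Lg ^+ 2); split => // [|t t1]; first exact: sqr_ge0.
  have := HL i k j t t1; rewrite gs0 subr0 oppr0 mul0r add0r => gL.
  apply: (@le_trans _ _ (g i k j (x t i k) ^+ 2)).
    rewrite /multiplier_rate /pos_proj; case: ifP => _; first by rewrite expr2.
    by rewrite mul0r sqr_ge0.
  rewrite -exprMn -[leLHS]real_normK ?num_real// -[leRHS]real_normK ?num_real//.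
  by rewrite ler_pXn2r ?nnegrE// normrM [`|Lg|]ger0_norm.
pose c := - g i k j (xs i k); have c0 : 0 < c by rewrite oppr_gt0.
(* Here g <= - c / 2 up to a multiple of |x - xs|^2, so the factor 2 B^2 / c turns g into at most -
   B^2, which offsets g^2 <= B^2. *)
exists (2 * B ^+ 2 / c), (B ^+ 2 * Lg ^+ 2 / c ^+ 2); split => [||t t1].
- by rewrite divr_ge0 ?(ltW c0)// mulr_ge0// sqr_ge0.
- by rewrite divr_ge0 ?sqr_ge0// mulr_ge0 ?sqr_ge0.
rewrite /multiplier_rate /pos_proj; case: ifP => _; last first.
  by rewrite mul0r mulr0 add0r mulr_ge0 ?sqr_ge0// divr_ge0 ?sqr_ge0// mulr_ge0 ?sqr_ge0.
set y := g i k j (x t i k); set z := x t i k - xs i k.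
have yL : y <= - c + Lg * `|z|.
  by have := le_trans (ler_norm _) (HL i k j t t1); rewrite -/y -/z /c; lra.
have yB : y * y <= B ^+ 2.
  rewrite -expr2 -real_normK ?num_real// ler_pXn2r ?nnegrE//; first exact: HB.
  exact: le_trans (normr_ge0 _) (HB i k j t t1).
(* AM-GM: Lg |z| <= c / 2 + Lg^2 z^2 / (2 c) *)
have amgm : Lg * `|z| <= c / 2 + Lg ^+ 2 * z ^+ 2 / (2 * c).
  have : 0 <= (c - Lg * `|z|) ^+ 2 / (2 * c) by rewrite divr_ge0 ?sqr_ge0// mulr_ge0// ltW.
  rewrite (_ : _ / _ = c / 2 + Lg ^+ 2 * `|z| ^+ 2 / (2 * c) - Lg * `|z|).
    by rewrite real_normK ?num_real// subr_ge0.
  by field; rewrite gt_eqF.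
have h : 2 * B ^+ 2 / c * y <= 2 * B ^+ 2 / c * (- c / 2 + Lg ^+ 2 * z ^+ 2 / (2 * c)).
  apply: ler_wpM2l; last by lra.
  by rewrite divr_ge0 ?(ltW c0)// mulr_ge0// sqr_ge0.
have eq_c : 2 * B ^+ 2 / c * (- c / 2 + Lg ^+ 2 * z ^+ 2 / (2 * c)) =
    - B ^+ 2 + B ^+ 2 * Lg ^+ 2 / c ^+ 2 * z ^+ 2 by field; rewrite gt_eqF.
by rewrite mulNr; lra.
Qed.

Lemma rate_power : exists (w : multipliers R m) (K : R), [/\ nonneg w, 0 <= K &
  forall t, 1 <= t ->
    \sum_i \sum_k \sum_j multiplier_rate t i k j * g i k j (x t i k) <=
    - \sum_i \sum_k \sum_j w i k j * multiplier_rate t i k j + K * sqnorm (x t - xs)].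
Proof.
pose w i k j := sval (cid (@rate_power1 i k j)).
have Hw i k j : exists K, [/\ 0 <= w i k j, 0 <= K & forall t, 1 <= t ->
    multiplier_rate t i k j * g i k j (x t i k) <=
    - w i k j * multiplier_rate t i k j + K * (x t i k - xs i k) ^+ 2].
  exact: (svalP (cid (@rate_power1 i k j))).
pose K i k j := sval (cid (Hw i k j)).
have HK i k j := svalP (cid (Hw i k j)).
exists w, (\sum_i \sum_k \sum_j K i k j); split.
- by move=> i k j; have [] := HK i k j.
- apply: sumr_ge0 => i _; apply: sumr_ge0 => k _; apply: sumr_ge0 => j _.
  by have [] := HK i k j.
move=> t t1; rewrite -sumrN mulr_suml -big_split; apply: ler_sum => i _.
rewrite -sumrN mulr_suml -big_split; apply: ler_sum => k _.
rewrite -sumrN mulr_suml -big_split; apply: ler_sum => j _ /=.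
have [_ K0 H] := HK i k j; apply: (le_trans (H t t1)).
rewrite mulNr lerD2l ler_wpM2l//.
by have := entry_le_sqnorm (x t - xs) i k; rewrite !mxE.
Qed.

(** The Lagrangian augmented by a quadratic consensus penalty, written relative to [xs], which the
    Laplacian kills. Its gradient in [x] is [- velocity]: the equation of [x] is gradient descent on
    it. *)
Definition energy t : R :=
  F (x t) + 2^-1 * inner (x t - xs) (L t *m (x t - xs)) + inner (x t - xs) (L t *m alpha t)
  + \sum_i \sum_k \sum_j th t i k j * g i k j (x t i k).

Local Notation L' t := (laplacian (weight_velocity t)).

Lemma laplacian_x t : 0 <= t -> L t *m x t = L t *m (x t - xs).
Proof.
by move=> t0; rewrite mulmxBr [L t *m xs]laplacian_consensus ?subr0//; exact: weights_sym.
Qed.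

(** Descent in [x] gives the square of the velocity with a minus sign; the other terms come from the
    motion of alpha, of the weights and of the multipliers. *)
Lemma rd_energy t : 0 < t -> rd energy t (- sqnorm (velocity t) + sqnorm (L t *m (x t - xs))
  + 2^-1 * inner (x t - xs) (L' t *m (x t - xs)) + inner (x t - xs) (L' t *m alpha t)
  + \sum_i \sum_k \sum_j multiplier_rate t i k j * g i k j (x t i k)).
Proof.
move=> t0; have sw := weights_sym (ltW t0).
have dx := mrdB (mrd_x t0) (mrd_cst xs t); rewrite subr0 in dx.
have dL := mrd_laplacian (mrd_a t0).
have dsum : rd (fun s => \sum_i \sum_k \sum_j th s i k j * g i k j (x s i k)) t
    (\sum_i \sum_k \sum_j (multiplier_rate t i k j * g i k j (x t i k) +
       th t i k j * (derive1 (g i k j) (x t i k) * velocity t i k))).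
  by do 3 (apply: rd_sum => ? _); apply: rdM; [exact: rd_th|exact: rd_g].
apply: rd_eq (rdD (rdD (rdD (rd_F t0) (rdZ 2^-1 (rd_inner dx (mrdM dL dx))))
  (rd_inner dx (mrdM dL (mrd_alpha t0)))) dsum) _.
have -> : \sum_i \sum_k \sum_j (multiplier_rate t i k j * g i k j (x t i k) +
       th t i k j * (derive1 (g i k j) (x t i k) * velocity t i k)) =
    \sum_i \sum_k \sum_j multiplier_rate t i k j * g i k j (x t i k) +
    inner (velocity t) (constraint_force g (x t) (th t)).
  rewrite /inner -big_split; apply: eq_bigr => i _; rewrite -big_split; apply: eq_bigr => k _ /=.
  rewrite big_split /= [constraint_force _ _ _ _ _]mxE mulr_sumr.
  by congr (_ + _); apply: eq_bigr => j _; ring.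
set xi := x t - xs; set v := velocity t.
have E1 : inner xi (L t *m v) = inner v (L t *m xi) by rewrite inner_laplacianC// innerC.
have E2 : inner xi (L t *m (L t *m x t)) = sqnorm (L t *m xi).
  by rewrite inner_laplacianC// laplacian_x// ltW.
have E3 : sqnorm v = - inner v (gradient F (x t)) - inner v (L t *m xi)
    - inner v (L t *m alpha t) - inner v (constraint_force g (x t) (th t)).
  by rewrite /sqnorm {2}/v /velocity !innerBr innerNr laplacian_x// ltW.
by rewrite ![inner xi (_ + _)]innerDr E1 E2 E3 (innerC (gradient F _)); lra.
Qed.

(** Cauchy-Schwarz on each row, then a_iq^2 <= A a_iq. The factor A forces the Lyapunov function to
    be used later with a coefficient of that order. *)
Lemma laplacian_sqnorm_le t : 0 <= t ->
  sqnorm (L t *m (x t - xs)) <=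
    2 * n%:R * total_weight t * inner (x t - xs) (L t *m (x t - xs)).
Proof.
move=> t0; have sw := weights_sym t0; set xi := x t - xs.
rewrite [in leRHS]inner_laplacian//.
have -> : 2 * n%:R * total_weight t * (2^-1 * \sum_i \sum_q \sum_k
    a t i q * ((xi i k - xi q k) * (xi i k - xi q k))) =
  \sum_i \sum_k (n%:R * \sum_q total_weight t *
    (a t i q * ((xi i k - xi q k) * (xi i k - xi q k)))).
  rewrite (_ : 2 * _ * _ * (2^-1 * _) = n%:R * total_weight t * \sum_i \sum_q \sum_k
    a t i q * ((xi i k - xi q k) * (xi i k - xi q k))); last by field.
  rewrite mulr_sumr; apply: eq_bigr => i _; rewrite exchange_big mulr_sumr; apply: eq_bigr => k _.
  by rewrite -[LHS]mulrA; congr (_ * _); rewrite mulr_sumr.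
apply: ler_sum => i _; apply: ler_sum => k _; rewrite -expr2 laplacian_mulE//.
apply: (le_trans (sqr_sum_le _)); rewrite ler_wpM2l//; apply: ler_sum => q _.
rewrite exprMn !expr2 -mulrA ler_wpM2r ?weight_le_total//.
by rewrite mulr_ge0 ?weights_ge0// -expr2 sqr_ge0.
Qed.

Definition edge_power t : R :=
  \sum_i \sum_q \sum_k weight_velocity t i q * `|x t i k - x t q k|.

(** Each edge contributes e_iq times e_iq / 4 + (alpha_i - alpha_q) / 2, and the second factor is at
    most C / 2 + C <= 2 C. *)
Lemma weight_power_le t : 1 <= t ->
  2^-1 * inner (x t - xs) (L' t *m (x t - xs)) + inner (x t - xs) (L' t *m alpha t)
    <= 2 * C * edge_power t.
Proof.
move=> t1; have sw := weight_velocity_sym t; rewrite !inner_laplacian//.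
have -> : 2^-1 * (2^-1 * \sum_i \sum_q \sum_k weight_velocity t i q *
      (((x t - xs) i k - (x t - xs) q k) * ((x t - xs) i k - (x t - xs) q k))) +
    2^-1 * \sum_i \sum_q \sum_k weight_velocity t i q *
      (((x t - xs) i k - (x t - xs) q k) * (alpha t i k - alpha t q k)) =
    \sum_i \sum_q \sum_k weight_velocity t i q * ((x t i k - x t q k) *
      (4^-1 * (x t i k - x t q k) + 2^-1 * (alpha t i k - alpha t q k))).
  rewrite mulrA !mulr_sumr -big_split; apply: eq_bigr => i _.
  rewrite !mulr_sumr -big_split; apply: eq_bigr => q _.
  rewrite !mulr_sumr -big_split; apply: eq_bigr => k _ /=.
  by rewrite !mxE (xs_consensus i q); field.
rewrite mulr_sumr; apply: ler_sum => i _; rewrite mulr_sumr; apply: ler_sum => q _.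
rewrite mulr_sumr; apply: ler_sum => k _.
rewrite [leRHS]mulrCA; apply: ler_wpM2l; first exact: weight_velocity_ge0.
apply: (le_trans (ler_norm _)); rewrite normrM mulrC ler_wpM2r//.
have b1 : `|x t i k - x t q k| <= 2 * C.
  apply: (le_trans (ler_normB _ _)).
  by have := x_bounded i k t1; have := x_bounded q k t1; lra.
have b2 : `|alpha t i k - alpha t q k| <= 2 * C.
  apply: (le_trans (ler_normB _ _)).
  by have := alpha_bounded i k t1; have := alpha_bounded q k t1; lra.
apply: (le_trans (ler_normD _ _)); rewrite !normrM.
rewrite [`|4^-1|]gtr0_norm ?invr_gt0// [`|2^-1|]gtr0_norm ?invr_gt0//.
by have := C_ge1; lra.
Qed.

(** Only the cross term with [alpha] can be very negative, and it is controlled edge by edge through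
    a_iq |e_iq|. *)
Lemma energy_lower : exists B, forall eta T, 1 <= T ->
  (forall i q k, a T i q * `|x T i k - x T q k| <= eta * total_weight T) ->
  - B - C * (n * n * l)%:R * (eta * total_weight T) <= energy T.
Proof.
have [B1 HB1] := objective_bounded; have [B2 HB2] := constraint_bounded.
exists (B1 + \sum_i \sum_k \sum_(j < m i k) C * B2) => eta T T1 Heta.
have T0 := ge0_ge1 T1; have sw := weights_sym T0.
have C0 : 0 <= C by exact: le_trans C_ge1.
have h1 : - B1 <= F (x T) by have := HB1 T T1; rewrite ler_norml => /andP[].
have h2 : 0 <= inner (x T - xs) (L T *m (x T - xs)).
  by apply: laplacian_quad_ge0 => // i q; exact: weights_ge0.
have h3 : - \sum_i \sum_k \sum_(j < m i k) C * B2 <=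
    \sum_i \sum_k \sum_j th T i k j * g i k j (x T i k).
  rewrite -sumrN; apply: ler_sum => i _; rewrite -sumrN. apply: ler_sum => k _.
  rewrite -sumrN; apply: ler_sum => j _; apply: lerNnormlW; rewrite normrM.
  by rewrite ler_pM// ?th_bounded// HB2.
have h4 : - (C * (n * n * l)%:R * (eta * total_weight T)) <= inner (x T - xs) (L T *m alpha T).
  apply: lerNnormlW; rewrite inner_laplacian// normrM gtr0_norm ?invr_gt0//.
  rewrite -[leRHS](mulKf (_ : 2 != 0 :> R))// ler_wpM2l ?invr_ge0//.
  apply: (@le_trans _ _ (\sum_(i < n) \sum_(q < n) \sum_(k < l) eta * total_weight T * (2 * C))).
    apply: (le_trans (ler_norm_sum _ _ _)); apply: ler_sum => i _.
    apply: (le_trans (ler_norm_sum _ _ _)); apply: ler_sum => q _.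
    apply: (le_trans (ler_norm_sum _ _ _)); apply: ler_sum => k _.
    rewrite !normrM ger0_norm ?weights_ge0// !mxE (xs_consensus i q) mulrA.
    rewrite (_ : x T i k - xs q k - (x T q k - xs q k) = x T i k - x T q k); last by ring.
    rewrite ler_pM// ?mulr_ge0// ?weights_ge0//.
    apply: (le_trans (ler_normB _ _)).
    by have := alpha_bounded i k T1; have := alpha_bounded q k T1; lra.
  rewrite !sumr_const !card_ord -!mulrnA -mulr_natl.
  rewrite (_ : (l * (n * n) = n * n * l)%N); last by rewrite mulnC.
  by rewrite le_eqVlt; apply/orP; left; apply/eqP; ring.
rewrite /energy; lra.
Qed.

(** A potential for the edge power: a multiple of its derivative dominates that power, while the
    function grows only like the square root of the weights. The shift [delta] keeps the root
    differentiable. *)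
Definition sqrt_potential (delta t : R) : R :=
  \sum_i \sum_q 2 * Num.sqrt (a t i q + delta).

Lemma rd_sqrt_potential delta t : 0 < delta -> 0 < t ->
  rd (sqrt_potential delta) t
    (\sum_i \sum_q weight_velocity t i q / Num.sqrt (a t i q + delta)).
Proof.
move=> delta0 t0; apply: rd_sum => i _; apply: rd_sum => q _.
have pos : 0 < a t i q + delta by rewrite ltr_wpDl// weights_ge0// ltW.
have da := rdD (mrd_a t0 i q) (rd_cst delta t).
apply: rd_eq (rdZ 2 (rd_comp (f := fun s => a s i q + delta) (is_derive1_sqrt pos) da)) _.
rewrite addr0; field.
by rewrite gt_eqF// sqrtr_gt0.
Qed.

(** From a |e| <= delta and |e| <= 2 C follow a |e|^2 <= 2 C delta and delta |e|^2 <= 4 C^2 delta;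
    their sum bounds |e| by a constant over sqrt(a + delta). *)
Lemma edge_power_le (eta S t : R) : 0 < eta -> 0 < S -> 1 <= t ->
  (forall i q k, a t i q * `|x t i k - x t q k| <= eta ^+ 2 * S) ->
  edge_power t <= l%:R * Num.sqrt (eta ^+ 2 * S * (2 * C + 4 * C ^+ 2)) *
    \sum_i \sum_q weight_velocity t i q / Num.sqrt (a t i q + eta ^+ 2 * S).
Proof.
move=> eta0 S0 t1 Heta; set delta := eta ^+ 2 * S.
have delta0 : 0 < delta by rewrite mulr_gt0// exprn_gt0.
rewrite /edge_power mulr_sumr; apply: ler_sum => i _; rewrite mulr_sumr; apply: ler_sum => q _.
have pos : 0 < a t i q + delta by rewrite ltr_wpDl// weights_ge0// ge0_ge1.
have spos : 0 < Num.sqrt (a t i q + delta) by rewrite sqrtr_gt0.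
rewrite -mulr_sumr [leRHS]mulrCA; apply: ler_wpM2l; first exact: weight_velocity_ge0.
have -> : l%:R * Num.sqrt (delta * (2 * C + 4 * C ^+ 2)) / Num.sqrt (a t i q + delta) =
    \sum_(k < l) Num.sqrt (delta * (2 * C + 4 * C ^+ 2)) / Num.sqrt (a t i q + delta).
  by rewrite sumr_const card_ord -mulrA mulr_natl.
apply: ler_sum => k _; rewrite ler_pdivlMr//.
have C0 : 0 <= C by exact: le_trans C_ge1.
have kap0 : 0 <= 2 * C + 4 * C ^+ 2 by rewrite addr_ge0 ?mulr_ge0// sqr_ge0.
rewrite -(@ler_pXn2r _ 2) ?nnegrE ?mulr_ge0 ?sqrtr_ge0//.
rewrite exprMn !sqr_sqrtr ?(ltW pos)//; last by rewrite mulr_ge0// ltW.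
set y := `|x t i k - x t q k|.
have y0 : 0 <= y by exact: normr_ge0.
have yC : y <= 2 * C.
  apply: (le_trans (ler_normB _ _)).
  by have := x_bounded i k t1; have := x_bounded q k t1; lra.
have h1 : y * (a t i q * y) <= 2 * C * delta.
  apply: ler_pM => //; last exact: Heta.
  by apply: mulr_ge0 => //; exact: weights_ge0 (ge0_ge1 t1).
have h2 : y * y * delta <= 2 * C * (2 * C) * delta.
  by rewrite ler_wpM2r ?(ltW delta0)// ler_pM.
by rewrite !expr2; lra.
Qed.

(* The total weight is compared with itself at the end T of the interval: all
   the growth terms are at most eta times it. *)
Lemma total_weight_bounded : exists M, forall t, 1 <= t -> total_weight t <= M.
Proof.
have C0 : 0 < C by exact: lt_le_trans C_ge1.
have [K1 K10 HK1] := total_weight_velocity_le.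
have [w [Kw [w0 Kw0 Hw]]] := rate_power.
have [B HB] := energy_lower.
pose kap := 2 * C + 4 * C ^+ 2.
have kap0 : 0 < kap by rewrite addr_gt0 ?mulr_gt0// exprn_gt0.
pose c1 := (1 + Kw) / mu.
have c10 : 0 <= c1 by rewrite divr_ge0 ?addr_ge0// ltW.
pose c2 : R := 2 * n%:R.
have c20 : 0 <= c2 by rewrite mulr_ge0.
pose c3 := 2 * C * l%:R.
have c30 : 0 <= c3 by rewrite !mulr_ge0// ltW.
(* The coefficient of eta S collected at the end: from [c2 * S] times the remaining decrease of [U],
   from [energy_lower], and from the square-root potential; the [+ 1] makes it positive. *)
pose c4 := c2 + C * (n * n * l)%:R + c3 * (n * n)%:R * (2 * Num.sqrt (2 * kap)) + 1.
have c40 : 0 < c4.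
  by rewrite ltr_wpDl// !addr_ge0// ?mulr_ge0 ?sqrtr_ge0// ltW.
(* This makes c4 eta S at most half of S / K1, so that it can be absorbed. *)
pose eta := Num.min 1 (2 * K1 * c4)^-1.
have eta0 : 0 < eta by rewrite lt_min ltr01 invr_gt0 !mulr_gt0.
have eta1 : eta <= 1 by rewrite /eta ge_min lexx.
have [T1 T11 HT1] := heavy_edge_disagreement (exprn_gt0 2 eta0).
have [M [_ HM]] : \forall t \near +oo, U t < Uinf + eta.
  by apply: (cvgr_lt _ U_cvg); rewrite ltrDl.
pose T0 := Num.max T1 (M + 1).
have T01 : 1 <= T0 by rewrite le_max T11.
have UT0 : U T0 < Uinf + eta.
  by apply: HM; rewrite (@lt_le_trans _ _ (M + 1)) ?ltrDl// le_max lexx orbT.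
(* Everything here is fixed at [T0], independently of the end time [T]. *)
pose E1 := total_weight T0 / K1 + energy T0 + c1 +
  (\sum_i \sum_k \sum_j w i k j * th T0 i k j) + B.
exists (Num.max (total_weight T0) (2 * K1 * E1)) => T T1'.
have [TT0|/ltW TT0] := leP T T0.
  by rewrite le_max total_weight_nondecreasing ?gt0_ge1.
rewrite le_max; apply/orP; right.
have T1'' : 1 <= T by exact: le_trans TT0.
pose S := total_weight T; have S0 : 0 < S by exact: total_weight_gt0 (ge0_ge1 T1'').
pose delta := eta ^+ 2 * S; have delta0 : 0 < delta by rewrite mulr_gt0// exprn_gt0.
pose sq := Num.sqrt (delta * kap).
have sq0 : 0 <= sq by exact: sqrtr_ge0.
(* The growth of A / K1 is paid by the energy and by [c1 * U]; [c2 * S * U] pays for |L (x - xs)|^2,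
   the terms in [w] for the multipliers, and the last term for the weights. With [S] frozen all
   coefficients are constant on [T0, T]. *)
pose Psi t := total_weight t / K1 + energy t + (c1 + c2 * S) * U t +
  \sum_i \sum_k \sum_j w i k j * th t i k j - c3 * sq * sqrt_potential delta t.
have mono : Psi T <= Psi T0.
  apply: rd_le0_nonincreasing => // t /andP[T0t tT].
  have t1 : 1 <= t by exact: le_trans T0t.
  have t0 := gt0_ge1 t1; have t0' := ltW t0.
  have tS : total_weight t <= S by exact: total_weight_nondecreasing.
  have [c cD dU] := U_decay t0.
  have dth : rd (fun s => \sum_i \sum_k \sum_j w i k j * th s i k j) t
      (\sum_i \sum_k \sum_j w i k j * multiplier_rate t i k j).
    by do 3 (apply: rd_sum => ? _); apply: rdZ; exact: rd_th.
  have dA : rd (fun s => total_weight s / K1) t (total_weight_velocity t / K1).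
    have := rdZ K1^-1 (rd_total_weight t0).
    by rewrite mulrC; apply: rd_ext => s; rewrite mulrC.
  eexists; last first.
    exact: rdB (rdD (rdD (rdD dA (rd_energy t0)) (rdZ (c1 + c2 * S) dU)) dth)
      (rdZ (c3 * sq) (rd_sqrt_potential delta0 t0)).
  have f1 : total_weight_velocity t / K1 <= sqnorm (x t - xs) + sqnorm (velocity t).
    rewrite ler_pdivrMr// mulrC; apply: HK1 => i r k.
    by rewrite !mxE (xs_consensus i r); ring.
  have f2 := laplacian_sqnorm_le t0'.
  have f3 := weight_power_le t1.
  have f4 := Hw t t1.
  have Heta i q k : a t i q * `|x t i k - x t q k| <= eta ^+ 2 * S.
    have T1t : T1 <= t by rewrite (le_trans _ T0t)// le_max lexx.
    by rewrite (le_trans (HT1 t i q k T1t))// ler_pM2l// exprn_gt0.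
  have f5 := edge_power_le eta0 S0 t1 Heta.
  have f5' := ler_wpM2l (_ : 0 <= 2 * C) f5.
  have q0 : 0 <= inner (x t - xs) (L t *m (x t - xs)).
    apply: laplacian_quad_ge0; first exact: weights_sym.
    by move=> i q; exact: weights_ge0.
  have f6 : 2 * n%:R * total_weight t * inner (x t - xs) (L t *m (x t - xs)) <=
      c2 * S * inner (x t - xs) (L t *m (x t - xs)).
    by rewrite ler_wpM2r// ler_wpM2l.
  have f7 : (c1 + c2 * S) * c <= - ((1 + Kw) * sqnorm (x t - xs))
      - c2 * S * inner (x t - xs) (L t *m (x t - xs)).
    have cS0 : 0 <= c2 * S by rewrite mulr_ge0// ltW.
    apply: (le_trans (ler_wpM2l _ cD)); first by rewrite addr_ge0.
    have g1 : 0 <= c1 * inner (x t - xs) (L t *m (x t - xs)) by rewrite mulr_ge0.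
    have g2 : 0 <= c2 * S * (mu * sqnorm (x t - xs)).
      by rewrite !mulr_ge0 ?sqnorm_ge0// ltW.
    have g3 : c1 * (mu * sqnorm (x t - xs)) = (1 + Kw) * sqnorm (x t - xs).
      by rewrite mulrA divfK// gt_eqF.
    by rewrite /dissipation; lra.
  have {}f5' := f5' (mulr_ge0 (ler0n _ 2) (ltW C0)).
  rewrite -/delta -/kap -/sq in f5'.
  have f8 : 2 * C * edge_power t <= c3 * sq *
      \sum_i \sum_q weight_velocity t i q / Num.sqrt (a t i q + delta).
    by apply: (le_trans f5'); rewrite /c3 !mulrA.
  by lra.
have low := HB (eta ^+ 2) T T1'' (fun i q k => HT1 T i q k (le_trans (_ : T1 <= T0) TT0)).
have {}low : - B - C * (n * n * l)%:R * (eta ^+ 2 * S) <= energy T.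
  by apply: low; rewrite le_max lexx.
have UT := U_ge T1''.
have thT : 0 <= \sum_i \sum_k \sum_j w i k j * th T i k j.
  by do 3 (apply: sumr_ge0 => ? _); rewrite mulr_ge0// th_ge0// ge0_ge1.
have qT0 : 0 <= sqrt_potential delta T0.
  by do 2 (apply: sumr_ge0 => ? _); rewrite mulr_ge0// sqrtr_ge0.
(* Since delta = eta^2 S and both a_iq and delta are at most [S], the product delta kap (a_iq +
   delta) is at most 2 kap (eta S)^2. *)
have qT : sq * sqrt_potential delta T <= (n * n)%:R * (2 * Num.sqrt (2 * kap)) * (eta * S).
  rewrite /sqrt_potential mulr_sumr.
  apply: (@le_trans _ _ (\sum_(i < n) \sum_(q < n) 2 * Num.sqrt (2 * kap) * (eta * S))).
    apply: ler_sum => i _; rewrite mulr_sumr; apply: ler_sum => q _.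
    have dk0 : 0 <= delta * kap by rewrite mulr_ge0 ?(ltW delta0) ?(ltW kap0).
    have k20 : 0 <= 2 * kap by rewrite mulr_ge0 ?(ltW kap0).
    have eS0 : 0 <= eta * S by rewrite mulr_ge0 ?(ltW eta0) ?(ltW S0).
    rewrite mulrCA -mulrA ler_pM2l// -(sqrtrM _ dk0).
    have -> : eta * S = Num.sqrt ((eta * S) ^+ 2) by rewrite sqrtr_sqr ger0_norm.
    rewrite -(sqrtrM _ k20) ler_wsqrtr//.
    have aS : a T i q <= S by exact: weight_le_total (ge0_ge1 T1'').
    have dS : delta <= S by rewrite /delta ler_piMl ?exprn_ile1 ?(ltW eta0) ?(ltW S0).
    rewrite (_ : 2 * kap * (eta * S) ^+ 2 = delta * kap * (2 * S)); last by rewrite /delta; ring.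
    by rewrite ler_pM2l ?mulr_gt0//; lra.
  by rewrite !sumr_const !card_ord -mulrnA -[leLHS]mulr_natl !mulrA.
have qT' := ler_wpM2l c30 qT.
have eS : eta ^+ 2 * S <= eta * S by rewrite ler_pM2r// expr2 ler_piMr// ltW.
have g1 : C * (n * n * l)%:R * (eta ^+ 2 * S) <= C * (n * n * l)%:R * (eta * S).
  by rewrite ler_wpM2l// mulr_ge0// ltW.
have g2 : (c1 + c2 * S) * (U T0 - U T) <= c1 + c2 * (eta * S).
  have du : U T0 - U T <= eta by lra.
  have c0 : 0 <= c1 + c2 * S by rewrite addr_ge0// mulr_ge0// ltW.
  apply: (le_trans (ler_wpM2l c0 du)); rewrite mulrDl lerD//.
    by rewrite ler_piMr.
  by rewrite -mulrA [S * _]mulrC.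
have main : S / K1 <= E1 + c4 * (eta * S).
  move: mono; rewrite /Psi /E1 /c4 -/S.
  have g3 : 0 <= c3 * sq * sqrt_potential delta T0.
    exact: mulr_ge0 (mulr_ge0 c30 sq0) qT0.
  have g4 : 0 <= eta * S by exact: mulr_ge0 (ltW eta0) (ltW S0).
  by lra.
have half : c4 * (eta * S) <= S / K1 / 2.
  have : eta <= (2 * K1 * c4)^-1 by rewrite /eta ge_min lexx orbT.
  move=> /(ler_wpM2l (ltW (mulr_gt0 c40 S0))) H.
  rewrite (_ : S / K1 / 2 = c4 * S * (2 * K1 * c4)^-1); first by lra.
  by field; rewrite !gt_eqF.
have : S / K1 / 2 <= E1 by lra.
by rewrite -mulrA -invfM ler_pdivrMr ?mulr_gt0// => H; rewrite -/S; lra.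
Qed.

End Potential.

(** * Convergence *)

Section Convergence.
Variables (xs : 'M[R]_(n, l)) (ths0 : multipliers R m).
Hypothesis kkt_s : kkt_pair f g xs ths0.

Lemma trajectory_bounded_ge1 : exists C, [/\ 1 <= C,
  forall t i k, 1 <= t -> `|x t i k| <= C,
  forall t i k, 1 <= t -> `|alpha t i k| <= C &
  forall t i k j, 1 <= t -> `|th t i k j| <= C].
Proof.
have [C HC] := trajectory_bounded 0 kkt_s.
have C1 : C <= Num.max 1 C by rewrite le_max lexx orbT.
exists (Num.max 1 C); split; first by rewrite le_max lexx.
- by move=> t i k /HC[h _ _]; exact: le_trans C1.
- by move=> t i k /HC[_ h _]; exact: le_trans C1.
- by move=> t i k j /HC[_ _ h]; exact: le_trans C1.
Qed.

Lemma total_weight_bounded_ge1 : exists M, forall t, 1 <= t -> total_weight t <= M.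
Proof.
have [C [C1 xC alC thC]] := trajectory_bounded_ge1.
have [cs fs _ _ _] := kkt_s.
have [Uinf cU geU] := lyapunov_cvg 0 kkt_s.
apply: (total_weight_bounded cs fs cU geU _ C1 xC alC thC) => t t0.
exact: (lyapunov_decay 0 kkt_s t0).
Qed.

Lemma velocity_bounded_ge1 : exists2 V, 0 < V & forall i k t, 1 <= t -> `|velocity t i k| <= V.
Proof.
have [C [C1 xC alC thC]] := trajectory_bounded_ge1.
have [M HM] := total_weight_bounded_ge1.
have [K K0 HK] := velocity_bounded C1 xC alC thC.
have M0 : 0 < M by apply: lt_le_trans (HM 1 (lexx _)); exact: total_weight_gt0.
exists (K * M) => [|i k t t1]; first exact: mulr_gt0.
by rewrite (le_trans (HK i k t t1))// ler_pM2l// HM.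
Qed.

Lemma weights_cvg : exists2 al : 'M[R]_n, coupling_weights e al & mxcvg +oo%R a al.
Proof.
have [M HM] := total_weight_bounded_ge1.
have lim i q : exists2 al : R, a t i q @[t --> +oo] --> al & forall t, 1 <= t -> a t i q <= al.
  apply: (@nondecreasing_cvgy _ _ 1 M) => [s t s1 st|t t1].
    by apply: weights_nondecreasing => //; exact: gt0_ge1.
  exact: le_trans (weight_le_total i q (ge0_ge1 t1)) (HM t t1).
pose al := \matrix_(i, q) s2val (cid2 (lim i q)).
have cal i q : a t i q @[t --> +oo] --> al i q by rewrite mxE; case: cid2.
exists al => // i q; split.
  have sym : a t q i @[t --> +oo] --> al i q.
    apply: cvg_trans (cal i q); apply: near_eq_cvg; near=> t.
    have t0 : 0 <= t by near: t; apply: nbhs_pinfty_ge; exact: num_real.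
    by have [] := sol_weights sol t0 i q.
  exact: cvg_unique _ sym (cal q i).
have [_] := sol_weights sol ler01 i q; case: ifPn => eiq.
  (* The weights only grow, so the limit stays positive on the edges and the limit graph is still
     connected. *)
  move=> a0; have le_al : a 1 i q <= al i q by rewrite mxE; case: cid2 => ? /= _ H; exact: H.
  exact: lt_le_trans le_al.
move=> _; apply/eqP.
have zero : a t i q @[t --> +oo] --> (0 : R).
  have : cst (0 : R) (t : R) @[t --> +oo] --> (0 : R) by exact: cvg_cst.
  apply: cvg_trans; apply: near_eq_cvg; near=> t.
  have t0 : 0 <= t by near: t; apply: nbhs_pinfty_ge; exact: num_real.
  by have [_] := sol_weights sol t0 i q; rewrite (negbTE eiq) => /eqP.
exact: cvg_unique _ (cal i q) zero.
Unshelve. all: by end_near. Qed.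

(** A Barbalat argument: the velocity being bounded by [V], a deviation [eps] at a late time stays
    above eps / 2 for a time [sg] = eps / (2 V). The Lyapunov function would then lose ka sg, with
    ka = mu eps^2 / 4, which is more than it has left. *)
Lemma x_cvg_xs : mxcvg +oo%R x xs.
Proof.
have [V V0 HV] := velocity_bounded_ge1.
have [Uinf cU geU] := lyapunov_cvg 0 kkt_s; set U := lyapunov xs 0 ths0 in cU geU.
move=> i k; apply/cvgrPdist_le => eps eps0.
pose sg := eps / (2 * V); pose ka := mu * (eps ^+ 2 / 4).
have sg0 : 0 < sg by rewrite divr_gt0// mulr_gt0.
have ka0 : 0 < ka by rewrite mulr_gt0// divr_gt0// exprn_gt0.
have nU : \forall t \near +oo, U t < Uinf + ka * sg.
  by apply: (cvgr_lt _ cU); rewrite ltrDl mulr_gt0.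
near=> t.
have t1 : 1 <= t by near: t; apply: nbhs_pinfty_ge; exact: num_real.
have Ut : U t < Uinf + ka * sg by near: t.
rewrite distrC leNgt; apply/negP => far.
have tv : t <= t + sg by rewrite lerDl ltW.
have decay : U (t + sg) + ka * (t + sg) <= U t + ka * t.
  apply: (@rd_le0_nonincreasing _ (fun s => U s + ka * s)) => // s /andP[ts sv].
  have s1 : 1 <= s by exact: le_trans ts.
  have [c cD dU] := lyapunov_decay 0 kkt_s (gt0_ge1 s1).
  have did : rd (fun s : R => s) s 1 by apply: is_derive_rd; exact: is_derive_id.
  exists (c + ka * 1); last exact: rdD dU (rdZ _ did).
  have drift : `|x s i k - x t i k| <= V * (s - t).
    apply: (@rd_increment_le _ (fun s => x s i k)) => // u /andP[tu _].
    have u1 : 1 <= u by exact: le_trans tu.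
    by exists (velocity u i k); [exact: HV|exact: mrd_x (gt0_ge1 u1) _ _].
  have small : V * (s - t) <= eps / 2.
    rewrite mulrC -ler_pdivlMr// (_ : eps / 2 / V = sg); first by lra.
    by rewrite /sg; field; rewrite gt_eqF.
  have big : eps / 2 <= `|x s i k - xs i k|.
    have := ler_distD (x s i k) (x t i k) (xs i k); rewrite [`|x t i k - x s i k|]distrC.
    by lra.
  have sq : eps ^+ 2 / 4 <= (x s i k - xs i k) ^+ 2.
    rewrite -[leRHS]real_normK ?num_real// (_ : eps ^+ 2 / 4 = (eps / 2) ^+ 2); last by field.
    by rewrite ler_pXn2r ?nnegrE// divr_ge0// ltW.
  have ent := entry_le_sqnorm (x s - xs) i k; rewrite !mxE in ent.
  have q0 : 0 <= inner (x s - xs) (L s *m (x s - xs)).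
    apply: laplacian_quad_ge0; first exact: weights_sym (ge0_ge1 s1).
    by move=> i' q'; exact: weights_ge0 (ge0_ge1 s1).
  have : ka <= mu * sqnorm (x s - xs) by rewrite ler_pM2l// (le_trans sq).
  by rewrite /dissipation in cD; lra.
have := geU _ (le_trans t1 tv); lra.
Unshelve. all: by end_near. Qed.

Variable al : 'M[R]_n.
Hypothesis weights_al : coupling_weights e al.
Hypothesis a_al : mxcvg +oo%R a al.
Arguments a_al : clear implicits.
Arguments x_cvg_xs : clear implicits.
Local Notation Loo := (laplacian al).

Lemma Lx_cvg0 : mxcvg +oo%R (fun t => L t *m x t) 0.
Proof.
have [cs _ _ _ _] := kkt_s.
rewrite -(laplacian_consensus (coupling_sym_loopless graph_e weights_al) cs).
by apply: mxcvg_mul; [exact: mxcvg_laplacian|exact: x_cvg_xs].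
Qed.

Lemma constraint_cvg_xs i k j : g i k j (x t i k) @[t --> +oo] --> g i k j (xs i k).
Proof.
by apply: continuous_cvg; [apply: derivable_cvg; exact: g_diff|exact: x_cvg_xs].
Qed.

Arguments constraint_cvg_xs : clear implicits.

Lemma alpha_slow i k : slow (fun t => alpha t i k).
Proof.
apply: (@slow_rd _ _ (fun t => (L t *m x t) i k)) => [t t1|].
  exact: mrd_alpha (gt0_ge1 t1) _ _.
by have := @Lx_cvg0 i k; rewrite mxE.
Qed.

(** Once g <= - c the multiplier is nonincreasing, and a positive limit would make it decrease at
    speed at least [c] forever. *)
Lemma th_inactive_cvg0 i k j : g i k j (xs i k) < 0 -> th t i k j @[t --> +oo] --> (0 : R).
Proof.
move=> gneg; pose c := - g i k j (xs i k) / 2.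
have c0 : 0 < c by rewrite divr_gt0// oppr_gt0.
have [M [_ HM]] : \forall t \near +oo, g i k j (x t i k) <= - c.
  by apply: (cvgr_le _ (constraint_cvg_xs i k j)); rewrite /c; lra.
pose T := Num.max 1 (M + 1).
have gT t : T <= t -> 1 <= t /\ g i k j (x t i k) <= - c.
  rewrite ge_max => /andP[t1 tM]; split=> //; apply: HM.
  by rewrite (lt_le_trans _ tM)// ltrDl.
have rate_le t : T <= t -> multiplier_rate t i k j <= 0.
  move=> /gT[_ gt]; rewrite /multiplier_rate /pos_proj; case: ifP => // _.
  by rewrite (le_trans gt)// oppr_le0 ltW.
have [p cp Hp] : exists2 p : R, th t i k j @[t --> +oo] --> p & forall t, T <= t -> p <= th t i k j.
  apply: (@nonincreasing_cvgy _ _ T 0) => [s t sT st|t /gT[t1 _]].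
    apply: (@rd_le0_nonincreasing _ (fun t => th t i k j)) => // u /andP[su _].
    have uT : T <= u by exact: le_trans su.
    have [u1 _] := gT u uT; exists (multiplier_rate u i k j); first exact: rate_le.
    exact: rd_th (gt0_ge1 u1).
  exact: th_ge0 (ge0_ge1 t1).
suff -> : 0 = p by [].
have p0 : 0 <= p.
  apply: (cvgr_to_ge cp); near=> t; apply: th_ge0; apply: ge0_ge1.
  by near: t; exact: near_ge1.
apply/le_anti; rewrite p0 leNgt; apply/negP => pgt0.
(* By this time the linear decrease would have brought the multiplier down to -1. *)
pose t := T + (th T i k j + 1) / c.
have thT : 0 <= th T i k j by apply: th_ge0; rewrite (@le_trans _ _ 1)// le_max lexx.
have Tt : T <= t by rewrite lerDl divr_ge0 ?(ltW c0)// addr_ge0.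
have : th t i k j + c * t <= th T i k j + c * T.
  apply: (@rd_le0_nonincreasing _ (fun t => th t i k j + c * t)) => // u /andP[Tu _].
  have [u1 gu] := gT u Tu.
  have did : rd (fun s : R => s) u 1 by apply: is_derive_rd; exact: is_derive_id.
  exists (multiplier_rate u i k j + c * 1); last exact: rdD (rd_th j (gt0_ge1 u1)) (rdZ c did).
  rewrite /multiplier_rate /pos_proj (lt_le_trans pgt0 (Hp u Tu)) /=.
  by rewrite mulr1 -lerBrDr sub0r.
rewrite /t mulrDr mulrCA divff ?gt_eqF// mulr1.
by have := Hp _ Tt; lra.
Unshelve. all: by end_near. Qed.

(** For a constraint inactive at [xs] the multiplier converges; for an active one the rate is at
    most |g(x)|, which tends to 0. *)
Lemma th_slow i k j : slow (fun t => th t i k j).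
Proof.
have [_ fs _ _ _] := kkt_s; have := fs i k j; rewrite le_eqVlt => /predU1P[g0|gneg]; last first.
  exact: slow_cvg (th_inactive_cvg0 gneg).
apply: (@slow_rd _ _ (fun t => multiplier_rate t i k j)) => [t t1|].
  exact: rd_th (gt0_ge1 t1).
have cg := constraint_cvg_xs i k j; rewrite g0 in cg.
apply/cvgrPdist_le => eps eps0; move/cvgrPdist_le : cg => /(_ _ eps0).
apply: filterS => t; rewrite !sub0r !normrN /multiplier_rate /pos_proj; case: ifP => // _.
by move=> _; rewrite normr0 ltW.
Qed.

(** The time [s] depends on the entry (i, k), so the limit of the velocity is later computed one
    entry at a time. *)
Lemma mean_velocity i k t : 1 <= t -> exists s,
  t <= s <= t + 1 /\ x (t + 1) i k - x t i k = velocity s i k.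
Proof.
move=> t1.
have tt1 : t <= t + 1 by rewrite lerDl.
have dx s : s \in `]t, t + 1[ -> is_derive s 1 (fun s => x s i k) (velocity s i k).
  rewrite in_itv /= => /andP[ts _]; apply: is_derive_entry; apply: (sol_x sol).
  by rewrite (lt_trans _ ts)// gt0_ge1.
have cx : {within `[t, t + 1], continuous (fun s => x s i k)}.
  apply: continuous_in_subspaceT => s; rewrite inE /= in_itv /= => /andP[ts _].
  by apply: x_cvg; rewrite (lt_le_trans _ ts)// gt0_ge1.
have [s sI Es] := MVT_segment tt1 dx cx.
exists s; split; first by move: sI; rewrite in_itv.
by rewrite Es addrAC subrr add0r mulr1.
Qed.

(* Along an ultrafilter finer than +oo every bounded function converges. The
   limit of the velocity vanishes because x converges while alpha and theta
   vary slowly: by the mean value theorem the velocity is x (t + 1) - x t at a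
   point of [t, t + 1]. *)
Lemma ultra_limit_kkt : exists (G : set_system R) (alh : 'M[R]_(n, l)) (thh : multipliers R m),
  [/\ ProperFilter G, +oo%R `<=` G, mxcvg G alpha alh,
      forall i k j, th t i k j @[t --> G] --> thh i k j &
      kkt_pair f g xs thh /\
      Loo *m alh = - (gradient F xs + constraint_force g xs thh)].
Proof.
have [G [UG ooG]] := @ultraFilterLemma R +oo%R _.
have PG : ProperFilter G by exact: ultra_proper.
have [C [C1 xC alC thC]] := trajectory_bounded_ge1.
have G1 : \forall t \near G, 1 <= t by exact: ooG (near_ge1 R).
have lal i k : exists p : R, alpha t i k @[t --> G] --> p.
  by apply: (ultra_bounded_cvg (C := C) UG); apply: filterS G1 => t; exact: alC.
have lth i k j : exists p : R, th t i k j @[t --> G] --> p.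
  by apply: (ultra_bounded_cvg (C := C) UG); apply: filterS G1 => t; exact: thC.
pose alh : 'M[R]_(n, l) := \matrix_(i, k) sval (cid (lal i k)).
pose thh : multipliers R m := fun i k j => sval (cid (lth i k j)).
have cal : mxcvg G alpha alh by move=> i k; rewrite mxE; exact: svalP (cid (lal i k)).
have cth i k j : th t i k j @[t --> G] --> thh i k j by exact: svalP (cid (lth i k j)).
have toG (phi : R -> R) (p : R) : phi t @[t --> +oo] --> p -> phi t @[t --> G] --> p.
  by move=> H B /H /ooG.
have vel0 i k : - gradient F xs i k - (Loo *m xs) i k - (Loo *m alh) i k
    - constraint_force g xs thh i k = 0.
  (* The guard makes [tau] a total function, with an arbitrary value before time 1. *)
  have tauE t : exists s, 1 <= t -> t <= s <= t + 1 /\ x (t + 1) i k - x t i k = velocity s i k.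
    have [t1|_] := boolP (1 <= t); last by exists t.
    by have [s Hs] := mean_velocity i k t1; exists s.
  pose tau t := sval (cid (tauE t)).
  have tauI t : 1 <= t -> t <= tau t <= t + 1 by move=> /(svalP (cid (tauE t)))[].
  have cx : mxcvg G (fun t => x (tau t)) xs.
    move=> i' k'; have cxG := toG _ _ (x_cvg_xs i' k').
    exact: (@slow_shift _ (fun t => x t i' k') tau _ G PG ooG (slow_cvg (x_cvg_xs i' k')) tauI cxG).
  have calt : mxcvg G (fun t => alpha (tau t)) alh.
    move=> i' k'; exact: (@slow_shift _ (fun t => alpha t i' k') tau _ G PG ooG
      (@alpha_slow i' k') tauI (@cal i' k')).
  have cat : mxcvg G (fun t => a (tau t)) al.
    move=> i' k'; have caG := toG _ _ (a_al i' k').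
    exact: (@slow_shift _ (fun t => a t i' k') tau _ G PG ooG (slow_cvg (a_al i' k')) tauI caG).
  have ctht i' k' j : th (tau t) i' k' j @[t --> G] --> thh i' k' j.
    exact: (@slow_shift _ (fun t => th t i' k' j) tau _ G PG ooG
      (@th_slow i' k' j) tauI (@cth i' k' j)).
  have cgrad : gradient F (x (tau t)) i k @[t --> G] --> gradient F xs i k.
    rewrite gradient_objective//; under eq_fun do rewrite gradient_objective//.
    have crow : mxcvg G (fun t => row i (x (tau t))) (row i xs).
      by move=> i' k'; rewrite mxE; under eq_fun do rewrite mxE; exact: cx.
    have crow' : row i (x (tau t)) @[t --> G] --> row i xs by exact: mxcvg_cvg crow.
    have cpart := partial_cvg f_diff (i := i) (k := k) (z := row i xs).
    exact: (@cvg_comp _ _ _ (fun t => row i (x (tau t))) ('D_(delta_mx 0 k) (f i))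
      _ _ _ crow' cpart).
  have cforce : constraint_force g (x (tau t)) (th (tau t)) i k @[t --> G] -->
      constraint_force g xs thh i k.
    rewrite mxE; under eq_fun do rewrite mxE.
    apply: cvg_sumr => j _; apply: cvgM; first exact: ctht.
    by apply: continuous_cvg; [exact: convex_derive1_cvg|exact: cx].
  have cvel : velocity (tau t) i k @[t --> G] --> - gradient F xs i k - (Loo *m xs) i k
      - (Loo *m alh) i k - constraint_force g xs thh i k.
    under eq_fun do rewrite velocityE.
    have cL : mxcvg G (fun t => L (tau t)) Loo by exact: mxcvg_laplacian.
    have cLx : mxcvg G (fun t => L (tau t) *m x (tau t)) (Loo *m xs) by exact: mxcvg_mul.
    have cLal : mxcvg G (fun t => L (tau t) *m alpha (tau t)) (Loo *m alh) by exact: mxcvg_mul.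
    apply: cvgB; last exact: cforce.
    apply: cvgB; last exact: cLal.
    apply: cvgB; last exact: cLx.
    exact: cvgN.
  have cdiff : (x (t + 1) i k - x t i k) @[t --> G] --> (0 : R).
    apply: toG; rewrite -(subrr (xs i k)); apply: cvgB; last exact: x_cvg_xs.
    exact: (@cvg_comp _ _ _ (fun t => t + 1) (fun t => x t i k) _ _ _ (cvg_addrr 1) (x_cvg_xs i k)).
  have cvel0 : velocity (tau t) i k @[t --> G] --> (0 : R).
    apply: cvg_trans cdiff; apply: near_eq_cvg.
    by apply: filterS G1 => t t1; have [_ ->] := svalP (cid (tauE t)) t1.
  exact: cvg_unique _ cvel cvel0.
have [cs fs _ _ _] := kkt_s.
have saddle : Loo *m alh = - (gradient F xs + constraint_force g xs thh).
  have Lxs := laplacian_consensus (coupling_sym_loopless graph_e weights_al) cs.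
  apply/matrixP => i k; have := vel0 i k; rewrite Lxs [X in _ - X - _ - _]mxE => H.
  by rewrite [RHS]mxE [(gradient F xs + _) i k]mxE; lra.
exists G, alh, thh; split => //; split => //; split => //.
- move=> i k j; apply: (cvgr_to_ge (cth i k j)); apply: filterS G1 => t t1.
  exact: th_ge0 (ge0_ge1 t1).
- move=> i k j; have := fs i k j; rewrite le_eqVlt => /predU1P[->|gneg]; first by rewrite mulr0.
  have -> : thh i k j = 0 by exact: cvg_unique _ (cth i k j) (toG _ _ (th_inactive_cvg0 gneg)).
  by rewrite mul0r.
- move=> k; have := laplacian_column_sum alh k (coupling_sym_loopless graph_e weights_al).
  rewrite saddle => H; rewrite -[LHS]opprK -sumrN -[RHS]oppr0; congr (- _); rewrite -[RHS]H.
  by apply: eq_bigr => i _; rewrite [RHS]mxE.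
Qed.

Lemma trajectory_cvg : exists (alh : 'M[R]_(n, l)) (thh : multipliers R m),
  [/\ mxcvg +oo%R alpha alh, forall i k j, th t i k j @[t --> +oo] --> thh i k j,
      kkt_pair f g xs thh &
      Loo *m alh = - (gradient F xs + constraint_force g xs thh)].
Proof.
have [G [alh [thh [PG ooG cal cth [kkt_h Lal]]]]] := ultra_limit_kkt.
have toG (phi : R -> R) (p : R) : phi t @[t --> +oo] --> p -> phi t @[t --> G] --> p.
  by move=> H B /H /ooG.
have [w cw] := gap_energy_cvg alh kkt_h.
(* With [alh] as [beta], [rhs_star] equals [grounded al *m alh], so that [alpha_star] tends to [alh]
   itself and not to another solution with different column means. *)
have castar : mxcvg +oo%R (alpha_star xs alh thh) alh.
  have cP : mxcvg +oo%R (fun t => invmx (grounded (a t))) (invmx (grounded al)).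
    apply: mxcvg_invmx.
    - near=> t; apply: (grounded_unit graph_e); apply: (sol_weights sol); apply: ge0_ge1.
      by near: t; exact: near_ge1.
    - exact: grounded_unit weights_al.
    - by apply: mxcvgD; [exact: mxcvg_laplacian|exact: mxcvg_cst].
  have rhsE : rhs_star xs alh thh = grounded al *m alh.
    by rewrite /rhs_star /grounded mulmxDl Lal addrC.
  have alhE : invmx (grounded al) *m rhs_star xs alh thh = alh.
    by rewrite rhsE mulmxA mulVmx ?mul1mx//; exact: grounded_unit weights_al.
  have : mxcvg +oo%R (fun t => invmx (grounded (a t)) *m rhs_star xs alh thh)
      (invmx (grounded al) *m rhs_star xs alh thh).
    by apply: mxcvg_mul => //; exact: mxcvg_cst.
  by rewrite alhE.
have w0 : w = 0.
  have cx : mxcvg G (fun t => x t - xs) (xs - xs).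
    apply: mxcvgD; last exact: mxcvg_cst.
    by move=> i k; apply: toG; exact: x_cvg_xs.
  have cA : mxcvg G (fun t => alpha t - alpha_star xs alh thh t) (alh - alh).
    apply: mxcvgD => //; apply: mxcvgN => i k; apply: toG; exact: castar.
  have csum : (\sum_i \sum_k \sum_j (th t i k j - thh i k j) * (th t i k j - thh i k j)) @[t --> G]
      --> \sum_i \sum_k \sum_(j < m i k) (0 : R) * 0.
    apply: cvg_sumr => i _; apply: cvg_sumr => k _; apply: cvg_sumr => j _.
    have c0 : (th t i k j - thh i k j) @[t --> G] --> (0 : R).
      by rewrite -(subrr (thh i k j)); apply: cvgB; [exact: cth|exact: cvg_cst].
    exact: cvgM.
  have cgap : gap_energy xs alh thh t @[t --> G] --> 2^-1 * (sqnorm (xs - xs) + sqnorm (alh - alh) +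
      \sum_i \sum_k \sum_(j < m i k) (0 : R) * 0).
    apply: cvgM; first exact: cvg_cst.
    by apply: cvgD => //; apply: cvgD; exact: cvg_sqnorm.
  have -> : w = 2^-1 * (sqnorm (xs - xs) + sqnorm (alh - alh) +
      \sum_i \sum_k \sum_(j < m i k) (0 : R) * 0) by exact: cvg_unique _ (toG _ _ cw) cgap.
  rewrite !subrr /sqnorm !inner0r !add0r big1 ?mulr0// => i _.
  by rewrite big1// => k _; rewrite big1// => j _; rewrite mulr0.
rewrite w0 in cw.
have gapE t : 2 * gap_energy xs alh thh t = sqnorm (x t - xs) +
    sqnorm (alpha t - alpha_star xs alh thh t) +
    \sum_i \sum_k \sum_j (th t i k j - thh i k j) * (th t i k j - thh i k j).
  by rewrite /gap_energy mulrA divff// mul1r.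
have sum0 t : 0 <= \sum_i \sum_k \sum_j (th t i k j - thh i k j) * (th t i k j - thh i k j).
  by do 3 (apply: sumr_ge0 => ? _); rewrite -expr2 sqr_ge0.
exists alh, thh; split => //.
- move=> i k.
  have c0 : (alpha t i k - alpha_star xs alh thh t i k) @[t --> +oo] --> (0 : R).
    apply: cvg0_of_sqr cw _ => t; rewrite gapE.
    have := entry_le_sqnorm (alpha t - alpha_star xs alh thh t) i k; rewrite !mxE.
    by have := sqnorm_ge0 (x t - xs); have := sum0 t; lra.
  have : (alpha t i k - alpha_star xs alh thh t i k + alpha_star xs alh thh t i k) @[t --> +oo]
      --> 0 + alh i k by apply: cvgD => //; exact: castar.
  by rewrite add0r; under eq_fun do rewrite subrK.
- move=> i k j.
  have c0 : (th t i k j - thh i k j) @[t --> +oo] --> (0 : R).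
    apply: cvg0_of_sqr cw _ => t; rewrite gapE.
    have : (th t i k j - thh i k j) ^+ 2 <=
        \sum_i \sum_k \sum_j (th t i k j - thh i k j) * (th t i k j - thh i k j).
      rewrite (bigD1 i)//= (bigD1 k)//= (bigD1 j)//= expr2 -!addrA lerDl !addr_ge0//.
      + by apply: sumr_ge0 => ? _; rewrite -expr2 sqr_ge0.
      + by do 2 (apply: sumr_ge0 => ? _); rewrite -expr2 sqr_ge0.
      + by do 3 (apply: sumr_ge0 => ? _); rewrite -expr2 sqr_ge0.
    by have := sqnorm_ge0 (x t - xs); have := sqnorm_ge0 (alpha t - alpha_star xs alh thh t); lra.
  have : (th t i k j - thh i k j + thh i k j) @[t --> +oo] --> 0 + thh i k j.
    by apply: cvgD => //; exact: cvg_cst.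
  by rewrite add0r; under eq_fun do rewrite subrK.
Unshelve. all: by end_near. Qed.

End Convergence.

End Dynamics.

(** * KKT points are saddle points *)

Section Saddle.
Variables (R : realType) (n l : nat) (m : 'I_n -> 'I_l -> nat).
Variables (e : rel 'I_n) (f : 'I_n -> 'rV[R]_l -> R) (g : constraints R m) (mu kappa : R).
Arguments g : clear implicits.
Hypothesis graph_e : connected_graph e.
Hypothesis f_diff : forall i, twice_differentiable (f i).
Hypothesis g_convex : forall i k (j : 'I_(m i k)), convex_function [set: R^o] (g i k j).
Hypothesis g_diff : forall i k (j : 'I_(m i k)) (z : R), derivable (g i k j) z 1.
Hypothesis mu_gt0 : 0 < mu.
Hypothesis f_smooth : strongly_convex_smooth mu kappa (objective f).
Variables (al : 'M[R]_n) (xs alphas : 'M[R]_(n, l)) (ths : multipliers R m).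
Arguments ths : clear implicits.
Hypothesis weights_al : coupling_weights e al.
Hypothesis kkt_s : kkt_pair f g xs ths.
Hypothesis stationary : laplacian al *m alphas =
  - (gradient (objective f) xs + constraint_force g xs ths).

Lemma kkt_pair_kkt : kkt f g e al xs alphas ths.
Proof.
have [cs fs ths0 comp _] := kkt_s; split => // i k.
have sal := coupling_sym_loopless graph_e weights_al.
have := congr1 (fun A : 'M[R]_(n, l) => A i k) stationary => /=.
rewrite laplacian_mulE//.
rewrite [RHS]mxE [(gradient _ _ + _) i k]mxE gradient_objective// [constraint_force _ _ _ _ _]mxE.
rewrite (bigID (e i)) /= [X in _ + X = _]big1 => [|q /negbTE eiq]; last first.
  by have [_] := weights_al i q; rewrite eiq => /eqP ->; rewrite mul0r.
by move=> H; lra.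
Qed.

(** The left inequality is a matter of signs, since [xs] is a consensus and complementarity holds.
    For the right one, the tangents of the objective and of the constraints at [xs] have linear
    parts that stationarity cancels against the term in [alphas]. *)
Lemma kkt_pair_saddle : saddle_point f g al xs alphas ths.
Proof.
have [cs fs ths0 comp _] := kkt_s.
have sal := coupling_sym_loopless graph_e weights_al.
have Lxs := laplacian_consensus sal cs.
have comp0 : ineq_term g xs ths = 0.
  by rewrite /ineq_term big1// => i _; rewrite big1// => k _; rewrite big1.
split=> // X alpha th th0; rewrite /network_lagrangian Lxs !inner0r comp0 !addr0.
apply/andP; split.
  rewrite gerDl; do 3 (apply: sumr_le0 => ? _).
  by rewrite mulr_ge0_le0// ?th0// fs.
have T := objective_tangent f_diff f_smooth xs X.
have E : inner alphas (laplacian al *m X) = - inner (gradient (objective f) xs) (X - xs)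
    - inner (constraint_force g xs ths) (X - xs).
  have -> : laplacian al *m X = laplacian al *m (X - xs) by rewrite mulmxBr Lxs subr0.
  by rewrite inner_laplacianC// stationary innerNl innerDl opprD.
have H : inner (constraint_force g xs ths) (X - xs) <= ineq_term g X ths.
  apply: ler_sum => i _; apply: ler_sum => k _.
  rewrite mxE [(X - xs) i k]mxE [(- xs) i k]mxE mulr_suml; apply: ler_sum => j _.
  have := convex_tangent (@g_convex i k j) (@g_diff i k j) (xs i k) (X i k).
  move=> /(ler_wpM2l (ths0 i k j)); rewrite mulrDr comp add0r mulrA => /le_trans; apply.
  by [].
have := sqnorm_ge0 (X - xs) => s0.
have : 0 <= mu / 2 * sqnorm (X - xs) by rewrite mulr_ge0// divr_ge0// ltW.
lra.
Qed.

End Saddle.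

(** The stationarity condition involves the weights, which move, so it is stated at their limit
    [a_lim]. The point [xs] is fixed in advance by optimality, whereas [alphas] and [ths] are
    selected by the trajectory. *)
Theorem proposition2p7 (R : realType) (n l : nat) (m : 'I_n -> 'I_l -> nat)
  (e : rel 'I_n) (f : 'I_n -> 'rV[R]_l -> R) (g : constraints R m)
  (d : 'M[R]_n) (mu kappa : R)
  (x : R -> 'M[R]_(n, l)) (a : R -> 'M[R]_n) (alpha : R -> 'M[R]_(n, l))
  (th : R -> multipliers R m)
  (graph_e : connected_graph e)
  (f_diff : forall i, twice_differentiable (f i))
  (f_convex : forall i, strongly_convex (f i))
  (g_convex : forall i k (j : 'I_(m i k)), convex_function [set: R^o] (g i k j))
  (g_diff : forall i k (j : 'I_(m i k)) (z : R), derivable (g i k j) z 1)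
  (slater_g : slater g)
  (duality : strong_duality f g)
  (mu_gt0 : 0 < mu)
  (f_smooth : strongly_convex_smooth mu kappa (objective f))
  (d_gain : forall i q, e i q -> 0 < d i q /\ d i q = d q i)
  (rate_lip : forall i q, e i q -> lipschitz_on_bounded (@weight_rate R l (d i q)))
  (sol : hybrid_solution f g e d x a alpha th) :
  exists (xs : 'M[R]_(n, l)) (alphas : 'M[R]_(n, l)) (ths : multipliers R m)
         (a_lim : 'M[R]_n),
    [/\ [/\ x t @[t --> +oo] --> xs,
            alpha t @[t --> +oo] --> alphas,
            forall i k j, th t i k j @[t --> +oo] --> ths i k j
          & a t @[t --> +oo] --> a_lim],
        coupling_weights e a_lim,
        saddle_point f g a_lim xs alphas ths
      & kkt f g e a_lim xs alphas ths].
Proof.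
have [xs [ths0 kkt0]] := kkt_pair_exists f_diff f_smooth mu_gt0 g_convex g_diff slater_g.
have [al weights_al a_al] :=
  weights_cvg graph_e f_diff g_convex g_diff mu_gt0 f_smooth d_gain sol kkt0.
have x_xs := x_cvg_xs graph_e f_diff g_convex g_diff mu_gt0 f_smooth d_gain sol kkt0.
have [alh [thh [cal cth kkt_h Lal]]] :=
  trajectory_cvg graph_e f_diff g_convex g_diff mu_gt0 f_smooth d_gain sol kkt0 weights_al a_al.
exists xs, alh, thh, al; split=> //.
- by split=> //; exact: mxcvg_cvg.
- exact: (kkt_pair_saddle graph_e f_diff g_convex g_diff mu_gt0 f_smooth weights_al kkt_h Lal).
- exact: (kkt_pair_kkt graph_e f_diff weights_al kkt_h Lal).
Qed.
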